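(* Let $C$ be an algebraic curve in $\mathbb{C}^2$ of degree $d$, and let $S\subset C$ be a finite set of size $n$. Then the number of four-point circles spanned by $S$ is $O(n^{8/3})$, where the constant of proportionality depends on $d$, unless $C$ contains a curve of degree at most four.
   Context: A circle in $\mathbb{C}^2$ is a set of the form $\{(x,y)\in\mathbb{C}^2\mid (x-a)^2+(y-b)^2=r\}$ with $a,b,r\in\mathbb{C}$, $r\neq 0$. A four-point circle spanned by $S$ is a circle incident to at least four points of $S$. The constant of proportionality depends only on $d$. *)

(* Defs.v *)
(* mpoly must be imported before the MathComp-Analysis files: the opposite
   order fails because their notations clash. *)
From mathcomp Require Import all_boot all_order all_algebra.
From mathcomp Require Import finmap complex mpoly.
From mathcomp Require Import all_classical all_reals.

Set Implicit Arguments.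
Unset Strict Implicit.
Unset Printing Implicit Defensive.

Import Order.TTheory GRing.Theory Num.Theory.
Local Open Scope fset_scope.
Local Open Scope classical_set_scope.
Local Open Scope ring_scope.

Definition eval2 (R : realType) (f : {mpoly R[i][2]}) (p : R[i] * R[i]) : R[i] :=
  f.@[fun k : 'I_2 => if k == ord0 then p.1 else p.2].

Definition zero_set (R : realType) (f : {mpoly R[i][2]}) : set (R[i] * R[i]) :=
  [set p | eval2 f p = 0].

(* A curve is the zero set of a nonconstant polynomial; its degree is the least
   total degree of a defining polynomial, so repeated factors do not count.
   Recall that msize f is the total degree of f plus one. *)
Definition curve_of_degree (R : realType) (C : set (R[i] * R[i])) (d : nat) : Prop :=
  [/\ (0 < d)%N,
      exists2 f : {mpoly R[i][2]}, C = zero_set f & msize f = d.+1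
    & forall g : {mpoly R[i][2]}, C = zero_set g -> (d < msize g)%N].

Definition circle (R : realType) (a b r : R[i]) : set (R[i] * R[i]) :=
  [set p | (p.1 - a) ^+ 2 + (p.2 - b) ^+ 2 = r].

Definition is_circle (R : realType) (X : set (R[i] * R[i])) : Prop :=
  exists a b r : R[i], r != 0 /\ X = circle a b r.

Definition four_point_circles (R : realType) (S : {fset R[i] * R[i]}) :
    set (set (R[i] * R[i])) :=
  [set X | is_circle X /\ (4 <= #|` [fset p in S | p \in X]|)%N].

(* Main.v *)
(* Lift (x, y) to (1, x, y, x^2 + y^2) in C^4.  The lifted points lie on a quadric, and four points
   are on a circle only if the line through the first two lifts meets the line through the last two.
   So it suffices to bound the incidences between pairs (p, q) and pairs (s, t) of points of S.  For
   fixed (p, q), eliminating the ordinates by means of the equation of C leaves a polynomial relation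
   of bounded degree between the abscissas of s and t, so these incidences are between points of a
   Cartesian product A x A and n^2 plane curves.

   The product is cut into about r^2 cells, each with at most m^2 points, m r ~ n.  The cells are
   products of annuli, and a curve avoiding finitely many test lines of such a product avoids the
   product: on it one monomial of its equation dominates all others.  This gives O(r) cells per curve,
   and O(n^2 (r + m^2)) = O(n^(8/3)) incidences, provided that two pairs (s, t), (s', t') have boundedly
   many common partners, up to boundedly many exceptional (s', t') for each (s, t).

   If the lines of (s, t) and (s', t') meet, infinitely many common partners force the meeting point o
   to be a centre: the reflection in o preserving the quadric maps a component of C to a component.
   Compositions of two such reflections have bounded order, because their orbits are in planes, so the
   products of the normalised centres take boundedly many values and there are boundedly many centres;
   the quadruples whose lines pass through a centre contribute O(n^2).  If the lines are skew, q is
   determined by p, and too many exceptional pairs put infinitely many points of C on one quadric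
   section, which is a curve of degree at most four. *)

Require Import Defs.
From mathcomp Require Import all_boot all_order all_algebra.
From mathcomp Require Import perm finmap complex mpoly.
From mathcomp Require Import all_classical all_reals exp.
From mathcomp Require Import closed_field ring lra zify.

Set Implicit Arguments.
Unset Strict Implicit.
Unset Printing Implicit Defensive.

Import Order.TTheory GRing.Theory Num.Theory.
Local Open Scope fset_scope.
Local Open Scope classical_set_scope.
Local Open Scope ring_scope.

(** * Dominant monomials *)

(** A complex curve does not separate the plane, so the cells that it meets cannot be counted
    topologically. Dominance of a monomial replaces this: it is tested on boundedly many lines per
    cell, and a test line meets a curve in boundedly many points. What is charged for a cell is a
    zero near an annulus on a test line, so the annuli, all dilated by a constant factor, must still
    cover each point boundedly often. This requirement shapes the construction of the cells.

    A vector [o] with [bf o o = 1] stands for a circle or a line, and the reflection in [o] is the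
    inversion in it. If an inversion preserves C, the pairs that it exchanges lie on lines through
    one point, so any two of these lines are coplanar and no bound on common partners can hold;
    hence these pairs are split off and counted separately. For skew lines the map from p to q is
    given by polynomials of degree at most 6; if more such maps send a component into C than a plane
    has points of C, two of them agree on the whole component. *)

Definition cabs (R : rcfType) (z : R[i]) : R :=
  Num.sqrt (complex.Re z ^+ 2 + complex.Im z ^+ 2).

Lemma cabsE (R : rcfType) (z : R[i]) : cabs z = Normc.normc z.
Proof. by case: z. Qed.

Lemma cabs_ge0 (R : rcfType) (z : R[i]) : 0 <= cabs z.
Proof. exact: sqrtr_ge0. Qed.

Lemma cabs0 (R : rcfType) : cabs (0 : R[i]) = 0.
Proof. by rewrite cabsE Normc.normc0. Qed.

Lemma cabs1 (R : rcfType) : cabs (1 : R[i]) = 1.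
Proof. by rewrite cabsE Normc.normc1. Qed.

Lemma cabs_eq0 (R : rcfType) (z : R[i]) : (cabs z == 0) = (z == 0).
Proof.
by apply/eqP/eqP => [|->]; [rewrite cabsE => /Normc.eq0_normc | exact: cabs0].
Qed.

Lemma cabs_gt0 (R : rcfType) (z : R[i]) : (0 < cabs z) = (z != 0).
Proof. by rewrite lt_def cabs_ge0 andbT cabs_eq0. Qed.

Lemma cabsM (R : rcfType) (x y : R[i]) : cabs (x * y) = cabs x * cabs y.
Proof. by rewrite !cabsE Normc.normcM. Qed.

Lemma cabsD (R : rcfType) (x y : R[i]) : cabs (x + y) <= cabs x + cabs y.
Proof. by rewrite !cabsE; exact: le_normcD. Qed.

Lemma cabsN (R : rcfType) (x : R[i]) : cabs (- x) = cabs x.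
Proof. by rewrite !cabsE; exact: normcN. Qed.

Lemma cabsX (R : rcfType) (x : R[i]) n : cabs (x ^+ n) = cabs x ^+ n.
Proof. by elim: n => [|n IH]; rewrite ?expr0 ?cabs1 // !exprS cabsM IH. Qed.

Lemma cabsC (R : rcfType) (x y : R[i]) : cabs (x - y) = cabs (y - x).
Proof. by rewrite -cabsN opprB. Qed.

Lemma cabs_tri (R : rcfType) (y x z : R[i]) :
  cabs (x - z) <= cabs (x - y) + cabs (y - z).
Proof.
have -> : x - z = (x - y) + (y - z) by ring.
exact: cabsD.
Qed.

Lemma cabsB_ge (R : rcfType) (x y : R[i]) : cabs x - cabs y <= cabs (x - y).
Proof. by have := cabsD (x - y) y; rewrite subrK; lra. Qed.

Lemma cabs_sum (R : rcfType) I (r : seq I) (P : pred I) (F : I -> R[i]) :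
  cabs (\sum_(i <- r | P i) F i) <= \sum_(i <- r | P i) cabs (F i).
Proof.
elim/big_rec2: _ => [|i y1 y2 _ h]; first by rewrite cabs0.
by apply: le_trans (cabsD _ _) _; rewrite lerD2l.
Qed.

Lemma cabs_real (R : rcfType) (a : R) : cabs (a%:C)%C = `|a|.
Proof. by rewrite /cabs /= expr0n /= addr0 sqrtr_sqr. Qed.

Lemma cabs_Re (R : rcfType) (z : R[i]) : `|complex.Re z| <= cabs z.
Proof. by rewrite /cabs -sqrtr_sqr ler_wsqrtr // lerDl sqr_ge0. Qed.

Lemma cabs_Im (R : rcfType) (z : R[i]) : `|complex.Im z| <= cabs z.
Proof. by rewrite /cabs -sqrtr_sqr ler_wsqrtr // lerDr sqr_ge0. Qed.

Lemma cabs_le_ReIm (R : rcfType) (z : R[i]) :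
  cabs z <= `|complex.Re z| + `|complex.Im z|.
Proof.
rewrite /cabs; set a := complex.Re z; set b := complex.Im z.
have h : 0 <= `|a| + `|b| by rewrite addr_ge0 ?normr_ge0.
rewrite -(ger0_norm h) -(sqrtr_sqr (`|a| + `|b|)) ler_wsqrtr //.
rewrite sqrrD !real_normK ?num_real // addrAC lerDl.
by rewrite mulrn_wge0 // mulr_ge0.
Qed.

(** The coefficient norm of radius [t] is submultiplicative and ['X - z] has norm [t + cabs z]. The
    truncation to [D] terms survives because multiplication by ['X] only shifts indices upwards. *)
Lemma coef_sum_mul_factor (R : rcfType) (D : nat) (p : {poly R[i]}) (z : R[i]) (t : R) :
  0 <= t ->
  \sum_(i < D) cabs (p * ('X - z%:P))`_i * t ^+ i
    <= (t + cabs z) * \sum_(i < D) cabs p`_i * t ^+ i.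
Proof.
move=> t0.
have nn i : 0 <= cabs p`_i * t ^+ i by rewrite mulr_ge0 ?cabs_ge0 ?exprn_ge0.
apply: (@le_trans _ _ (\sum_(i < D) (cabs ((p * 'X)`_i) * t ^+ i
    + cabs z * (cabs p`_i * t ^+ i)))).
  apply: ler_sum => i _; rewrite mulrBr coefB coefMC.
  rewrite mulrA -mulrDl ler_wpM2r ?exprn_ge0 //.
  apply: le_trans (cabsD _ _) _; rewrite cabsN cabsM [cabs z * _]mulrC.
  exact: lexx.
rewrite big_split /= -mulr_sumr mulrDl lerD2r.
case: D => [|D]; first by rewrite !big_ord0 mulr0.
rewrite big_ord_recl coefMX /= cabs0 mul0r add0r.
rewrite big_ord_recr /= mulrDr -[leLHS]addr0 lerD //; last by rewrite mulr_ge0.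
rewrite mulr_sumr; apply: ler_sum => i _.
by rewrite coefMX /bump leq0n add1n /= exprS mulrCA.
Qed.

Lemma coef_sum_prod_factors (R : rcfType) (D : nat) (rs : seq R[i]) (t : R) :
  0 <= t ->
  \sum_(i < D) cabs (\prod_(z <- rs) ('X - z%:P) : {poly R[i]})`_i * t ^+ i
    <= \prod_(z <- rs) (t + cabs z).
Proof.
move=> t0; elim: rs => [|z rs IH].
  rewrite !big_nil; case: D => [|D]; first by rewrite big_ord0 ler01.
  rewrite big_ord_recl /= coef1 /= cabs1 mulr1 big1 ?addr0 // => i _.
  by rewrite /bump leq0n add1n coef1 /= cabs0 mul0r.
rewrite !big_cons mulrC; apply: le_trans (coef_sum_mul_factor _ _ _ t0) _.
by rewrite ler_wpM2l // addr_ge0 ?cabs_ge0.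
Qed.

Lemma complex_poly_split (R : rcfType) (p : {poly R[i]}) :
  exists rs : seq R[i], p = lead_coef p *: \prod_(z <- rs) ('X - z%:P).
Proof. by have [rs e] := closed_field_poly_normal p; exists rs. Qed.

(** A converse of the triangle inequality: away from the roots of [f] there is little cancellation,
    so the value controls the coefficient norm. The comparison is made root by root. *)
Lemma coef_sum_le_horner (R : rcfType) (D : nat) (f : {poly R[i]}) (x : R[i]) (t e : R) :
  0 < e -> e <= 1 -> 0 < t -> cabs x <= 2 * t -> (size f <= D)%N ->
  (f != 0 -> forall r, root f r -> e * t <= cabs (x - r)) ->
  \sum_(i < D) cabs f`_i * t ^+ i <= (5 / e) ^+ D * cabs f.[x].
Proof.
move=> e0 e1 t0 xt sf hr.
have [->|f0] := eqVneq f 0.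
  rewrite horner0 cabs0 mulr0 big1 // => i _.
  by rewrite coef0 cabs0 mul0r.
have [rs ef] := complex_poly_split f.
set a := lead_coef f in ef; have a0 : a != 0 by rewrite /a lead_coef_eq0.
have hroot z : z \in rs -> root f z.
  move=> zr; rewrite ef rootZ // root_prod_XsubC //.
have srs : (size rs <= D)%N.
  by apply: leq_trans sf; rewrite ef size_scale // size_prod_XsubC.
have K1 : 1 <= 5 / e by rewrite ler_pdivlMr //; lra.
have -> : f.[x] = a * \prod_(z <- rs) (x - z).
  rewrite ef hornerZ horner_prod; congr (_ * _).
  by apply: eq_bigr => z _; rewrite hornerXsubC.
have efi i : cabs f`_i = cabs a * cabs (\prod_(z <- rs) ('X - z%:P) : {poly R[i]})`_i.
  by rewrite {1}ef coefZ cabsM.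
rewrite (eq_bigr (fun i : 'I_D => cabs a *
  (cabs (\prod_(z <- rs) ('X - z%:P) : {poly R[i]})`_i * t ^+ i))); last first.
  by move=> i _; rewrite efi mulrA.
rewrite -mulr_sumr cabsM mulrCA ler_wpM2l ?cabs_ge0 //.
apply: le_trans (coef_sum_prod_factors _ _ (ltW t0)) _.
apply: (@le_trans _ _ ((5 / e) ^+ size rs * cabs (\prod_(z <- rs) (x - z)))); last first.
  by rewrite ler_wpM2r ?cabs_ge0 // ler_weXn2l.
have : all (root f) rs by apply/allP => z /hroot.
elim: rs {ef efi hroot srs} => [|z rs IH] /=; first by rewrite !big_nil cabs1 mulr1.
case/andP=> rz /IH {IH} IH; rewrite !big_cons cabsM exprS mulrACA.
apply: ler_pM => //; first by rewrite addr_ge0 ?cabs_ge0 ?ltW.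
  by apply: prodr_ge0 => i _; rewrite addr_ge0 ?cabs_ge0 ?ltW.
have h1 := hr f0 _ rz; have h2 := cabsB_ge z x; rewrite cabsC in h2.
rewrite mulrAC ler_pdivlMr //.
have := cabs_ge0 z; have := cabs_ge0 (x - z).
(* A root of modulus at most [4 * t] is handled by the separation [e * t]; a larger one has distance
   at least half its modulus from [x], since [cabs x <= 2 * t]. *)
have [zt|zt] := lerP (cabs z) (4 * t); nra.
Qed.

(** Induction on the roots. On the annulus a root below [s0 / K] makes its factor act like ['X] and
    moves the dominant index up by one; a root above [K * s1] makes it act like a constant. Each
    factor turns an error [e] into [2 * (e + 1 / K)], whence [(2 ^+ k.+1 - 2) / K] for [k] roots. *)
Lemma dominant_monomial_prod (R : rcfType) (rs : seq R[i]) (s0 s1 K : R) :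
  0 < s0 -> s0 <= s1 -> (2 ^+ (size rs).+1 <= K) ->
  all (fun z => (K * cabs z < s0) || (K * s1 < cabs z)) rs ->
  exists2 j0 : nat, (j0 <= size rs)%N & forall s j, s0 <= s -> s <= s1 -> j != j0 ->
    cabs (\prod_(z <- rs) ('X - z%:P) : {poly R[i]})`_j * s ^+ j
    <= (2 ^+ (size rs).+1 - 2) / K *
       (cabs (\prod_(z <- rs) ('X - z%:P) : {poly R[i]})`_j0 * s ^+ j0).
Proof.
move=> s00 s01; elim: rs => [|z rs IH] /= hK.
  move=> _; exists 0%N => // s j _ _ j0; rewrite big_nil !coef1.
  by rewrite (negbTE j0) cabs0 mul0r expr1 subrr !mul0r.
case/andP=> hz hrs.
have K0 : 0 < K by apply: lt_le_trans hK; rewrite exprn_gt0.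
set N : R := 2 ^+ (size rs).+1 in IH hK *.
have eN : 2 ^+ (size rs).+2 = 2 * N by rewrite exprS.
rewrite eN in hK *.
have N2 : 2 <= N.
  by rewrite /N exprS -[leLHS]mulr1 ler_wpM2l // exprn_ege1 // ler1n.
have NK : N <= K by lra.
have [j0 hj0 H] := IH NK hrs; rewrite big_cons mulrC.
set p := \prod_(_ <- _) _ in H *.
set e : R := (N - 2) / K in H.
have e0 : 0 <= e by rewrite /e divr_ge0 //; lra.
have eK : e + 1 / K <= 1 / 2.
  by rewrite /e -mulrDl ler_pdivrMr //; lra.
have -> : (2 * N - 2) / K = 2 * (e + 1 / K) by rewrite /e; field; rewrite gt_eqF.
set d := 1 / K in eK *.
have d0 : 0 <= d by rewrite /d divr_ge0 // ltW.
have coefq j : (p * ('X - z%:P))`_j = (p * 'X)`_j - p`_j * z.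
  by rewrite mulrBr coefB coefMC.
set q := p * ('X - z%:P) in coefq *.
have z0 := cabs_ge0 z.
have ed : e * d <= 1 / 2.
  by apply: (@le_trans _ _ (1 / 2 * 1)); [apply: ler_pM => //; lra | lra].
case/orP: hz => hz.
- exists j0.+1 => // s j h0 h1 hj.
  have sp : 0 < s by lra.
  pose A := cabs p`_j0 * s ^+ j0.
  have A0 : 0 <= A by rewrite mulr_ge0 ?cabs_ge0 ?exprn_ge0 ?ltW.
  have hle k : cabs p`_k * s ^+ k <= A * (if k == j0 then 1 else e).
    by case: eqP => [->|/eqP hk]; [rewrite mulr1 | rewrite [A * _]mulrC; exact: H].
  have zs : cabs z <= d * s.
    by rewrite /d mulrC mulrA mulr1 ler_pdivlMr // mulrC; lra.
  have hlow : A * s / 2 <= cabs q`_j0.+1 * s ^+ j0.+1.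
    have := cabsB_ge (p * 'X)`_j0.+1 (p`_j0.+1 * z).
    rewrite -coefq coefMX /= cabsM => h.
    have h' := hle j0.+1; rewrite gtn_eqF // in h'.
    have sj : 0 <= s ^+ j0.+1 by rewrite exprn_ge0 ?ltW.
    have hh : (cabs p`_j0 - cabs p`_j0.+1 * cabs z) * s ^+ j0.+1
       <= cabs q`_j0.+1 * s ^+ j0.+1 by rewrite ler_wpM2r.
    apply: le_trans hh; rewrite mulrBl mulrAC.
    have -> : cabs p`_j0 * s ^+ j0.+1 = A * s by rewrite /A exprSr mulrA.
    have : (cabs p`_j0.+1 * s ^+ j0.+1) * cabs z <= (A * e) * (d * s).
      by apply: ler_pM => //; rewrite mulr_ge0 ?cabs_ge0.
    have : A * s * (e * d) <= A * s * (1 / 2).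
      exact: ler_wpM2l (mulr_ge0 A0 (ltW sp)) _ _ ed.
    lra.
  have hup : cabs q`_j * s ^+ j <= A * s * (e + d).
    have -> : A * s * (e + d) = (A * e) * s + A * (d * s) by ring.
    apply: (@le_trans _ _ (cabs (p * 'X)`_j * s ^+ j + cabs p`_j * s ^+ j * cabs z)).
      rewrite mulrAC -mulrDl ler_wpM2r ?exprn_ge0 ?(ltW sp) // coefq -cabsM -[cabs (_ * z)]cabsN.
      exact: cabsD.
    apply: lerD.
      case: j hj => [|j] hj; rewrite coefMX /=.
        by rewrite cabs0 mul0r; exact: mulr_ge0 (mulr_ge0 A0 e0) (ltW sp).
      rewrite exprSr mulrA ler_wpM2r ?(ltW sp) //.
      by have := hle j; rewrite -eqSS (negbTE hj).
    apply: ler_pM => //; first by rewrite mulr_ge0 ?cabs_ge0 ?exprn_ge0 ?(ltW sp).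
    apply: le_trans (hle j) _; case: eqP; rewrite ?mulr1 // => _.
    by rewrite -[leRHS]mulr1 ler_wpM2l //; lra.
  apply: le_trans hup _.
  have : 2 * (e + d) * (A * s / 2) <= 2 * (e + d) * (cabs q`_j0.+1 * s ^+ j0.+1).
    by rewrite ler_wpM2l //; lra.
  apply: le_trans; lra.
- exists j0; first exact: leqW.
  move=> s j h0 h1 hj.
  have sp : 0 < s by lra.
  pose A := cabs p`_j0 * s ^+ j0.
  have A0 : 0 <= A by rewrite mulr_ge0 ?cabs_ge0 ?exprn_ge0 ?ltW.
  have hle k : cabs p`_k * s ^+ k <= A * (if k == j0 then 1 else e).
    by case: eqP => [->|/eqP hk]; [rewrite mulr1 | rewrite [A * _]mulrC; exact: H].
  have zs : s <= d * cabs z.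
    rewrite /d mulrC mulrA mulr1 ler_pdivlMr //.
    apply: (@le_trans _ _ (K * s1)); last exact: ltW.
    by rewrite mulrC ler_wpM2l // ltW.
  have hX k : cabs (p * 'X)`_k * s ^+ k <= A * (if k == j0.+1 then 1 else e) * s.
    case: k => [|k]; rewrite coefMX /=.
      by rewrite cabs0 mul0r; apply: mulr_ge0 (ltW sp); apply: mulr_ge0.
    by rewrite exprSr mulrA ler_wpM2r ?(ltW sp) // eqSS.
  have hlow : A * cabs z / 2 <= cabs q`_j0 * s ^+ j0.
    have := cabsB_ge (p`_j0 * z) (p * 'X)`_j0.
    rewrite cabsC -coefq cabsM => h.
    have h' := hX j0; rewrite ltn_eqF // in h'.
    have hh : (cabs p`_j0 * cabs z - cabs (p * 'X)`_j0) * s ^+ j0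
       <= cabs q`_j0 * s ^+ j0 by rewrite ler_wpM2r ?exprn_ge0 ?(ltW sp).
    apply: le_trans hh; rewrite mulrBl.
    have -> : cabs p`_j0 * cabs z * s ^+ j0 = A * cabs z by rewrite mulrAC.
    have : A * e * s <= A * e * (d * cabs z) by exact: ler_wpM2l (mulr_ge0 A0 e0) _ _ zs.
    have : A * cabs z * (e * d) <= A * cabs z * (1 / 2).
      exact: ler_wpM2l (mulr_ge0 A0 z0) _ _ ed.
    lra.
  have hup : cabs q`_j * s ^+ j <= A * cabs z * (e + d).
    have -> : A * cabs z * (e + d) = A * (d * cabs z) + (A * e) * cabs z by ring.
    apply: (@le_trans _ _ (cabs (p * 'X)`_j * s ^+ j + cabs p`_j * s ^+ j * cabs z)).
      rewrite mulrAC -mulrDl ler_wpM2r ?exprn_ge0 ?(ltW sp) // coefq -cabsM -[cabs (_ * z)]cabsN.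
      exact: cabsD.
    apply: lerD.
      apply: le_trans (hX j) _; apply: ler_pM => //; first by case: ifP => _; apply: mulr_ge0.
        exact: ltW.
      by case: ifP; rewrite ?mulr1 // => _; rewrite -[leRHS]mulr1 ler_wpM2l //; lra.
    by rewrite ler_wpM2r //; have := hle j; rewrite (negbTE hj).
  apply: le_trans hup _.
  have : 2 * (e + d) * (A * cabs z / 2) <= 2 * (e + d) * (cabs q`_j0 * s ^+ j0).
    by rewrite ler_wpM2l //; lra.
  apply: le_trans; lra.
Qed.

Lemma dominant_monomial (R : rcfType) (D : nat) (g : {poly R[i]}) (s0 s1 K : R) :
  0 < s0 -> s0 <= s1 -> 2 ^+ D.+1 <= K -> g != 0 -> (size g <= D)%N ->
  (forall y, root g y -> s0 <= K * cabs y -> K * s1 < cabs y) ->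
  exists j0 : 'I_D, forall s (j : 'I_D), s0 <= s -> s <= s1 -> j != j0 ->
    cabs g`_j * s ^+ j <= 2 ^+ D.+1 / K * (cabs g`_j0 * s ^+ j0).
Proof.
move=> s00 s01 hK g0 sg hr.
have [rs ef] := complex_poly_split g.
set a := lead_coef g in ef; have a0 : a != 0 by rewrite /a lead_coef_eq0.
have srs : (size rs < D)%N.
  by apply: leq_trans sg; rewrite ef size_scale // size_prod_XsubC.
have K0 : 0 < K by apply: lt_le_trans hK; rewrite exprn_gt0.
have pw : (2 : R) ^+ (size rs).+1 <= 2 ^+ D.+1 by rewrite ler_weXn2l ?ler1n // ltnW.
have [||j0 hj0 H] := @dominant_monomial_prod R rs s0 s1 K s00 s01.
- exact: le_trans hK.
- apply/allP => z zr; case: (ltP (K * cabs z) s0) => //= h; apply: hr => //.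
  by rewrite ef rootZ // root_prod_XsubC.
have j0D : (j0 < D)%N by apply: leq_ltn_trans srs.
exists (Ordinal j0D) => s j h0 h1 hj.
have hH := H s j h0 h1 hj.
have ek k : cabs g`_k = cabs a * cabs (\prod_(z <- rs) ('X - z%:P) : {poly R[i]})`_k.
  by rewrite {1}ef coefZ cabsM.
have -> : nat_of_ord (Ordinal j0D) = j0 by [].
rewrite (ek j) (ek j0); move: hH; set u := cabs _; set v := cabs _ => hH.
have v0 : 0 <= v * s ^+ j0 by rewrite mulr_ge0 ?cabs_ge0 ?exprn_ge0 //; lra.
have -> : cabs a * u * s ^+ j = cabs a * (u * s ^+ j) by rewrite mulrA.
have -> : 2 ^+ D.+1 / K * (cabs a * v * s ^+ j0) =
  cabs a * (2 ^+ D.+1 / K * (v * s ^+ j0)) by ring.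
rewrite ler_wpM2l ?cabs_ge0 //; apply: le_trans hH _.
by rewrite ler_wpM2r // ler_wpM2r ?invr_ge0 ?(ltW K0) //; lra.
Qed.

(** If [N] is the sum of all entries, the columns other than [j0] and, inside column [j0], the rows
    other than [i0] carry at most [D%:R * e * N] each. Hence entry [(i0, j0)] is at least [N / 2],
    and any other entry is at most [2 * D%:R * e * N]. *)
Lemma entry_dominates (R : realFieldType) (D : nat) (m : 'I_D -> 'I_D -> R) (e : R) i0 j0 :
  (forall i j, 0 <= m i j) -> 0 <= e -> 8 * D%:R * e <= 1 ->
  (forall j, j != j0 -> \sum_i m i j <= e * \sum_i m i j0) ->
  (forall i, i != i0 -> \sum_j m i j <= e * \sum_j m i0 j) ->
  (forall i j, (i, j) != (i0, j0) -> m i j <= 4 * D%:R * e * m i0 j0).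
Proof.
move=> m0 e0 eD Hc Hr i j hij.
set N := \sum_i \sum_j m i j.
have rN k : \sum_l m k l <= N.
  rewrite /N [X in _ <= X](bigD1 k) //= lerDl; apply: sumr_ge0 => ? _; exact: sumr_ge0.
have eN : N = \sum_j \sum_i m i j by rewrite /N exchange_big.
have cN k : \sum_l m l k <= N.
  rewrite eN [X in _ <= X](bigD1 k) //= lerDl; apply: sumr_ge0 => ? _; exact: sumr_ge0.
have N0 : 0 <= N by apply: sumr_ge0 => ? _; exact: sumr_ge0.
have bnd (f : 'I_D -> R) (P : pred 'I_D) : (forall k, P k -> f k <= e * N) ->
    \sum_(k | P k) f k <= D%:R * (e * N).
  move=> h; apply: (@le_trans _ _ (\sum_(k | P k) e * N)); first exact: ler_sum.
  have cP : (#|P| <= D)%N by rewrite -[X in (_ <= X)%N](card_ord D) max_card.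
  by rewrite sumr_const -[leLHS]mulr_natl ler_wpM2r ?mulr_ge0 // ler_nat.
have hN1 : N <= \sum_i m i j0 + D%:R * (e * N).
  rewrite {1}eN (bigD1 j0) //= lerD2l; apply: bnd => k hk.
  by apply: le_trans (Hc k hk) _; rewrite ler_wpM2l.
have hN2 : \sum_i m i j0 <= m i0 j0 + D%:R * (e * N).
  rewrite (bigD1 i0) //= lerD2l; apply: bnd => k hk.
  apply: (@le_trans _ _ (\sum_j m k j)).
    by rewrite [X in _ <= X](bigD1 j0) //= lerDl sumr_ge0.
  by apply: le_trans (Hr k hk) _; rewrite ler_wpM2l.
have hN3 : m i j + m i0 j0 <= N.
  rewrite /N pair_big /= (bigD1 (i0, j0)) //= (bigD1 (i, j)) //=.
  rewrite addrA [m i j + _]addrC lerDl.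
  by apply: sumr_ge0.
have hD : 0 <= D%:R :> R by [].
set d := D%:R * e in eD.
have d0 : 0 <= d by rewrite mulr_ge0.
have {}hN1 : N <= \sum_i m i j0 + d * N by rewrite /d -mulrA.
have {}hN2 : \sum_i m i j0 <= m i0 j0 + d * N by rewrite /d -mulrA.
have -> : 4 * D%:R * e = 4 * d by rewrite /d mulrA.
have {}eD : 8 * d <= 1 by rewrite /d mulrA.
have M0 := m0 i0 j0.
have dN : d * N <= 1 / 8 * N by rewrite ler_wpM2r //; lra.
have NM : N <= 2 * m i0 j0 by lra.
have : d * N <= d * (2 * m i0 j0) by rewrite ler_wpM2l.
by lra.
Qed.

(** Dominance on the four sides gives a dominant monomial at each corner by [entry_dominates]. The
    four agree, and the ratio of two monomials, being monotone in each variable, is largest at a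
    corner. *)
Lemma rectangle_dominates (R : realFieldType) (D : nat) (w : 'I_D -> 'I_D -> R)
    (t0 t1 s0 s1 e : R) :
  (forall i j, 0 <= w i j) -> (exists i j, 0 < w i j) -> 0 < t0 -> t0 <= t1 ->
  0 < s0 -> s0 <= s1 -> 0 <= e -> 8 * D%:R * e <= 1 ->
  (forall t, t = t0 \/ t = t1 -> exists j0 : 'I_D, forall s (j : 'I_D), s0 <= s ->
    s <= s1 -> j != j0 ->
    \sum_i w i j * t ^+ i * s ^+ j <= e * (\sum_i w i j0 * t ^+ i * s ^+ j0)) ->
  (forall s, s = s0 \/ s = s1 -> exists i0 : 'I_D, forall t (i : 'I_D), t0 <= t ->
    t <= t1 -> i != i0 ->
    \sum_j w i j * t ^+ i * s ^+ j <= e * (\sum_j w i0 j * t ^+ i0 * s ^+ j)) ->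
  exists a b : 'I_D, 0 < w a b /\ forall t s i j, t0 <= t -> t <= t1 -> s0 <= s ->
    s <= s1 -> (i, j) != (a, b) ->
    w i j * t ^+ i * s ^+ j <= 4 * D%:R * e * (w a b * t ^+ a * s ^+ b).
Proof.
move=> w0 [p [q wpq]] t00 t01 s00 s01 e0 eD Hc Hr.
have t10 : 0 < t1 by lra.
have s10 : 0 < s1 by lra.
have [j0 Hj0] := Hc t0 (or_introl erefl).
have [j1 Hj1] := Hc t1 (or_intror erefl).
have [i0 Hi0] := Hr s0 (or_introl erefl).
have [i1 Hi1] := Hr s1 (or_intror erefl).
pose m t s i j := w i j * t ^+ i * s ^+ j.
have m0 t s : 0 < t -> 0 < s -> forall i j, 0 <= m t s i j.
  by move=> ht hs i j; rewrite /m !mulr_ge0 ?exprn_ge0 ?(ltW ht) ?(ltW hs).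
pose f := 4 * D%:R * e.
have f0 : 0 <= f by rewrite /f !mulr_ge0.
have f1 : f < 1 by rewrite /f; lra.
have E00 : forall i j, (i, j) != (i0, j0) -> m t0 s0 i j <= f * m t0 s0 i0 j0.
  apply: entry_dominates => //; first exact: m0.
    by move=> j hj; apply: Hj0.
  by move=> i hi; apply: Hi0.
have E01 : forall i j, (i, j) != (i1, j0) -> m t0 s1 i j <= f * m t0 s1 i1 j0.
  apply: entry_dominates => //; first exact: m0.
    by move=> j hj; apply: Hj0.
  by move=> i hi; apply: Hi1.
have E10 : forall i j, (i, j) != (i0, j1) -> m t1 s0 i j <= f * m t1 s0 i0 j1.
  apply: entry_dominates => //; first exact: m0.
    by move=> j hj; apply: Hj1.
  by move=> i hi; apply: Hi0.
have E11 : forall i j, (i, j) != (i1, j1) -> m t1 s1 i j <= f * m t1 s1 i1 j1.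
  apply: entry_dominates => //; first exact: m0.
    by move=> j hj; apply: Hj1.
  by move=> i hi; apply: Hi1.
have pos t s i j : 0 < t -> 0 < s ->
    (forall i' j', (i', j') != (i, j) -> m t s i' j' <= f * m t s i j) -> 0 < w i j.
  move=> ht hs h; have := w0 i j; rewrite le_eqVlt => /orP[/eqP e1|//].
  have [e2|hne] := eqVneq (p, q) (i, j); first by case: e2 e1 => <- <- e1; lra.
  have := h p q hne; rewrite /m -e1 !mul0r mulr0 => h'.
  have : 0 < w p q * t ^+ p * s ^+ q by rewrite !mulr_gt0 ?exprn_gt0.
  lra.
have P00 := pos _ _ _ _ t00 s00 E00.
have P01 := pos _ _ _ _ t00 s10 E01.
have P10 := pos _ _ _ _ t10 s00 E10.
(* At both ends of the side [t = t0] the dominant monomial has second index [j0], so the power of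
   [s] cancels and the two comparisons contradict each other, as [f < 1]. *)
have ei : i1 = i0.
  apply/eqP/negPn/negP => hne.
  have h1 : m t0 s0 i1 j0 <= f * m t0 s0 i0 j0.
    by apply: E00; apply: contra hne => /eqP[->].
  have h2 : m t0 s1 i0 j0 <= f * m t0 s1 i1 j0.
    by apply: E01; apply: contra hne => /eqP[->].
  have h1' : w i1 j0 * t0 ^+ i1 <= f * (w i0 j0 * t0 ^+ i0).
    by rewrite -(ler_pM2r (x := s0 ^+ j0)) ?exprn_gt0 // -[leRHS]mulrA.
  have h2' : w i0 j0 * t0 ^+ i0 <= f * (w i1 j0 * t0 ^+ i1).
    by rewrite -(ler_pM2r (x := s1 ^+ j0)) ?exprn_gt0 // -[leRHS]mulrA.
  move: h1' h2'.
  have : 0 < w i0 j0 * t0 ^+ i0 by rewrite mulr_gt0 ?exprn_gt0.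
  have : 0 < w i1 j0 * t0 ^+ i1 by rewrite mulr_gt0 ?exprn_gt0.
  nra.
have ej : j1 = j0.
  apply/eqP/negPn/negP => hne.
  have h1 : m t0 s0 i0 j1 <= f * m t0 s0 i0 j0.
    by apply: E00; apply: contra hne => /eqP[->].
  have h2 : m t1 s0 i0 j0 <= f * m t1 s0 i0 j1.
    by apply: E10; apply: contra hne => /eqP[->].
  have h1' : w i0 j1 * s0 ^+ j1 <= f * (w i0 j0 * s0 ^+ j0).
    rewrite -(ler_pM2r (x := t0 ^+ i0)) ?exprn_gt0 // -[leRHS]mulrA.
    by move: h1; rewrite /m !(mulrAC _ (t0 ^+ i0)).
  have h2' : w i0 j0 * s0 ^+ j0 <= f * (w i0 j1 * s0 ^+ j1).
    rewrite -(ler_pM2r (x := t1 ^+ i0)) ?exprn_gt0 // -[leRHS]mulrA.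
    by move: h2; rewrite /m !(mulrAC _ (t1 ^+ i0)).
  move: h1' h2'.
  have : 0 < w i0 j0 * s0 ^+ j0 by rewrite mulr_gt0 ?exprn_gt0.
  have : 0 < w i0 j1 * s0 ^+ j1 by rewrite mulr_gt0 ?exprn_gt0.
  nra.
rewrite ei ej in E01 E10 E11.
exists i0, j0; split => // t s i j ht0 ht1 hs0 hs1 hij.
have tp : 0 < t by lra.
have sp : 0 < s by lra.
(* The ratio of [u ^+ k] to [u ^+ l] is at most its value at one of the ends of the interval. *)
have mono (u0 u1 u : R) (k l : nat) : 0 < u0 -> u0 <= u -> u <= u1 ->
    exists2 v, v = u0 \/ v = u1 & u ^+ k * v ^+ l <= v ^+ k * u ^+ l.
  move=> hu0 h1 h2; have hu : 0 < u by lra.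
  have [kl|kl] := leqP k l.
    exists u0; first by left.
    rewrite -(subnKC kl) !exprD.
    have -> : u ^+ k * (u0 ^+ k * u0 ^+ (l - k)) = u0 ^+ (l - k) * (u ^+ k * u0 ^+ k) by ring.
    have -> : u0 ^+ k * (u ^+ k * u ^+ (l - k)) = u ^+ (l - k) * (u ^+ k * u0 ^+ k) by ring.
    rewrite ler_wpM2r ?mulr_ge0 ?exprn_ge0 ?(ltW hu) ?(ltW hu0) //.
    by rewrite lerXn2r ?nnegrE ?(ltW hu) ?(ltW hu0).
  exists u1; first by right.
  have hu1 : 0 < u1 by lra.
  rewrite -(subnKC (ltnW kl)) !exprD.
  have -> : u ^+ l * u ^+ (k - l) * u1 ^+ l = u ^+ (k - l) * (u ^+ l * u1 ^+ l) by ring.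
  have -> : u1 ^+ l * u1 ^+ (k - l) * u ^+ l = u1 ^+ (k - l) * (u ^+ l * u1 ^+ l) by ring.
  rewrite ler_wpM2r ?mulr_ge0 ?exprn_ge0 ?(ltW hu) ?(ltW hu1) //.
  by rewrite lerXn2r ?nnegrE ?(ltW hu) ?(ltW hu1).
have [tv htv Ht] := mono _ _ _ i i0 t00 ht0 ht1.
have [sv hsv Hs] := mono _ _ _ j j0 s00 hs0 hs1.
have hm : m tv sv i j <= f * m tv sv i0 j0.
  by case: htv hsv => -> [] ->; [apply: E00|apply: E01|apply: E10|apply: E11].
have tvp : 0 < tv by case: htv => ->.
have svp : 0 < sv by case: hsv => ->.
rewrite -(ler_pM2r (x := tv ^+ i0 * sv ^+ j0)) ?mulr_gt0 ?exprn_gt0 //.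
apply: (@le_trans _ _ (w i j * ((tv ^+ i * t ^+ i0) * (sv ^+ j * s ^+ j0)))).
  have -> : w i j * t ^+ i * s ^+ j * (tv ^+ i0 * sv ^+ j0) =
    w i j * ((t ^+ i * tv ^+ i0) * (s ^+ j * sv ^+ j0)) by ring.
  by rewrite ler_wpM2l // ler_pM ?mulr_ge0 ?exprn_ge0 ?(ltW tp) ?(ltW sp) ?(ltW tvp) ?(ltW svp).
have -> : w i j * ((tv ^+ i * t ^+ i0) * (sv ^+ j * s ^+ j0)) =
  m tv sv i j * (t ^+ i0 * s ^+ j0) by rewrite /m; ring.
have -> : 4 * D%:R * e * (w i0 j0 * t ^+ i0 * s ^+ j0) * (tv ^+ i0 * sv ^+ j0) =
  f * m tv sv i0 j0 * (t ^+ i0 * s ^+ j0) by rewrite /m /f; ring.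
by rewrite ler_wpM2r ?mulr_ge0 ?exprn_ge0 ?(ltW tp) ?(ltW sp).
Qed.

(** * Zeros in a product of annuli and on its test lines *)

Definition bipoly (R : rcfType) (D : nat) (c : nat -> nat -> R[i]) (x y : R[i]) : R[i] :=
  \sum_(i < D) \sum_(j < D) c i j * x ^+ i * y ^+ j.

Lemma bipoly_swap (R : rcfType) (D : nat) (c : nat -> nat -> R[i]) x y :
  bipoly D c x y = bipoly D (fun i j => c j i) y x.
Proof.
rewrite /bipoly exchange_big; apply: eq_bigr => i _; apply: eq_bigr => j _.
by rewrite mulrAC.
Qed.

Lemma bipoly_row (R : rcfType) (D : nat) (c : nat -> nat -> R[i]) x y :
  bipoly D c x y = (\poly_(j < D) (\poly_(i < D) c i j).[x]).[y].
Proof.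
rewrite bipoly_swap horner_poly; apply: eq_bigr => j _.
by rewrite horner_poly mulr_suml; apply: eq_bigr => i _; rewrite mulrAC.
Qed.

Lemma bipoly_neq0_coef (R : rcfType) (D : nat) (c : nat -> nat -> R[i]) x y :
  bipoly D c x y != 0 -> exists i j : 'I_D, c i j != 0.
Proof.
move=> h; have /existsP [i /existsP [j hij]] : [exists i : 'I_D, exists j : 'I_D, c i j != 0].
  apply: contraNT h; rewrite negb_exists => /forallP h.
  rewrite /bipoly big1 // => i _; rewrite big1 // => j _.
  have := h i; rewrite negb_exists => /forallP /(_ j); rewrite negbK => /eqP ->.
  by rewrite !mul0r.
by exists i, j.
Qed.

Lemma exprD_coef (R : rcfType) (D : nat) (z : R[i]) :
  exists M : nat -> nat -> R[i], forall (k : 'I_D) x,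
    (x + z) ^+ k = \sum_(i < D) M k i * x ^+ i.
Proof.
exists (fun k i => (('X + z%:P) ^+ k)`_i) => k x.
have s : (size (('X + z%:P) ^+ k : {poly R[i]}) <= D)%N.
  by rewrite -[z]opprK polyCN size_exp_XsubC.
have -> : (x + z) ^+ k = (('X + z%:P) ^+ k).[x] by rewrite horner_exp !hornerE.
by rewrite (horner_coef_wide _ s).
Qed.

Lemma bipoly_shift (R : rcfType) (D : nat) (c : nat -> nat -> R[i]) (z w : R[i]) :
  exists c', forall x y, bipoly D c (x + z) (y + w) = bipoly D c' x y.
Proof.
have [M HM] := exprD_coef D z; have [N HN] := exprD_coef D w.
exists (fun i j => \sum_(k < D) \sum_(l < D) c k l * M k i * N l j) => x y.
rewrite /bipoly.
under eq_bigr => k _ do under eq_bigr => l _ do rewrite HM HN.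
transitivity (\sum_(k < D) \sum_(l < D) \sum_(i < D) \sum_(j < D)
    c k l * M k i * N l j * x ^+ i * y ^+ j).
  apply: eq_bigr => k _; apply: eq_bigr => l _.
  rewrite [c k l * _]mulr_sumr mulr_suml; apply: eq_bigr => i _.
  by rewrite mulr_sumr; apply: eq_bigr => j _; ring.
have e1 : forall k : 'I_D, \sum_(l < D) \sum_(i < D) \sum_(j < D)
    c k l * M k i * N l j * x ^+ i * y ^+ j =
    \sum_(i < D) \sum_(j < D) \sum_(l < D) c k l * M k i * N l j * x ^+ i * y ^+ j.
  by move=> k; rewrite exchange_big; apply: eq_bigr => i _; rewrite exchange_big.
under eq_bigr => k _ do rewrite e1.
rewrite exchange_big; apply: eq_bigr => i _; rewrite exchange_big; apply: eq_bigr => j _.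
rewrite !mulr_suml; apply: eq_bigr => k _; rewrite !mulr_suml.
by apply: eq_bigr.
Qed.

(** Test abscissas of modulus between [t] and [2 * t]. Their spacing is [t / N%:R], so a given root
    comes closer than half of this to at most one of them. *)
Definition ray_points (R : rcfType) (N : nat) (t : R) : seq R[i] :=
  [seq ((t * (1 + k%:R / N%:R))%:C)%C | k <- iota 0 N].

Lemma ray_points_bound (R : rcfType) (N : nat) (t : R) x :
  0 < t -> x \in ray_points N t -> t <= cabs x /\ cabs x <= 2 * t.
Proof.
move=> t0 /mapP [k]; rewrite mem_iota add0n => /andP[_ kN] ->.
have N0 : (0 : R) < N%:R by rewrite ltr0n (leq_ltn_trans _ kN).
have h : (0 : R) <= k%:R / N%:R by rewrite divr_ge0.
have h1 : (k%:R / N%:R : R) <= 1 by rewrite ler_pdivrMr // mul1r ler_nat ltnW.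
rewrite cabs_real ger0_norm; last by rewrite mulr_ge0 ?(ltW t0) //; lra.
by split; nra.
Qed.

Lemma far_point_exists (T U : eqType) (s : seq T) (L : seq U) (near : T -> U -> bool) :
  uniq s -> (forall x y u, x \in s -> y \in s -> u \in L -> near x u -> near y u -> x = y) ->
  (size L < size s)%N -> exists2 x, x \in s & forall u, u \in L -> ~~ near x u.
Proof.
move=> us inj sL; case: (boolP (has (fun x => all (fun u => ~~ near x u) L) s)).
  by case/hasP => x xs /allP h; exists x.
move/hasPn => h.
have hn x : x \in s -> has (near x) L.
  by move/h; rewrite -has_predC; apply: sub_has => u /=; rewrite negbK.
case: L inj sL h hn => [|u0 L] inj sL h hn.
  by case: s us sL {inj h} hn => // x s _ _ /(_ x); rewrite inE eqxx => /(_ isT).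
pose f x := nth u0 (u0 :: L) (find (near x) (u0 :: L)).
have fL x : x \in s -> f x \in u0 :: L.
  by move=> xs; rewrite /f mem_nth // -has_find hn.
have uf : uniq (map f s).
  rewrite map_inj_in_uniq // => x y xs ys e; apply: (inj x y (f x)) => //.
  - exact: fL.
  - exact: nth_find (hn x xs).
  - by rewrite e; exact: nth_find (hn y ys).
have : (size (map f s) <= size (u0 :: L))%N.
  by apply: uniq_leq_size => // _ /mapP [x xs ->]; exact: fL.
by rewrite size_map leqNgt sL.
Qed.

Lemma ray_point_far (R : rcfType) (N : nat) (t : R) (L : seq R[i]) :
  0 < t -> (size L < N)%N ->
  exists2 x, x \in ray_points N t & forall r, r \in L -> t / (2 * N%:R) <= cabs (x - r).
Proof.
move=> t0 LN.
have N0 : (0 : R) < N%:R by rewrite ltr0n (leq_ltn_trans _ LN).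
have sep k l : k != l ->
    t / N%:R <= cabs (((t * (1 + k%:R / N%:R))%:C)%C - ((t * (1 + l%:R / N%:R))%:C)%C).
  move=> kl; rewrite -rmorphB cabs_real.
  have -> : t * (1 + k%:R / N%:R) - t * (1 + l%:R / N%:R) = t / N%:R * (k%:R - l%:R).
    by field; rewrite gt_eqF.
  rewrite normrM ger0_norm ?divr_ge0 ?(ltW t0) ?(ltW N0) //.
  rewrite -[leLHS]mulr1 ler_wpM2l ?divr_ge0 ?(ltW t0) ?(ltW N0) //.
  case: (ltngtP k l) kl => // h _.
    by rewrite distrC -natrB ?(ltnW h) // normr_nat ler1n subn_gt0.
  by rewrite -natrB ?(ltnW h) // normr_nat ler1n subn_gt0.
have [|x y u xs ys _ h1 h2||x xs h] := @far_point_exists _ _ (ray_points N t) L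
    (fun x r => cabs (x - r) < t / (2 * N%:R)).
- rewrite map_inj_in_uniq ?iota_uniq // => k l _ _ e; apply/eqP/negPn/negP => kl.
  by have := sep k l kl; rewrite e subrr cabs0 leNgt divr_gt0.
- case/mapP: xs h1 => k _ ->; case/mapP: ys h2 => l _ -> h2 h1.
  case: (eqVneq k l) => [->//|kl]; exfalso; have := sep k l kl.
  have := cabs_tri u ((t * (1 + k%:R / N%:R))%:C)%C ((t * (1 + l%:R / N%:R))%:C)%C.
  rewrite [cabs (u - _)]cabsC.
  have : t / N%:R = t / (2 * N%:R) + t / (2 * N%:R) by field; rewrite gt_eqF.
  by lra.
- by rewrite size_map size_iota.
by exists x => // r /h; rewrite -leNgt.
Qed.

(* The coefficients of F in powers of y are polynomials in x; at a point x far
   from all their roots, the absence of roots of F(x,.) near an annulus forces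
   one power of y to dominate in the sense of the coefficient norm of radius t. *)
Lemma column_dominates (R : rcfType) (D : nat) (c : nat -> nat -> R[i]) (t s0 s1 K E : R) :
  (0 < D)%N ->
  E = (10 * (D * D).+1%:R) ^+ D * 2 ^+ D * 2 ^+ D.+1 -> 2 ^+ D.+1 <= K ->
  0 < t -> 0 < s0 -> s0 <= s1 ->
  (exists i j : 'I_D, c i j != 0) ->
  (forall x y, x \in ray_points (D * D).+1 t -> (exists y, bipoly D c x y != 0) ->
    bipoly D c x y = 0 -> s0 <= K * cabs y -> K * s1 < cabs y) ->
  exists j0 : 'I_D, forall s (j : 'I_D), s0 <= s -> s <= s1 -> j != j0 ->
    \sum_(i < D) cabs (c i j) * t ^+ i * s ^+ j <=
    E / K * (\sum_(i < D) cabs (c i j0) * t ^+ i * s ^+ j0).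
Proof.
move=> D0 eE hK t0 s00 s01 [p [q cpq]] hr.
set N := (D * D).+1 in eE hr.
have K0 : 0 < K by apply: lt_le_trans hK; rewrite exprn_gt0.
have N0 : (0 : R) < N%:R by rewrite ltr0n.
pose f (j : nat) : {poly R[i]} := \poly_(i < D) c i j.
have fE (i : 'I_D) j : (f j)`_i = c i j by rewrite coef_poly ltn_ord.
have [rt Hrt] : {rt : nat -> seq R[i] & forall j, (size (rt j) <= D)%N /\
    (f j != 0 -> forall r, root (f j) r -> r \in rt j)}.
  apply: (@choice _ _ (fun (j : nat) (rt : seq R[i]) => (size rt <= D)%N /\
    (f j != 0 -> forall r, root (f j) r -> r \in rt))) => j.
  have [->|fj0] := eqVneq (f j) 0; first by exists [::]; split.
  have [rs ef] := complex_poly_split (f j).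
  have a0 : lead_coef (f j) != 0 by rewrite lead_coef_eq0.
  exists rs; split; last first.
    by move=> _ r; rewrite ef rootZ // root_prod_XsubC.
  have : (size (f j) <= D)%N by exact: size_poly.
  by rewrite ef size_scale // size_prod_XsubC => /ltnW.
pose L := flatten [seq rt j | j <- iota 0 D].
have sL : (size L < N)%N.
  rewrite /N ltnS /L size_flatten /shape -map_comp.
  have -> : (D * D)%N = (sumn [seq D | j <- iota 0 D])%N.
    rewrite sumnE big_map -[X in iota 0 X]subn0 -/(index_iota 0 D) sum_nat_const_nat.
    by rewrite subn0.
  rewrite !sumnE !big_map; apply: leq_sum => j _ /=.
  by have [] := Hrt j.
have [x xs hx] := ray_point_far t0 sL.
have [xt0 xt] := ray_points_bound t0 xs.
(* [e * t] is the distance given by [ray_point_far], whence the factor [(10 * N%:R) ^+ D] of [E];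
   its factor [2 ^+ D] comes from [cabs x <= 2 * t] and [2 ^+ D.+1] from [dominant_monomial]. *)
pose e : R := 1 / (2 * N%:R).
have e0 : 0 < e by rewrite /e divr_gt0 ?mulr_gt0.
have e1 : e <= 1.
  rewrite /e ler_pdivrMr ?mulr_gt0 // mul1r.
  have : (1 : R) <= N%:R by rewrite ler1n.
  by lra.
have e5 : 5 / e = 10 * N%:R by rewrite /e; field; rewrite gt_eqF.
have hfar (j : 'I_D) : f j != 0 -> forall r, root (f j) r -> e * t <= cabs (x - r).
  move=> fj0 r rr.
  have -> : e * t = t / (2 * N%:R) by rewrite /e; field; rewrite gt_eqF.
  apply: hx; apply/flattenP; exists (rt j); last by have [_ H] := Hrt j; exact: H.
  by apply/mapP; exists (val j) => //; rewrite mem_iota /= add0n ltn_ord.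
pose C1 : R := (10 * N%:R) ^+ D.
have C10 : 0 <= C1 by rewrite /C1 exprn_ge0 // mulr_ge0.
have lowf (j : 'I_D) : \sum_(i < D) cabs (c i j) * t ^+ i <= C1 * cabs (f j).[x].
  rewrite /C1 -e5; have := coef_sum_le_horner e0 e1 t0 xt (size_poly _ _) (@hfar j).
  by rewrite (eq_bigr (fun i : 'I_D => cabs (c i j) * t ^+ i)) // => i _; rewrite fE.
have upf (j : 'I_D) : cabs (f j).[x] <= 2 ^+ D * \sum_(i < D) cabs (c i j) * t ^+ i.
  rewrite horner_poly; apply: le_trans (cabs_sum _ _ _) _.
  rewrite mulr_sumr; apply: ler_sum => i _; rewrite cabsM cabsX mulrCA ler_wpM2l ?cabs_ge0 //.
  apply: (@le_trans _ _ ((2 * t) ^+ i)).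
    by rewrite lerXn2r ?nnegrE ?cabs_ge0 // mulr_ge0 // ltW.
  rewrite exprMn ler_wpM2r ?exprn_ge0 ?(ltW t0) //.
  by rewrite ler_weXn2l ?ler1n // ltnW.
pose g := \poly_(j < D) (f j).[x].
have gE (j : 'I_D) : g`_j = (f j).[x] by rewrite coef_poly ltn_ord.
have rowE y : bipoly D c x y = g.[y] by exact: bipoly_row.
have g0 : g != 0.
  apply/eqP => gz; have := lowf q; rewrite -gE gz coef0 cabs0 mulr0 leNgt.
  apply/negP/negPn; rewrite (bigD1 p) //= ltr_wpDr ?mulr_gt0 ?cabs_gt0 ?exprn_gt0 //.
  by apply: sumr_ge0 => i _; rewrite mulr_ge0 ?cabs_ge0 ?exprn_ge0 ?(ltW t0).
have [y1 hy1] : exists y, bipoly D c x y != 0.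
  have := @max_poly_roots _ g [seq k%:R | k <- iota 0 D] g0.
  case: (boolP (all (root g) [seq k%:R | k <- iota 0 D])) => [_ h|].
    suff : (D < D)%N by rewrite ltnn.
    apply: (@leq_trans (size g)); last exact: size_poly.
    rewrite -{1}(size_iota 0 D) -(size_map (fun k => k%:R : R[i])); apply: h => //.
    by rewrite map_inj_uniq ?iota_uniq //; exact: mulrIn (oner_neq0 _).
  by move=> /allPn [y _ hy] _; exists y; rewrite rowE.
have [j0 Hj0] := @dominant_monomial R D g s0 s1 K s00 s01 hK g0 (size_poly _ _)
  (fun y ry => hr x y xs (ex_intro _ y1 hy1) (etrans (rowE y) (eqP ry))).
exists j0 => s j h0 h1 hj.
have sp : 0 < s by lra.
have sj k : 0 <= s ^+ k by rewrite exprn_ge0 // ltW.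
rewrite -!mulr_suml; apply: (@le_trans _ _ (C1 * (cabs g`_j * s ^+ j))).
  by rewrite mulrA ler_wpM2r // gE.
apply: (@le_trans _ _ (C1 * (2 ^+ D.+1 / K * (cabs g`_j0 * s ^+ j0)))).
  by rewrite ler_wpM2l // Hj0.
rewrite eE gE -/C1.
have -> : C1 * 2 ^+ D * 2 ^+ D.+1 / K * ((\sum_(i < D) cabs (c i j0) * t ^+ i) * s ^+ j0)
  = C1 * (2 ^+ D.+1 / K * ((2 ^+ D * (\sum_(i < D) cabs (c i j0) * t ^+ i)) * s ^+ j0)).
  by ring.
rewrite !(ler_wpM2l C10) // ler_wpM2l ?divr_ge0 ?exprn_ge0 ?(ltW K0) //.
by rewrite ler_wpM2r.
Qed.

(** By contraposition: if no test line carries a zero near the other annulus, [column_dominates],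
    applied to both variables, gives dominance on the sides of the rectangle of radii. Then one
    monomial exceeds the sum of the others on the whole product, which excludes the zero
    [(x, y)]. *)
Lemma dichotomy_centred (R : rcfType) (D : nat) :
  exists2 K : R, 1 <= K & forall (c : nat -> nat -> R[i]) t0 t1 s0 s1 x y,
    (exists i j : 'I_D, c i j != 0) ->
    0 < t0 -> t0 <= t1 -> 0 < s0 -> s0 <= s1 ->
    t0 <= cabs x -> cabs x <= t1 -> s0 <= cabs y -> cabs y <= s1 ->
    bipoly D c x y = 0 ->
    (exists x' y', [/\ x' \in ray_points (D * D).+1 t0 ++ ray_points (D * D).+1 t1,
       exists y, bipoly D c x' y != 0, bipoly D c x' y' = 0,
       s0 <= K * cabs y' & cabs y' <= K * s1])
    \/ (exists x' y', [/\ y' \in ray_points (D * D).+1 s0 ++ ray_points (D * D).+1 s1,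
       exists x, bipoly D c x y' != 0, bipoly D c x' y' = 0,
       t0 <= K * cabs x' & cabs x' <= K * t1]).
Proof.
case: D => [|D1]; first by exists 1 => // c t0 t1 s0 s1 x y [[]].
set D := D1.+1.
have d1 : (1 : R) <= D%:R by rewrite ler1n.
pose E : R := (10 * (D * D).+1%:R) ^+ D * 2 ^+ D * 2 ^+ D.+1.
have p2 : (1 : R) <= 2 ^+ D.+1 by rewrite exprn_ege1 // ler1n.
have hE : 2 ^+ D.+1 <= E.
  rewrite /E -[leLHS]mul1r ler_wpM2r ?(le_trans ler01 p2) //.
  rewrite mulr_ege1 ?exprn_ege1 ?ler1n //.
  by rewrite mulr_ege1 ?ler1n.
have eEdef : E = (10 * (D * D).+1%:R) ^+ D * 2 ^+ D * 2 ^+ D.+1 by [].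
clearbody E; pose K : R := 8 * D%:R ^+ 3 * E.
have D3 : (1 : R) <= D%:R ^+ 3 by rewrite exprn_ege1.
have hK : 2 ^+ D.+1 <= K.
  apply: (le_trans hE); rewrite /K -[leLHS]mul1r ler_wpM2r //; last by lra.
  exact: le_trans ler01 (le_trans p2 hE).
exists K; first by lra.
move=> c t0 t1 s0 s1 x y nz t00 t01 s00 s01 xt0 xt1 ys0 ys1 Fxy.
apply: contrapT => /not_orP [nA nB].
have K0 : 0 < K by lra.
have E0 : 0 < E by lra.
pose e := E / K.
have eE : e = 1 / (8 * D%:R ^+ 3).
  by rewrite /e /K; field; rewrite !gt_eqF //; lra.
have e0 : 0 <= e by rewrite /e divr_ge0 // ltW.
have t10 : 0 < t1 by lra.
have s10 : 0 < s1 by lra.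
have [||||||||||a [b [wab Hab]]] := @rectangle_dominates R D (fun i j => cabs (c i j)) t0 t1 s0 s1 e.
- by move=> i j; exact: cabs_ge0.
- by have [i [j h]] := nz; exists i, j; rewrite cabs_gt0.
- by [].
- by [].
- by [].
- by [].
- by [].
- rewrite eE; have -> : 8 * D%:R * (1 / (8 * D%:R ^+ 3)) = 1 / (D%:R ^+ 2) :> R.
    by field; rewrite gt_eqF //; lra.
  have D2 : (1 : R) <= D%:R ^+ 2 by rewrite exprn_ege1.
  by rewrite ler_pdivrMr ?mul1r //; lra.
- move=> t ht; apply: (@column_dominates _ D c t s0 s1 K E) => //.
    by case: ht => ->.
  move=> x' y' hx' hy hF h1; rewrite ltNge; apply/negP => h2; apply: nA.
  exists x', y'; split => //; rewrite mem_cat.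
  by case: ht hx' => -> ->; rewrite ?orbT.
- move=> s hs; pose c' i j := c j i.
  have sw u v : bipoly D c' u v = bipoly D c v u by rewrite bipoly_swap.
  have [||||||||i0 Hi0] := @column_dominates _ D c' s t0 t1 K E => //.
  + by case: hs => ->.
  + by have [i [j h]] := nz; exists j, i.
  + move=> y' x' hy' [x2 hx]; rewrite !sw in hx * => hF h1.
    rewrite ltNge; apply/negP => h2; apply: nB.
    exists x', y'; split => //; last by exists x2.
    by rewrite mem_cat; case: hs hy' => -> ->; rewrite ?orbT.
  + exists i0 => t i h0 h1 hi.
    have ac (k : nat) : \sum_(j < D) cabs (c' j k) * s ^+ j * t ^+ k =
        \sum_(j < D) cabs (c k j) * t ^+ k * s ^+ j.
      by apply: eq_bigr => j _; rewrite mulrAC.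
    by have := Hi0 t i h0 h1 hi; rewrite !ac.
have x0 : 0 < cabs x by lra.
have y0 : 0 < cabs y by lra.
pose W := cabs (c a b) * cabs x ^+ a * cabs y ^+ b.
have W0 : 0 < W by rewrite /W !mulr_gt0 ?exprn_gt0.
have eF : bipoly D c x y = \sum_(p : 'I_D * 'I_D) c p.1 p.2 * x ^+ p.1 * y ^+ p.2.
  by rewrite /bipoly pair_big.
move: Fxy; rewrite eF (bigD1 (a, b)) //= => /eqP; rewrite addr_eq0 => /eqP eab.
have : W <= \sum_(p : 'I_D * 'I_D | p != (a, b)) 4 * D%:R * e * W.
  have -> : W = cabs (c a b * x ^+ a * y ^+ b) by rewrite !cabsM !cabsX.
  rewrite {1}eab cabsN; apply: le_trans (cabs_sum _ _ _) _; apply: ler_sum => -[i j] hij /=.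
  by rewrite !cabsM !cabsX; apply: Hab.
rewrite sumr_const => hW.
have : #|(fun p : 'I_D * 'I_D => p != (a, b))|%:R <= (D%:R ^+ 2 : R).
  rewrite -natrX ler_nat; apply: leq_trans (max_card _) _.
  by rewrite card_prod !card_ord.
have eW : 4 * D%:R * e * W = W / (2 * D%:R ^+ 2).
  by rewrite eE; field; rewrite gt_eqF //; lra.
rewrite eW -mulr_natr in hW => hcard.
have : W / (2 * D%:R ^+ 2) * #|(fun p : 'I_D * 'I_D => p != (a, b))|%:R
   <= W / (2 * D%:R ^+ 2) * D%:R ^+ 2.
  by rewrite ler_wpM2l // divr_ge0 ?mulr_ge0 ?exprn_ge0 ?(ltW W0) //; lra.
have -> : W / (2 * D%:R ^+ 2) * D%:R ^+ 2 = W / 2.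
  by field; rewrite gt_eqF //; lra.
by lra.
Qed.

Lemma dichotomy (R : rcfType) (D : nat) :
  exists2 K : R, 1 <= K & forall (c : nat -> nat -> R[i]) z w t0 t1 s0 s1 x y,
    (exists x y, bipoly D c x y != 0) ->
    0 < t0 -> t0 <= t1 -> 0 < s0 -> s0 <= s1 ->
    t0 <= cabs (x - z) -> cabs (x - z) <= t1 ->
    s0 <= cabs (y - w) -> cabs (y - w) <= s1 ->
    bipoly D c x y = 0 ->
    (exists x' y', [/\ x' - z \in ray_points (D * D).+1 t0 ++ ray_points (D * D).+1 t1,
       exists y, bipoly D c x' y != 0, bipoly D c x' y' = 0,
       s0 <= K * cabs (y' - w) & cabs (y' - w) <= K * s1])
    \/ (exists x' y', [/\ y' - w \in ray_points (D * D).+1 s0 ++ ray_points (D * D).+1 s1,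
       exists x, bipoly D c x y' != 0, bipoly D c x' y' = 0,
       t0 <= K * cabs (x' - z) & cabs (x' - z) <= K * t1]).
Proof.
have [K K1 H] := dichotomy_centred R D.
exists K => // c z w t0 t1 s0 s1 x y [xn [yn nz]] t00 t01 s00 s01 xt0 xt1 ys0 ys1 F0.
have [c' Hc'] := bipoly_shift D c z w.
have sh u v : bipoly D c u v = bipoly D c' (u - z) (v - w) by rewrite -Hc' !subrK.
have nz' : exists i j : 'I_D, c' i j != 0.
  by apply: (@bipoly_neq0_coef _ _ _ (xn - z) (yn - w)); rewrite -sh.
rewrite sh in F0.
case: (H c' t0 t1 s0 s1 _ _ nz' t00 t01 s00 s01 xt0 xt1 ys0 ys1 F0) => -[x' [y' [h1 [v hv] h3 h4 h5]]].
  left; exists (x' + z), (y' + w); rewrite !addrK; split=> //.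
    by exists (v + w); rewrite Hc'.
  by rewrite Hc'.
right; exists (x' + z), (y' + w); rewrite !addrK; split=> //.
  by exists (v + z); rewrite Hc'.
by rewrite Hc'.
Qed.

(** * Cells *)

Lemma seq_argmin (T : eqType) (R : realDomainType) (s : seq T) (g : T -> R) :
  s != [::] -> exists2 x, x \in s & forall y, y \in s -> g x <= g y.
Proof.
elim: s => // x [|y s] IH _.
  by exists x; rewrite ?mem_head // => y; rewrite inE => /eqP ->.
have [//|z zs hz] := IH.
have [xz|xz] := lerP (g x) (g z).
  exists x; first exact: mem_head.
  by move=> w; rewrite inE => /orP[/eqP ->//|/hz]; exact: le_trans.
exists z; first by rewrite inE zs orbT.
by move=> w; rewrite inE => /orP[/eqP ->|/hz//]; exact: ltW.
Qed.

Lemma seq_argmax (T : eqType) (R : realDomainType) (s : seq T) (g : T -> R) :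
  s != [::] -> exists2 x, x \in s & forall y, y \in s -> g y <= g x.
Proof.
by move=> /(seq_argmin (fun x => - g x)) [x xs h]; exists x => // y /h; rewrite lerN2.
Qed.

Lemma sum_nat_const_seq (T : Type) (s : seq T) (m : nat) :
  (\sum_(x <- s) m = size s * m)%N.
Proof. by rewrite big_const_seq count_predT iter_addn addn0 mulnC. Qed.

Lemma sum_count_le (T U : eqType) (Z : seq T) (A : seq U) (B : T -> pred U) (M : nat) :
  (forall a, a \in A -> (count (fun z => B z a) Z <= M)%N) ->
  (\sum_(z <- Z) count (B z) A <= M * size A)%N.
Proof.
move=> h; apply: (@leq_trans (\sum_(a <- A) M)%N); last first.
  by rewrite sum_nat_const_seq mulnC.
have -> : (\sum_(z <- Z) count (B z) A = \sum_(a <- A) count (fun z => B z a) Z)%N.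
  under eq_bigr => z _ do rewrite -sum1_count big_mkcond.
  rewrite exchange_big; apply: eq_bigr => a _.
  by rewrite -sum1_count [in RHS]big_mkcond.
by rewrite big_seq [leqRHS]big_seq; exact: leq_sum.
Qed.

Lemma size_mul_le_disjoint (T U : eqType) (Z : seq T) (A : seq U) (B : T -> pred U) (m M : nat) :
  (forall a, a \in A -> (count (fun z => B z a) Z <= M)%N) ->
  (forall z, z \in Z -> (m <= count (B z) A)%N) -> (size Z * m <= M * size A)%N.
Proof.
move=> h1 h2; apply: leq_trans (sum_count_le h1).
rewrite -sum_nat_const_seq big_seq [leqRHS]big_seq; exact: leq_sum.
Qed.

Lemma count_fiber_uniq (T : eqType) (s : seq T) (x : T) :
  uniq s -> (count (fun y => x == y) s <= 1)%N.
Proof.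
move=> us; have -> : count (fun y => x == y) s = count_mem x s.
  by apply: eq_count => y /=; rewrite eq_sym.
by rewrite count_uniq_mem //; case: (_ \in _).
Qed.

Lemma uniq_size_image (T U : eqType) (s : seq T) (L : seq U) (f : T -> U) :
  uniq s -> {in s &, injective f} -> (forall x, x \in s -> f x \in L) ->
  (size s <= size L)%N.
Proof.
move=> us fi fL; rewrite -(size_map f); apply: uniq_leq_size.
  by rewrite map_inj_in_uniq.
by move=> _ /mapP [x xs ->]; exact: fL.
Qed.

Lemma size_fibers_le (T U : eqType) (s : seq T) (L : seq U) (f : T -> U) (m : nat) :
  (forall x, x \in s -> f x \in L) ->
  (forall u, u \in L -> (count (fun x => f x == u) s <= m)%N) ->
  (size s <= size L * m)%N.
Proof.
move=> fL hm.
have : (size s * 1 <= 1 * \sum_(u <- L) count (fun x => f x == u) s)%N.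
  rewrite mul1n; elim: s fL {hm} => [|x s IH] fL //=.
  have e : (\sum_(u <- L) ((f x == u) + count (fun x => f x == u) s) =
     count (fun u => f x == u) L + \sum_(u <- L) count (fun x => f x == u) s)%N.
    rewrite big_split /=; congr addn; rewrite -sum1_count [RHS]big_mkcond.
    by apply: eq_bigr => u _; case: eqP.
  rewrite muln1 e -add1n; apply: leq_add.
    rewrite -has_count; apply/hasP; exists (f x) => //; apply: fL; exact: mem_head.
  by rewrite -[X in (X <= _)%N]muln1; apply: IH => y ys; apply: fL; rewrite inE ys orbT.
rewrite muln1 mul1n => h; apply: leq_trans h _.
by rewrite -sum_nat_const_seq big_seq [leqRHS]big_seq; apply: leq_sum.
Qed.

(** [r] is the [m]-th smallest value of [g] on [A], counted with multiplicity. *)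
Lemma rank_radius (T : eqType) (R : realDomainType) (A : seq T) (g : T -> R) (m : nat) :
  (0 < m)%N -> (m <= size A)%N ->
  exists r, (m <= count (fun b => (g b <= r)%R) A)%N /\
    forall t, (m <= count (fun b => (g b < t)%R) A)%N -> r < t.
Proof.
move=> m0 mA; pose P b := (m <= count (fun b' => (g b' <= g b)%R) A)%N.
have A0 : A != [::] by rewrite -size_eq0 -lt0n (leq_trans m0).
have hP : [seq b <- A | P b] != [::].
  have [b bA hb] := seq_argmax g A0.
  rewrite -has_filter; apply/hasP; exists b => //; rewrite /P.
  suff -> : count (fun b' => (g b' <= g b)%R) A = size A by [].
  by apply/eqP; rewrite -all_count; apply/allP => b' /hb.
have [b] := seq_argmin g hP; rewrite mem_filter => /andP[Pb bA] hb.
exists (g b); split => // t ht.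
have h0 : [seq b <- A | g b < t] != [::].
  by rewrite -has_filter has_count; exact: leq_trans ht.
have [c] := seq_argmax g h0; rewrite mem_filter => /andP[ct cA] hc.
apply: le_lt_trans ct; apply: hb; rewrite mem_filter cA andbT /P.
apply: leq_trans ht _; rewrite -!sum1_count [leqRHS]big_mkcond [leqLHS]big_mkcond /=.
rewrite big_seq [leqRHS]big_seq; apply: leq_sum => b' bA'.
by case: ifP => // bt; rewrite hc // mem_filter bt.
Qed.

(** Vitali selection. Around each [a] take the smallest disc with [m] points of [A]; pick discs by
    increasing radius, discarding those that share a point of [A] with a picked one. The picked
    discs are disjoint on [A], which bounds their number, and a discarded disc shares a point with a
    picked one of no larger radius. *)
Lemma greedy_centres (R : rcfType) (A : seq R[i]) (m : nat) :
  (0 < m)%N -> exists Z : seq R[i], [/\ {subset Z <= A}, (size Z * m <= size A)%N &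
    forall a t, a \in A -> (m <= count (fun b => (cabs (b - a) < t)%R) A)%N ->
      exists2 z, z \in Z & cabs (a - z) < 2 * t].
Proof.
move=> m0; have [mA|Am] := leqP m (size A); last first.
  exists [::]; split => // a t _ h; exfalso.
  have : (count (fun b => (cabs (b - a) < t)%R) A <= size A)%N by exact: count_size.
  by rewrite leqNgt (leq_trans Am h).
have [rho Hrho] := @choice _ _ (fun a r => (m <= count (fun b => (cabs (b - a) <= r)%R) A)%N /\
    forall t, (m <= count (fun b => (cabs (b - a) < t)%R) A)%N -> r < t)
  (fun a => rank_radius (fun b => cabs (b - a)) m0 mA).
have [Z [ZA Zdis Zcov]] : exists Z : seq R[i], [/\ {subset Z <= A},
    forall b, (count (fun z => (cabs (b - z) <= rho z)%R) Z <= 1)%N \/ b \notin A &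
    forall a, a \in A -> exists2 z, z \in Z & cabs (a - z) <= 2 * rho a].
  have [n] := ubnP (size A).
  suff : forall A' : seq R[i], (size A' < n)%N -> {subset A' <= A} ->
    exists Z : seq R[i], [/\ {subset Z <= A'},
    forall b, (count (fun z => (cabs (b - z) <= rho z)%R) Z <= 1)%N \/ b \notin A &
    forall a, a \in A' -> exists2 z, z \in Z & cabs (a - z) <= 2 * rho a].
    by move=> H /H; apply.
  elim: n => // n IH A' sA' A'A.
  have [->|A'0] := eqVneq A' [::].
    by exists [::]; split => // b; left.
  have [a0 a0A' ha0] := seq_argmin rho A'0.
  pose meet a := has (fun b => (cabs (b - a) <= rho a) && (cabs (b - a0) <= rho a0)) A.
  have rho0 a : 0 <= rho a.
    have [h _] := Hrho a; have : has (fun b => cabs (b - a) <= rho a) A.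
      by rewrite has_count; exact: leq_trans h.
    by case/hasP => b _; apply: le_trans; exact: cabs_ge0.
  have ma0 : meet a0.
    have [h _] := Hrho a0; have : has (fun b => cabs (b - a0) <= rho a0) A.
      by rewrite has_count; exact: leq_trans h.
    by rewrite /meet; apply: sub_has => b ->.
  pose A2 := [seq a <- A' | ~~ meet a].
  have sA2 : (size A2 < n)%N.
    rewrite -ltnS; apply: leq_trans sA'; rewrite ltnS size_filter -(count_predC meet A').
    by rewrite -addn1 addnC leq_add2r -has_count; apply/hasP; exists a0.
  have [Z [ZA2 Zd Zc]] := IH A2 sA2 (fun a => fun h => A'A a (mem_subseq (filter_subseq _ _) h)).
  exists (a0 :: Z); split.
  - move=> z; rewrite inE => /orP[/eqP -> //|/ZA2]; rewrite mem_filter => /andP[] //.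
  - move=> b; case: (boolP (b \in A)) => [bA|]; last by right.
    left => /=; case: (boolP (cabs (b - a0) <= rho a0)) => hb; last first.
      by rewrite add0n; case: (Zd b) => //; rewrite bA.
    rewrite addnC addn1 ltnS leqn0 -leqn0 leqNgt -has_count; apply/hasPn => z /ZA2.
    rewrite mem_filter => /andP[hz _]; apply: contra hz => hz.
    by apply/hasP; exists b => //; rewrite hz hb.
  - move=> a aA'; case: (boolP (meet a)) => [/hasP [b bA /andP[h1 h2]]|hm].
      exists a0; first exact: mem_head.
      have := cabs_tri b a a0; rewrite [cabs (a - b)]cabsC => h3.
      have := ha0 a aA'; lra.
    have [|z zZ hz] := Zc a; first by rewrite mem_filter hm.
    by exists z; rewrite ?inE ?zZ ?orbT.
exists Z; split => //.
  rewrite -[X in (_ <= X)%N]mul1n.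
  apply: (@size_mul_le_disjoint _ _ Z A (fun z b => (cabs (b - z) <= rho z)%R)).
    by move=> a aA; case: (Zdis a) => //; rewrite aA.
  by move=> z _; have [] := Hrho z.
move=> a t aA h; have [z zZ hz] := Zcov a aA; exists z => //.
by have [_ /(_ t h)] := Hrho a; lra.
Qed.

(* Heights of a farthest-point ordering: the points of height at least t form a
   t-separated t-net of Z, for all scales t <= H simultaneously. *)
Definition net_height (R : rcfType) (Z : seq R[i]) (H : R) (h : R[i] -> R) :=
  [/\ forall z, z \in Z -> 0 < h z,
      forall u v, u \in Z -> v \in Z -> u != v ->
        h u <= cabs (u - v) \/ h v <= cabs (u - v) &
      forall z t, z \in Z -> 0 < t -> t <= H ->
        exists2 u, u \in Z & t <= h u /\ cabs (z - u) < t].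

(** Farthest-point insertion: [W] collects the points chosen so far and [d] is the current scale.
    The next point is one at maximal distance from [W], and this distance, capped by [d], is its
    height. *)
Lemma net_height_exists (R : rcfType) (Z : seq R[i]) (H : R) :
  Z != [::] -> 0 < H -> exists h, net_height Z H h.
Proof.
move=> Z0 H0.
pose Inv (W : seq R[i]) (d : R) (h : R[i] -> R) := [/\ {subset W <= Z}, W != [::], 0 < d &
  [/\ forall u, u \in W -> d <= h u,
    forall u v, u \in W -> v \in W -> u != v -> h u <= cabs (u - v) \/ h v <= cabs (u - v) &
    forall z t, z \in Z -> d < t -> t <= H -> exists2 u, u \in W & t <= h u /\ cabs (z - u) < t]].
suff : forall n (W : seq R[i]) d h, (count (fun z => z \notin W) Z < n)%N -> Inv W d h ->
    exists h, net_height Z H h.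
  case: Z Z0 @Inv => // z1 Z _ Inv /(_ (count (fun z => z \notin [:: z1]) (z1 :: Z)).+1 [:: z1] H (fun=> H)).
  apply => //; split => //.
    by move=> z; rewrite !inE => ->.
  split => // [u v|z t _ h1 h2]; last by lra.
  by rewrite !inE => /eqP -> /eqP ->; rewrite eqxx.
elim=> // n IH W d h hn [WZ W0 d0 [hd hsep hcov]].
case: (boolP (has (fun z => z \notin W) Z)) => [/hasP [z1 z1Z z1W]|/hasPn ZW]; last first.
  exists h; split.
  - by move=> z /ZW; rewrite negbK => /hd; exact: lt_le_trans.
  - by move=> u v /ZW uW /ZW vW; rewrite !negbK in uW vW; exact: hsep.
  - move=> z t zZ t0 tH; have [td|dt] := lerP t d; last first.
      by have [u /WZ uZ hu] := hcov z t zZ dt tH; exists u.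
    exists z => //; rewrite subrr cabs0; split => //.
    by apply: le_trans td _; apply: hd; have := ZW z zZ; rewrite negbK.
have [nr Hnr] : {nr : R[i] -> R[i] & forall z, nr z \in W /\ forall u, u \in W -> cabs (z - nr z) <= cabs (z - u)}.
  apply: (@choice _ _ (fun z v : R[i] => v \in W /\
    forall u, u \in W -> cabs (z - v) <= cabs (z - u))) => z.
  have [u uW hu] := seq_argmin (fun u => cabs (z - u)) W0.
  by exists u.
have [z2 z2Z hz2] := seq_argmax (fun z => cabs (z - nr z)) Z0.
set d1 := cabs (z2 - nr z2) in hz2.
have d10 : 0 < d1.
  apply: lt_le_trans (hz2 z1 z1Z); rewrite cabs_gt0 subr_eq0; apply: contra z1W => /eqP ->.
  by have [] := Hnr z1.
have hz2W u : u \in W -> d1 <= cabs (z2 - u) by have [_] := Hnr z2; apply.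
have z2W : z2 \notin W.
  by apply/negP => /hz2W; rewrite subrr cabs0 leNgt d10.
(* The cap matters while [Z] is wider than [H]; covering is claimed only for scales up to [H]. *)
pose d2 := Num.min d1 d.
have d2d1 : d2 <= d1 by rewrite /d2 ge_min lexx.
have d2d : d2 <= d by rewrite /d2 ge_min lexx orbT.
have d20 : 0 < d2 by rewrite /d2 lt_min d10.
pose h2 u := if u == z2 then d2 else h u.
have h2W u : u \in W -> h2 u = h u.
  by rewrite /h2; case: eqP => // -> uW; rewrite uW in z2W.
have h2z : h2 z2 = d2 by rewrite /h2 eqxx.
apply: (IH (z2 :: W) d2 h2).
  rewrite -ltnS; apply: leq_trans hn; rewrite ltnS.
  have -> : count (fun z => z \notin W) Z =
     (count (fun z => z \notin z2 :: W) Z + count (fun z => (z == z2) && (z \notin W)) Z)%N.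
    rewrite addnC -count_predUI [X in (_ + X)%N](_ : _ = 0%N) ?addn0; last first.
      rewrite -(count_pred0 Z); apply: eq_count => z /=.
      by rewrite inE negb_or; case: (z == z2); rewrite ?andbF.
    apply: eq_count => z /=; rewrite inE negb_or.
    by case: (z == z2); case: (z \in W).
  rewrite -addn1 leq_add2l -has_count; apply/hasP; exists z2 => //.
  by rewrite eqxx.
split => //.
  by move=> z; rewrite inE => /orP[/eqP ->|/WZ].
split.
- move=> u; rewrite inE => /orP[/eqP ->|uW]; first by rewrite h2z.
  by rewrite h2W //; apply: le_trans d2d _; exact: hd.
- move=> u v; rewrite !inE => /orP[/eqP ->|uW] /orP[/eqP ->|vW].
  + by rewrite eqxx.
  + by move=> _; left; rewrite h2z; apply: le_trans d2d1 _; exact: hz2W.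
  + by move=> _; right; rewrite h2z cabsC; apply: le_trans d2d1 _; exact: hz2W.
  + by rewrite !h2W //; exact: hsep.
- move=> z t zZ h1 tH; have [td|dt] := lerP t d; last first.
    have [u uW [hu1 hu2]] := hcov z t zZ dt tH.
    by exists u; rewrite ?inE ?uW ?orbT // h2W.
  exists (nr z); first by rewrite inE; have [-> _] := Hnr z; rewrite orbT.
  have [nW _] := Hnr z; rewrite h2W //; split; first by apply: le_trans td _; exact: hd.
  have d1t : d1 < t by move: h1; rewrite /d2 gt_min => /orP[//|]; lra.
  exact: le_lt_trans (hz2 z zZ) d1t.
Qed.

(** * Integer grids and packing *)

Definition grid (R : realType) (e : R) (v a : R[i]) : int * int :=
  (Num.floor (complex.Re (a - v) / e), Num.floor (complex.Im (a - v) / e)).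

Definition int_window (R : realType) (k : nat) (x : R) : seq int :=
  [seq Num.floor x - k%:Z + i%:Z | i <- iota 0 (2 * k + 1)].

Lemma mem_int_window (R : realType) (k : nat) (x : R) (g : int) :
  `|g%:~R - x| <= k%:R -> g \in int_window k x.
Proof.
rewrite ler_norml => /andP[h1 h2].
have f1 := floor_le x; have f2 := floorD1_gt x; rewrite intrD in f2.
set f := Num.floor x in f1 f2 *.
have k1 : ((k%:Z)%:~R : R) = k%:R by [].
have l1 : f - k%:Z <= g.
  by rewrite -(ler_int R) intrB k1; lra.
have l2 : g < f + k%:Z + 1.
  by rewrite -(ltr_int R) !intrD k1; lra.
apply/mapP; exists (absz (g - (f - k%:Z))%R); last by lia.
by rewrite mem_iota add0n /=; lia.
Qed.

Definition grid_window (R : realType) (k : nat) (x y : R) : seq (int * int) :=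
  [seq (i, j) | i <- int_window k x, j <- int_window k y].

Lemma size_grid_window (R : realType) (k : nat) (x y : R) :
  size (grid_window k x y) = ((2 * k + 1) ^ 2)%N.
Proof. by rewrite size_allpairs !size_map !size_iota. Qed.

Lemma grid_same (R : realType) (e : R) (v a b : R[i]) :
  0 < e -> grid e v a = grid e v b -> cabs (a - b) < 2 * e.
Proof.
move=> e0 [h1 h2]; apply: le_lt_trans (cabs_le_ReIm _) _.
have key (x y : R) : Num.floor (x / e) = Num.floor (y / e) -> `|x - y| < e.
  move=> h; have f1 := floor_le (x / e); have f2 := floorD1_gt (x / e).
  have f3 := floor_le (y / e); have f4 := floorD1_gt (y / e).
  rewrite -h in f3 f4; rewrite intrD in f2 f4.
  set f := (_%:~R : R) in f1 f2 f3 f4.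
  rewrite ler_pdivlMr // in f1; rewrite ltr_pdivrMr // in f2.
  rewrite ler_pdivlMr // in f3; rewrite ltr_pdivrMr // in f4.
  by rewrite ltr_norml; apply/andP; split; lra.
have := key _ _ h1; have := key _ _ h2.
have -> : complex.Re (a - v) - complex.Re (b - v) = complex.Re (a - b).
  by rewrite !raddfB /=; ring.
have -> : complex.Im (a - v) - complex.Im (b - v) = complex.Im (a - b).
  by rewrite !raddfB /=; ring.
lra.
Qed.

Lemma grid_mem_window (R : realType) (e : R) (k : nat) (v a : R[i]) :
  0 < e -> cabs (a - v) <= k%:R * e -> grid e v a \in grid_window k.+1 (0 : R) 0.
Proof.
move=> e0 h.
have key (x : R) : `|x| <= cabs (a - v) -> Num.floor (x / e) \in int_window k.+1 (0 : R).
  move=> hx; apply: mem_int_window; rewrite subr0.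
  have f1 := floor_le (x / e); have f2 := floorD1_gt (x / e); rewrite intrD in f2.
  have hh : `|x / e| <= k%:R.
    by rewrite normrM normfV (gtr0_norm e0) ler_pdivrMr //; lra.
  move: hh; rewrite !ler_norml -natr1 => /andP[h1 h2]; apply/andP; split; lra.
by apply/allpairsP; eexists (_, _); split; [apply/key/cabs_Re|apply/key/cabs_Im|].
Qed.

(** Two points in one square of mesh [t / 2] are closer than [t], so the points occupy different
    squares of a bounded window. *)
Lemma packing (R : realType) (s : seq R[i]) (y : R[i]) (t : R) (k : nat) :
  uniq s -> 0 < t -> (forall u v, u \in s -> v \in s -> u != v -> t <= cabs (u - v)) ->
  (forall u, u \in s -> cabs (u - y) <= k%:R * (t / 2)) ->
  (size s <= (2 * k.+1 + 1) ^ 2)%N.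
Proof.
move=> us t0 sep hy; rewrite -(size_grid_window k.+1 (0 : R) 0).
have e0 : 0 < t / 2 by rewrite divr_gt0.
apply: (uniq_size_image us) (fun u us => grid_mem_window e0 (hy u us)).
move=> u v hu hv h; apply/eqP/negPn/negP => /(sep u v hu hv).
by have := grid_same e0 h; lra.
Qed.

Lemma count_divn_iota (n m q : nat) : (0 < m)%N ->
  (count (fun k => (k %/ m)%N == q) (iota 0 n) <= m)%N /\
  ((q * m + m <= n)%N -> (m <= count (fun k => (k %/ m)%N == q) (iota 0 n))%N).
Proof.
move=> m0; have hq k : ((k %/ m)%N == q) = (q * m <= k < q * m + m)%N.
  by rewrite eqn_leq -ltnS ltn_divLR // leq_divRL // mulSn [(m + _)%N]addnC andbC.
split.
  rewrite -size_filter -[X in (_ <= X)%N](size_iota (q * m)).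
  apply: uniq_leq_size; first by rewrite filter_uniq // iota_uniq.
  by move=> k; rewrite mem_filter hq !mem_iota => /andP[].
move=> hn; rewrite -size_filter -[X in (X <= _)%N](size_iota (q * m)).
apply: uniq_leq_size; first exact: iota_uniq.
move=> k; rewrite mem_filter hq !mem_iota => /andP[h1 h2].
by rewrite h1 h2 /= add0n (leq_trans h2).
Qed.

Lemma block_partition (T : eqType) (R : realDomainType) (G : seq T) (key : T -> R) (m : nat) :
  uniq G -> (0 < m)%N -> exists blk : T -> nat, [/\
    forall a b, a \in G -> b \in G -> (blk a < blk b)%N -> key a <= key b,
    forall q, (count (fun a => blk a == q) G <= m)%N &
    forall a q, a \in G -> (q < blk a)%N -> (m <= count (fun a => blk a == q) G)%N].
Proof.
move=> uG m0; pose s := sort (fun a b => key a <= key b) G.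
have ps : perm_eq s G by rewrite perm_sort.
have us : uniq s by rewrite (perm_uniq ps).
have cnt P : count P G = count P s by apply/seq.permP; rewrite perm_sym.
have cidx q : count (fun a => (index a s %/ m)%N == q) G =
    count (fun k => (k %/ m)%N == q) (iota 0 (size s)).
  rewrite cnt -(count_map (fun a => index a s) (fun k => (k %/ m)%N == q)).
  congr count; apply: (@eq_from_nth _ 0%N); rewrite size_map ?size_iota // => i hi.
  have [x0 _] : exists x0, x0 \in s by case: (s) hi => // x0 s' _; exists x0; exact: mem_head.
  by rewrite (nth_map x0) // nth_iota // index_uniq.
exists (fun a => (index a s %/ m)%N); split.
- move=> a b aG bG hab.
  have hi : (index a s < index b s)%N.
    by rewrite ltnNge; apply/negP => h; move: hab; rewrite ltnNge leq_div2r.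
  have bs : b \in s by rewrite (perm_mem ps).
  have sorted_s : sorted (fun a b => key a <= key b) s.
    by apply: sort_sorted => u v; exact: le_total.
  have tr : transitive (fun a b => key a <= key b) by move=> u v w; exact: le_trans.
  have as_ : a \in s by rewrite (perm_mem ps).
  have := sorted_ltn_nth tr a sorted_s.
  move=> /(_ (index a s) (index b s)); rewrite !inE !index_mem => /(_ as_ bs hi).
  by rewrite !nth_index.
- by move=> q; rewrite cidx; have [] := count_divn_iota (size s) q m0.
- move=> a q aG ha; rewrite cidx; have [_] := count_divn_iota (size s) q m0; apply.
  have as_ : a \in s by rewrite (perm_mem ps).
  apply: (@leq_trans (index a s)); last by rewrite ltnW // index_mem.
  rewrite addnC -mulSn; apply: leq_trans (leq_trunc_div _ m).
  by rewrite leq_mul2r ha orbT.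
Qed.

(* A point a of distance t from Z is isolated when no height comparable to t
   occurs near it; then all of Z near a sits in a tiny disc around one point u. *)
Definition isolated (R : rcfType) (Z : seq R[i]) (h : R[i] -> R) (L t : R) (a : R[i]) :=
  forall v, v \in Z -> cabs (a - v) <= L * t -> h v < t / L \/ L * t < h v.

Definition isolated_at (R : rcfType) (Z : seq R[i]) (h : R[i] -> R) (L t : R) (a u : R[i]) :=
  [/\ u \in Z, L * t < h u, t <= cabs (a - u) /\ cabs (a - u) <= 2 * t,
     isolated Z h L t a &
     forall w, w \in Z -> cabs (w - u) < t / L \/ L * t / 8 < cabs (w - u)].

(** The net at scale [t] gives a point [u] close to [z], and isolation lifts its height above
    [L * t]. Any [w] at moderate distance has a net point of scale [t / L] next to it, whose height
    is lifted likewise; two points of such heights cannot be that close, so this net point is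
    [u]. *)
Lemma isolated_centre (R : rcfType) (Z : seq R[i]) (H : R) h (L t : R) (a z : R[i]) :
  net_height Z H h -> 32 <= L -> 0 < t -> t <= H -> z \in Z -> cabs (a - z) = t ->
  (forall w, w \in Z -> t <= cabs (a - w)) -> isolated Z h L t a ->
  exists u, isolated_at Z h L t a u.
Proof.
move=> [hpos hsep hcov] hL t0 tH zZ az hz hiso.
have tL : t / L <= t by rewrite ler_pdivrMr ?ler_peMr; nra.
have tL0 : 0 < t / L by rewrite divr_gt0 //; lra.
have Lt : 32 * t <= L * t by rewrite ler_wpM2r // ltW.
have [u uZ [hu zu]] := hcov z t zZ t0 tH.
have au : cabs (a - u) <= 2 * t by have := cabs_tri z a u; lra.
have hut : L * t < h u.
  by case: (hiso u uZ) => [||//]; lra.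
exists u; split => //; first by split => //; exact: hz.
move=> w wZ; have [wn|wf] := lerP (cabs (a - w)) (L * t / 4); last first.
  by right; have := cabs_tri u a w; rewrite [cabs (u - w)]cabsC; lra.
left; have [u2 u2Z [hu2 wu2]] := hcov w (t / L) wZ tL0 (le_trans tL tH).
have au2 : cabs (a - u2) <= L * t / 4 + t by have := cabs_tri w a u2; lra.
have hu2t : L * t < h u2 by case: (hiso u2 u2Z) => [||//]; lra.
have [<-//|ne] := eqVneq u2 u.
have := cabs_tri a u2 u; rewrite [cabs (u2 - a)]cabsC.
by case: (hsep u2 u u2Z uZ ne); lra.
Qed.

(** Counts the heights around [u] below the distance of [a], that is, the scales at which [Z]
    branches before [a]. Isolated points with the same [u] and the same rank lie in one gap of [Z],
    by [isolated_gap]. *)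
Definition height_rank (R : rcfType) (Z : seq R[i]) (h : R[i] -> R) (u a : R[i]) : nat :=
  count (fun v => [&& v != u, h v <= h u, cabs (v - u) <= 3 * h v & h v < cabs (a - u)]) Z.

(** A point [w] of [Z] in between, at distance [g] from [u], has a net point [v] of height
    comparable to [g] next to it, and [v] is counted in the rank of [a2] but not in that of [a1]. *)
Lemma isolated_gap (R : rcfType) (Z : seq R[i]) (H : R) h (L t1 t2 : R) (a1 a2 u : R[i]) :
  net_height Z H h -> 32 <= L -> 0 < t1 -> 0 < t2 -> t2 <= H ->
  isolated_at Z h L t1 a1 u -> isolated_at Z h L t2 a2 u ->
  cabs (a1 - u) <= cabs (a2 - u) -> height_rank Z h u a1 = height_rank Z h u a2 ->
  forall w, w \in Z -> cabs (w - u) < cabs (a1 - u) / L \/ L * cabs (a2 - u) / 16 < cabs (w - u).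
Proof.
move=> [hpos hsep hcov] hL t10 t20 t2H [uZ hu1 [a1l a1u] _ iso1] [_ hu2 [a2l a2u] _ iso2] a12 hrk w wZ.
set r1 := cabs (a1 - u) in a1l a1u a12 *; set r2 := cabs (a2 - u) in a2l a2u a12 *.
have L0 : 0 < L by lra.
have t1r : t1 / L <= r1 / L by rewrite ler_wpM2r ?invr_ge0 ?(ltW L0).
have t2r : t2 / L <= r2 / L by rewrite ler_wpM2r ?invr_ge0 ?(ltW L0).
have r2L : r2 / L <= r2 / 32.
  by rewrite ler_wpM2l ?lef_pV2 ?posrE //; lra.
have h1 : L * r1 <= L * (2 * t1) by rewrite ler_wpM2l // ltW.
have h2 : L * r2 <= L * (2 * t2) by rewrite ler_wpM2l // ltW.
have h3 : 32 * r1 <= L * r1 by rewrite ler_wpM2r //; lra.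
have h4 : 32 * t2 <= L * t2 by rewrite ler_wpM2r //; lra.
case: (iso1 w wZ) => [|w1]; first by left; lra.
case: (iso2 w wZ) => [w2|]; last by right; lra.
set g := cabs (w - u) in w1 w2 *.
have g0 : 0 < g / 2 by lra.
have [v vZ [hv wv]] := hcov w (g / 2) wZ g0 ltac:(lra).
have vu : v != u by apply: contraTneq wv => ->; rewrite -/g -leNgt; lra.
have vu3 : cabs (v - u) < 3 * (g / 2).
  by have := cabs_tri w v u; rewrite [cabs (v - w)]cabsC -/g; lra.
have hvg : h v < 3 * (g / 2).
  by case: (hsep v u vZ uZ vu) => // ; lra.
suff : (height_rank Z h u a1 < height_rank Z h u a2)%N by rewrite hrk ltnn.
rewrite /height_rank -/r1 -/r2.
set P1 := (X in count X Z); set P2 := (X in (_ < count X Z)%N).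
have sub : subpred P1 P2.
  by move=> x; rewrite /P1 /P2 => /and4P[-> -> -> hx] /=; exact: lt_le_trans hx a12.
have -> : count P2 Z = (count P1 Z + count (predD P2 P1) Z)%N.
  rewrite -count_predUI [X in (_ + X)%N](_ : _ = 0%N) ?addn0; last first.
    by rewrite -(count_pred0 Z); apply: eq_count => x /=; case: (P1 x).
  by apply: eq_count => x /=; case e : (P1 x) => //=; rewrite sub.
rewrite -[X in (X < _)%N]addn0 ltn_add2l -has_count; apply/hasP; exists v => //=.
have hvu : h v <= h u by lra.
apply/andP; split; last by apply/and4P; split => //; lra.
by apply/negP => /and4P[_ _ _]; rewrite ltNge => /negP; apply; lra.
Qed.

(** A larger rank is witnessed by a height between the two distances from [u]; isolation at [a1] and
    at [a2] keeps this height a factor of order [L] away from either. *)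
Lemma isolated_rank_gap (R : rcfType) (Z : seq R[i]) (H : R) h (L t1 t2 : R) (a1 a2 u : R[i]) :
  net_height Z H h -> 32 <= L -> 0 < t1 -> 0 < t2 ->
  isolated_at Z h L t1 a1 u -> isolated_at Z h L t2 a2 u ->
  (height_rank Z h u a1 < height_rank Z h u a2)%N ->
  L * (L * cabs (a1 - u)) < 8 * cabs (a2 - u).
Proof.
move=> [hpos hsep hcov] hL t10 t20 [uZ hu1 [a1l a1u] i1 _] [_ hu2 [a2l a2u] i2 _] hrk.
set r1 := cabs (a1 - u) in a1l a1u *; set r2 := cabs (a2 - u) in a2l a2u *.
have L0 : 0 < L by lra.
have [v vZ [vu hvu v3 hv1 hv2]] : exists2 v, v \in Z &
    [/\ v != u, h v <= h u, cabs (v - u) <= 3 * h v, r1 <= h v & h v < r2].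
  apply: contrapT => nex; move: hrk; apply/negP; rewrite -leqNgt /height_rank -/r1 -/r2.
  rewrite -!sum1_count big_mkcond [leqRHS]big_mkcond big_seq [leqRHS]big_seq /=.
  apply: leq_sum => v vZ; case: and4P => // -[q1 q2 q3 q4].
  case: and4P => // nq; exfalso; apply: nq; split => //.
  by rewrite ltNge; apply/negP => h5; apply: nex; exists v.
have h4 : 32 * t2 <= L * t2 by rewrite ler_wpM2r //; lra.
have h5 : 32 * t1 <= L * t1 by rewrite ler_wpM2r //; lra.
have hv4 : L * t1 / 4 < h v.
  rewrite ltNge; apply/negP => hle.
  have hL1 : t1 / L <= t1 by rewrite ler_pdivrMr ?ler_peMr //; lra.
  case: (i1 v vZ); [|lra|lra].
  have := cabs_tri u a1 v; rewrite [cabs (u - v)]cabsC -/r1; lra.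
have hv5 : h v < t2 / L.
  case: (i2 v vZ) => [|//|]; last by lra.
  have := cabs_tri u a2 v; rewrite [cabs (u - v)]cabsC -/r2; lra.
have hv6 : h v < r2 / L.
  by apply: lt_le_trans hv5 _; rewrite ler_wpM2r ?invr_ge0 ?(ltW L0).
rewrite ltr_pdivlMr // in hv6.
have : L * (L * r1) <= L * (L * (2 * t1)) by rewrite !ler_wpM2l ?(ltW L0).
have : L * (L * t1 / 4) < L * h v by rewrite ltr_pM2l.
lra.
Qed.

Lemma sub_count_in (T : eqType) (P Q : pred T) (s : seq T) :
  (forall x, x \in s -> P x -> Q x) -> (count P s <= count Q s)%N.
Proof.
move=> h; rewrite -!sum1_count big_mkcond [leqRHS]big_mkcond big_seq [leqRHS]big_seq.
by apply: leq_sum => x xs; case: ifP => // Px; rewrite h.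
Qed.

Lemma middle_size (qs : seq nat) : uniq qs ->
  (size qs <= size [seq q <- qs | has (fun p => p < q)%N qs && has (fun p => q < p)%N qs] + 2)%N.
Proof.
move=> us; rewrite size_filter; set P := (X in count X qs).
rewrite -(count_predC P qs) leq_add2l.
pose P1 := fun q => all (fun p => q <= p)%N qs; pose P2 := fun q => all (fun p => p <= q)%N qs.
have h1 : (count P1 qs <= 1)%N.
  rewrite -size_filter; apply: (@uniq_size_image _ _ _ [:: tt] (fun=> tt)) => //.
    exact: filter_uniq.
  move=> x y; rewrite !mem_filter => /andP[/allP hx xs] /andP[/allP hy ys] _.
  by apply/eqP; rewrite eqn_leq hx // hy.
have h2 : (count P2 qs <= 1)%N.
  rewrite -size_filter; apply: (@uniq_size_image _ _ _ [:: tt] (fun=> tt)) => //.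
    exact: filter_uniq.
  move=> x y; rewrite !mem_filter => /andP[/allP hx xs] /andP[/allP hy ys] _.
  by apply/eqP; rewrite eqn_leq hx // hy.
apply: leq_trans (leq_add h1 h2).
rewrite -count_predUI; apply: leq_trans (leq_addr _ _).
apply: sub_count => q; rewrite /P /= negb_and -!all_predC /P1 /P2 => /orP[] h; apply/orP.
  by left; apply: sub_all h => p /=; rewrite -leqNgt.
by right; apply: sub_all h => p /=; rewrite -leqNgt.
Qed.

Section Cells.

Variables (R : realType) (K : R) (A : seq R[i]) (m r : nat) (Z : seq R[i]).
Variables (near : R[i] -> R[i]) (H : R) (h : R[i] -> R) (up : R[i] -> R[i]).
Variable blk : R[i] * nat -> R[i] -> nat.

Let t (y : R[i]) := cabs (y - near y).
(** [L] is a large multiple of [K] so that an annulus in a gap of [Z] stays in the gap when dilated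
    by [K]. [L'] makes the squares so fine that a point reached from the square of [a] is within
    [t a / 4] of [a]. *)
Let L := 64 * K.
Let L' := 40 * K * L.

Definition near_high (a : R[i]) :=
  has (fun v => [&& t a / L <= h v, h v <= L * t a & cabs (a - v) <= L * t a]) Z.

Definition high_pick (a : R[i]) := nth 0 Z
  (find (fun v => [&& t a / L <= h v, h v <= L * t a & cabs (a - v) <= L * t a]) Z).

Definition chain_group (u : R[i]) (i : nat) := [seq a <- A |
  [&& a \notin Z, ~~ near_high a, up a == u & height_rank Z h u a == i]].

Hypotheses (K1 : 1 <= K) (uA : uniq A) (m0 : (0 < m)%N) (uZ : uniq Z).
Hypothesis dens : forall a s, a \in A ->
  (m <= count (fun b => (cabs (b - a) < s)%R) A)%N -> exists2 z, z \in Z & cabs (a - z) < 2 * s.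
Hypothesis nearP : forall y, near y \in Z /\ forall z, z \in Z -> t y <= cabs (y - z).
Hypothesis netP : net_height Z H h.
Hypothesis tH : forall a, a \in A -> t a <= H.
Hypothesis upP : forall a, a \in A -> a \notin Z -> ~~ near_high a ->
  isolated_at Z h L (t a) a (up a).
Hypothesis blkP : forall g, [/\
  forall a b, a \in chain_group g.1 g.2 -> b \in chain_group g.1 g.2 ->
    (blk g a < blk g b)%N -> cabs (a - g.1) <= cabs (b - g.1),
  forall q, (count (fun a => blk g a == q) (chain_group g.1 g.2) <= m)%N &
  forall a q, a \in chain_group g.1 g.2 -> (q < blk g a)%N ->
    (m <= count (fun a => blk g a == q) (chain_group g.1 g.2))%N].

(* Each point of [Z] forms its own cell.  If some height near [a] is comparable to the distance [t a]
   from [a] to [Z], the cell of [a] is a square of a grid of that mesh.  Otherwise [Z] looks like the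
   single point [up a] from [a], and the cells are annuli around [up a]: these points are sorted by
   distance to [up a] and cut into blocks of [m], separately between consecutive scales of [Z]. *)
Definition label (a : R[i]) : R[i] + (R[i] * (int * int) + R[i] * nat * nat) :=
  if a \in Z then inl a else
  if near_high a then inr (inl (high_pick a, grid (h (high_pick a) / L') (high_pick a) a))
  else inr (inr (up a, height_rank Z h (up a) a, blk (up a, height_rank Z h (up a) a) a)).

Lemma L_ge : 64 <= L.
Proof. by rewrite /L; have := K1; lra. Qed.

Lemma t_gt0 a : a \notin Z -> 0 < t a.
Proof.
move=> aZ; rewrite cabs_gt0 subr_eq0; apply: contra aZ => /eqP ->.
by have [] := nearP a.
Qed.

Lemma t_lip a b : t a <= t b + cabs (a - b).
Proof.
have [nb _] := nearP b; have [_ /(_ _ nb) h1] := nearP a.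
by have := cabs_tri b a (near b); rewrite -/(t b); lra.
Qed.

(** A disc of radius [t a / 2] with [m] points would force a point of [Z] closer to [a] than [t a].
    This is why the squares near [a] need no counting: their small diameter already limits their
    points. *)
Lemma half_ball_count a : a \in A -> (count (fun b => (cabs (b - a) < t a / 2)%R) A < m)%N.
Proof.
move=> aA; rewrite ltnNge; apply/negP => /(dens aA) [z zZ hz].
by have [_ /(_ z zZ)] := nearP a; lra.
Qed.

Lemma close_count (P : pred R[i]) : (forall a b, P a -> P b -> a \in A -> b \in A ->
  cabs (b - a) < t a / 2) -> (count P A <= m)%N.
Proof.
move=> hP; case: (boolP (has P A)) => [/hasP [a aA Pa]|]; last first.
  by rewrite has_count -eqn0Ngt => /eqP ->.
apply: leq_trans (ltnW (half_ball_count aA)).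
rewrite -!sum1_count big_mkcond [leqRHS]big_mkcond big_seq [leqRHS]big_seq.
by apply: leq_sum => b bA; case: ifP => // Pb; rewrite hP.
Qed.

Lemma high_pickP a : near_high a -> [/\ high_pick a \in Z, t a / L <= h (high_pick a),
  h (high_pick a) <= L * t a & cabs (a - high_pick a) <= L * t a].
Proof.
move=> na; have /and3P[h1 h2 h3] := nth_find 0 na.
by split => //; rewrite /high_pick mem_nth // -has_find.
Qed.

Lemma label_single a z : label a = inl z -> a = z /\ z \in Z.
Proof. by rewrite /label; case: ifP => [aZ [<-]//|_]; case: ifP. Qed.

Lemma label_disc a v g : label a = inr (inl (v, g)) ->
  [/\ a \notin Z, near_high a, v = high_pick a & g = grid (h v / L') v a].
Proof.
rewrite /label; case: ifP => // aZ; case: ifP => // na [e1 e2].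
by split => //; rewrite -?e1 ?e2.
Qed.

Lemma label_chain a u i q : a \in A -> label a = inr (inr (u, i, q)) ->
  [/\ a \notin Z, up a = u, height_rank Z h u a = i, a \in chain_group u i & blk (u, i) a = q].
Proof.
rewrite /label => aA; case: ifP => // /negbT aZ; case: ifP => // /negbT na [e1 e2 e3].
subst u; subst i; split => //.
by rewrite mem_filter aZ na !eqxx.
Qed.

Lemma chain_group_label a u i : a \in chain_group u i ->
  a \in A /\ label a = inr (inr (u, i, blk (u, i) a)).
Proof.
rewrite mem_filter => /andP[/and4P[aZ na /eqP <- /eqP <-] aA].
by rewrite /label (negbTE aZ) (negbTE na).
Qed.

Lemma isolated_label a u i q : a \in A -> label a = inr (inr (u, i, q)) ->
  isolated_at Z h L (t a) a u /\ height_rank Z h u a = i.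
Proof.
move=> aA hl; have [aZ e1 e2 ag e3] := label_chain aA hl; split => //.
rewrite -e1; apply: upP => //.
by move: ag; rewrite mem_filter => /andP[/and4P[]].
Qed.

Lemma height_scale a : near_high a -> a \notin Z ->
  0 < h (high_pick a) / L' /\ 2 * (h (high_pick a) / L') <= t a / 2 /\
  10 * K * (h (high_pick a) / L') <= t a / 4.
Proof.
move=> na aZ; have [vZ h1 h2 h3] := high_pickP na.
have t0 := t_gt0 aZ; have hL := L_ge; have hK := K1.
have KL : 64 <= K * L by nra.
have L'0 : 0 < L' by rewrite /L'; lra.
have [hpos _ _] := netP; have hv0 := hpos _ vZ.
split; first by rewrite divr_gt0.
have e : h (high_pick a) / L' <= t a / (40 * K).
  rewrite ler_pdivrMr // /L'; apply: le_trans h2 _.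
  have -> : t a / (40 * K) * (40 * K * L) = L * t a by field; lra.
  exact: lexx.
have e2 : t a / (40 * K) <= t a / 40.
  by rewrite ler_wpM2l ?(ltW t0) // lef_pV2 ?posrE //; lra.
split; first by lra.
apply: (@le_trans _ _ (10 * K * (t a / (40 * K)))); first by rewrite ler_wpM2l //; lra.
have -> : 10 * K * (t a / (40 * K)) = t a / 4 by field; lra.
exact: lexx.
Qed.

Lemma label_class_size l : (count (fun a => label a == l) A <= m)%N.
Proof.
case: l => [z|[[v g]|[[u i] q]]].
- apply: (@leq_trans (count (fun a => a == z) A)).
    by apply: sub_count => a /eqP /label_single [-> _]; rewrite eqxx.
  by rewrite -/(count_mem z A) count_uniq_mem //; case: (_ \in _).
- apply: close_count => a b /eqP la /eqP lb _ _.
  have [aZ na ea eg] := label_disc la; have [bZ nb eb eg'] := label_disc lb.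
  have [e0 [e1 _]] := height_scale na aZ; rewrite -ea in e0 e1.
  by have := @grid_same R _ v b a e0 (etrans (esym eg') eg); lra.
- have [_ h2 _] := blkP (u, i); apply: leq_trans (h2 q).
  rewrite /= count_filter; apply: sub_count_in => a aA /= /eqP la.
  have [_ _ _ ag ->] := label_chain aA la; rewrite eqxx /=.
  by move: ag; rewrite mem_filter => /andP[].
Qed.

Definition labels := undup [seq label a | a <- A].

Lemma labelsP l : reflect (exists2 a, a \in A & label a = l) (l \in labels).
Proof.
rewrite mem_undup; apply: (iffP mapP) => -[a aA e]; exists a => //.
Qed.

Definition is_single (l : R[i] + (R[i] * (int * int) + R[i] * nat * nat)) :=
  if l is inl _ then true else false.
Definition is_disc (l : R[i] + (R[i] * (int * int) + R[i] * nat * nat)) :=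
  if l is inr (inl _) then true else false.
Definition is_chain (l : R[i] + (R[i] * (int * int) + R[i] * nat * nat)) :=
  if l is inr (inr _) then true else false.

Lemma count_labels (P : pred (R[i] + (R[i] * (int * int) + R[i] * nat * nat))) s :
  (count P s = count (fun l => P l && is_single l) s +
    (count (fun l => P l && is_disc l) s + count (fun l => P l && is_chain l) s))%N.
Proof.
elim: s => //= l s ->; case: l => [z|[x|x]] /=; case: (P _) => /=; lia.
Qed.

Definition kmesh := Num.bound (L * L * L').

Lemma num_single : (count is_single labels <= size Z)%N.
Proof.
rewrite -size_filter.
apply: (@uniq_size_image _ _ _ _ (fun l => if l is inl z then z else 0 : R[i])).
- by rewrite filter_uniq // undup_uniq.
- by case=> [z|x] [z'|x']; rewrite !mem_filter //= => _ _ ->.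
case=> [z|x]; rewrite mem_filter //= => /labelsP [a aA la].
by have [] := label_single la.
Qed.

(** The points whose square is attached to [v] are within [L * L * h v] of it, which is a bounded
    number of meshes [h v / L']. *)
Lemma num_disc : (count is_disc labels <= size Z * (2 * kmesh.+1 + 1) ^ 2)%N.
Proof.
rewrite -size_filter -(size_grid_window kmesh.+1 (0 : R) 0).
set win := grid_window _ _ _; rewrite -(size_allpairs pair).
apply: (@uniq_size_image _ _ _ _ (fun l => if l is inr (inl x) then x else (0 : R[i], (0 : int, 0 : int)))).
- by rewrite filter_uniq // undup_uniq.
- by case=> [z|[x|x]] [z'|[x'|x']]; rewrite !mem_filter //= => _ _ ->.
case=> [z|[[v g]|x]]; rewrite mem_filter; [by []| |by []].
case/andP=> _ /labelsP [a aA /label_disc [aZ na ev eg]].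
have [vZ h1 h2 h3] := high_pickP na; rewrite -ev in vZ h1 h2 h3.
have [e0 _] := height_scale na aZ; rewrite -ev in e0.
have L0 : 0 < L by have := L_ge; lra.
have L'0 : 0 < L' by rewrite /L'; have := L_ge; have := K1; nra.
apply/allpairsP; exists (v, g); split; [exact: vZ| |by []].
rewrite [(v, g).2]eg; apply: grid_mem_window; first exact: e0.
apply: (@le_trans _ _ (L * L * L' * (h v / L'))); last first.
  rewrite ler_wpM2r ?(ltW e0) //; apply/ltW/archi_boundP.
  exact: mulr_ge0 (mulr_ge0 (ltW L0) (ltW L0)) (ltW L'0).
have -> : L * L * L' * (h v / L') = L * (L * h v) by field; rewrite gt_eqF.
apply: le_trans h3 _; rewrite ler_wpM2l ?(ltW L0) //.
by move: h1; rewrite ler_pdivrMr // mulrC.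
Qed.

(** For fixed [v] the points [u] have height at least [h v], so they are [h v]-separated, and they
    are within [3 * h v] of [v]. Packing with [k = 6] gives [225 = 15 ^ 2]. *)
Lemma sum_heights : (\sum_(u <- Z) count (fun v => [&& v != u, h v <= h u & cabs (v - u) <= 3 * h v]%R) Z
  <= 225 * size Z)%N.
Proof.
have [hpos hsep _] := netP.
apply: sum_count_le => v vZ; rewrite -size_filter; apply: (@packing _ _ v (h v) 6).
- exact: filter_uniq.
- exact: hpos.
- move=> u w; rewrite !mem_filter => /andP[/and3P[_ h1 _] hu] /andP[/and3P[_ h2 _] hw] uw.
  by case: (hsep u w hu hw uw); apply: le_trans.
- move=> u; rewrite mem_filter => /andP[/and3P[_ _ h3] _].
  by rewrite cabsC; apply: le_trans h3 _; have := hpos v vZ; lra.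
Qed.

(** There is at most one first block for each [u] and each value of the rank, and the ranks at [u]
    do not exceed the count summed in [sum_heights]; this gives [226 = 1 + 225]. *)
Lemma num_chain0 : (count (fun l => is_chain l &&
  (if l is inr (inr (_, _, q)) then q == 0 else false)) labels <= 226 * size Z)%N.
Proof.
pose V u := count (fun v => [&& v != u, h v <= h u & cabs (v - u) <= 3 * h v]) Z.
have hV : (size (flatten [seq [seq (u, i) | i <- iota 0 (V u).+1] | u <- Z]) <= 226 * size Z)%N.
  rewrite size_flatten sumnE !big_map.
  under eq_bigr => u _ do rewrite size_map size_iota -add1n.
  rewrite big_split /= sum_nat_const_seq muln1 (_ : 226 = 1 + 225)%N // mulnDl mul1n leq_add2l.
  exact: sum_heights.
apply: leq_trans hV; rewrite -size_filter.
apply: (@uniq_size_image _ _ _ _ (fun l => if l is inr (inr (u, i, q)) then (u, i) else (0 : R[i], 0%N))).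
- by rewrite filter_uniq // undup_uniq.
- case=> [z|[x|[[u i] q]]] [z'|[x'|[[u' i'] q']]]; rewrite !mem_filter //=.
  by case/andP=> /eqP -> _ /andP[/eqP -> _] [-> ->].
case=> [z|[x|[[u i] q]]]; rewrite mem_filter; [by []|by []|].
case/andP=> _ /labelsP [a aA la]; have [[hu _ _ _ _] hi] := isolated_label aA la.
apply/flattenP; exists [seq (u, i) | i <- iota 0 (V u).+1]; first by apply/mapP; exists u.
apply/mapP; exists i => //; rewrite mem_iota /= add0n ltnS -hi; apply: sub_count => v.
by case/and4P => -> -> ->.
Qed.

(** A block other than the first is charged to the block before it, which is full and so has at
    least [m] points. *)
Lemma num_chainS : (count (fun l => is_chain l &&
  (if l is inr (inr (_, _, q)) then q != 0 else false)) labels * m <= size A)%N.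
Proof.
rewrite -size_filter -[X in (_ <= X)%N]mul1n.
apply: (@size_mul_le_disjoint _ _ _ _ (fun l a =>
  if l is inr (inr (u, i, q)) then label a == inr (inr (u, i, q.-1)) else false)).
  move=> a aA; rewrite -size_filter.
  apply: (@uniq_size_image _ _ _ [:: tt] (fun=> tt)) => //.
    by rewrite !filter_uniq // undup_uniq.
  case=> [z|[x|[[u i] q]]] [z'|[x'|[[u' i'] q']]]; rewrite !mem_filter //=.
  case/and3P => /eqP -> q0 _ /and3P[/eqP[-> -> e] q0' _] _.
  by congr (inr (inr (_, _, _))); lia.
case=> [z|[x|[[u i] q]]]; rewrite mem_filter //= => /andP[q0 /labelsP [a aA la]].
have [aZ e1 e2 ag e3] := label_chain aA la.
have [_ _ hfull] := blkP (u, i); have := hfull a q.-1 ag.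
rewrite /= e3 prednK ?lt0n // => /(_ (leqnn _)) => hm; apply: leq_trans hm _.
rewrite {1}/chain_group count_filter; apply: sub_count_in => b bA /andP[/eqP hb hg].
have bg : b \in chain_group u i by rewrite mem_filter hg.
by have [_ ->] := chain_group_label bg; rewrite hb eqxx.
Qed.

(** [228 = 1 + 226 + 1], for the points of [Z], the first blocks and the later blocks; the square
    term counts the grid squares. *)
Lemma num_labels : (size A <= m * r)%N -> (size Z <= r)%N ->
  (size labels <= (228 + (2 * kmesh.+1 + 1) ^ 2) * r)%N.
Proof.
move=> Amr Zr; have -> : size labels = count predT labels by rewrite count_predT.
rewrite count_labels.
have h1 := num_single; have h2 := num_disc; have h3 := num_chain0; have h4 := num_chainS.
set W := ((2 * kmesh.+1 + 1) ^ 2)%N in h2 *.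
have {}h4 : (count (fun l => is_chain l &&
  (if l is inr (inr (_, _, q)) then q != 0 else false)) labels <= r)%N.
  by rewrite -(leq_pmul2r m0) [(r * m)%N]mulnC; exact: leq_trans h4 Amr.
have e : (count (fun l => predT l && is_chain l) labels = 
   count (fun l => is_chain l && (if l is inr (inr (_, _, q)) then q == 0 else false)) labels +
   count (fun l => is_chain l && (if l is inr (inr (_, _, q)) then q != 0 else false)) labels)%N.
  by elim: labels => //= l s ->; case: l => [z|[x|[[u i] [|q]]]] /=; lia.
rewrite e (eq_count (a2 := is_single)) // (eq_count (a1 := fun l => _ && is_disc l) (a2 := is_disc)) //.
have h5 : (size Z * W <= W * r)%N by rewrite mulnC leq_mul2l Zr orbT.
have h6 : (226 * size Z <= 226 * r)%N by rewrite leq_mul2l Zr orbT.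
rewrite mulnDl; lia.
Qed.

Variable eta : R.
Hypothesis eta_gt0 : 0 < eta.
Hypothesis eta_sep : forall u v, u \in Z -> v \in Z -> u != v -> 8 * K * eta <= cabs (u - v).

(* Centres are placed so that no point of the cell sits on its centre. *)
Definition centre (l : R[i] + (R[i] * (int * int) + R[i] * nat * nat)) : R[i] :=
  match l with
  | inl z => z + (eta%:C)%C
  | inr (inl (v, (i, j))) => v + Complex (h v / L' * (i%:~R - 3)) (h v / L' * j%:~R)
  | inr (inr (u, _, _)) => u
  end.

Lemma disc_dist (e : R) (v a : R[i]) (i j : int) : 0 < e -> (i, j) = grid e v a ->
  0 < cabs (a - (v + Complex (e * (i%:~R - 3)) (e * j%:~R))) /\
  cabs (a - (v + Complex (e * (i%:~R - 3)) (e * j%:~R))) <= 5 * e.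
Proof.
move=> e0 [ei ej]; set c := Complex _ _.
have eR : complex.Re (a - (v + c)) = complex.Re (a - v) - e * (i%:~R - 3).
  by rewrite !(raddfB, raddfD) /=; ring.
have eI : complex.Im (a - (v + c)) = complex.Im (a - v) - e * j%:~R.
  by rewrite !(raddfB, raddfD) /=; ring.
have f1 := floor_le (complex.Re (a - v) / e); have f2 := floorD1_gt (complex.Re (a - v) / e).
have f3 := floor_le (complex.Im (a - v) / e); have f4 := floorD1_gt (complex.Im (a - v) / e).
rewrite -ei in f1 f2; rewrite -ej in f3 f4; rewrite intrD in f2 f4.
rewrite ler_pdivlMr // in f1; rewrite ltr_pdivrMr // in f2.
rewrite ler_pdivlMr // in f3; rewrite ltr_pdivrMr // in f4.
have h1 : 3 * e <= complex.Re (a - (v + c)) by rewrite eR; lra.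
have h2 : complex.Re (a - (v + c)) <= 4 * e by rewrite eR; lra.
have h3 : 0 <= complex.Im (a - (v + c)) by rewrite eI; lra.
have h4 : complex.Im (a - (v + c)) <= e by rewrite eI; lra.
split.
  by have := cabs_Re (a - (v + c)); have := ler_norm (complex.Re (a - (v + c))); lra.
apply: le_trans (cabs_le_ReIm _) _; rewrite !ger0_norm //; lra.
Qed.

Lemma centre_gt0 a : a \in A -> 0 < cabs (a - centre (label a)).
Proof.
move=> aA; case el : (label a) => [z|[[v [i j]]|[[u i] q]]] /=.
- have [-> _] := label_single el.
  by rewrite opprD addrA subrr add0r cabsN cabs_real gtr0_norm.
- have [aZ na ev eg] := label_disc el; have [e0 _] := height_scale na aZ.
  by rewrite -ev in e0; have [] := disc_dist e0 eg.
- have [[_ _ [h1 _] _ _] _] := isolated_label aA el.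
  apply: lt_le_trans h1; apply: t_gt0.
  by have [] := label_chain aA el.
Qed.

Variables (amin amax : R[i] + (R[i] * (int * int) + R[i] * nat * nat) -> R[i]).
Hypothesis aminP : forall l, l \in labels -> [/\ amin l \in A, label (amin l) = l &
  forall b, b \in A -> label b = l -> cabs (amin l - centre l) <= cabs (b - centre l)].
Hypothesis amaxP : forall l, l \in labels -> [/\ amax l \in A, label (amax l) = l &
  forall b, b \in A -> label b = l -> cabs (b - centre l) <= cabs (amax l - centre l)].

Definition reached (y : R[i]) (l : R[i] + (R[i] * (int * int) + R[i] * nat * nat)) :=
  (cabs (amin l - centre l) <= K * cabs (y - centre l)) &&
  (cabs (y - centre l) <= K * cabs (amax l - centre l)).

Lemma reached_single y : (count (fun l => reached y l && is_single l) labels <= 1)%N.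
Proof.
rewrite -size_filter; apply: (@uniq_size_image _ _ _ [:: tt] (fun=> tt)) => //.
  by rewrite filter_uniq // undup_uniq.
have key l z : l = inl z -> l \in labels -> reached y l -> z \in Z /\ cabs (y - z) <= 2 * K * eta.
  move=> -> hl /andP[_]; have [xA lx _] := amaxP hl; have [ex zZ] := label_single lx.
  have e1 : cabs (z - (z + (eta%:C)%C)) = eta.
    by rewrite opprD addrA subrr add0r cabsN cabs_real gtr0_norm.
  rewrite ex /= e1 => hy; split => //.
  have := cabs_tri (z + (eta%:C)%C) y z; rewrite [cabs (_ + _ - z)]cabsC e1.
  have : eta <= K * eta by rewrite ler_peMl // ltW.
  lra.
move=> l l'; rewrite !mem_filter => /andP[/andP[h1 s1] hl] /andP[/andP[h2 s2] hl'] _.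
case: l s1 h1 hl => // z _ h1 hl; case: l' s2 h2 hl' => // z' _ h2 hl'.
have [zZ hz] := key _ z erefl hl h1; have [zZ' hz'] := key _ z' erefl hl' h2.
congr inl; apply/eqP/negPn/negP => ne; have := eta_sep zZ zZ' ne.
have := cabs_tri y z z'; rewrite [cabs (z - y)]cabsC.
have Ke : 0 < K * eta by rewrite mulr_gt0 //; have := K1; lra.
lra.
Qed.

Definition kpick := Num.bound (12 * L * L).
Definition kdisc := Num.bound (5 * K).

(** A square reaching [y] has a point within a fraction of [t y] of [y], so the [v] it is attached
    to has height at least [t y / (2 * L)] and is near [y]. Such [v] are boundedly many by packing,
    and each has boundedly many squares around [y]. *)
Lemma reached_disc y : (count (fun l => reached y l && is_disc l) labels <=
  (2 * kpick.+1 + 1) ^ 2 * (2 * kdisc + 1) ^ 2)%N.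
Proof.
have hK := K1; have hL := L_ge.
have key v i j : inr (inl (v, (i, j))) \in labels -> reached y (inr (inl (v, (i, j)))) ->
   [/\ v \in Z /\ 0 < h v / L', 0 < t y, t y / (2 * L) <= h v, cabs (v - y) <= 3 * L * t y &
       cabs (y - centre (inr (inl (v, (i, j))))) <= 5 * K * (h v / L')].
  move=> hl /andP[_ hy].
  have [aA la _] := amaxP hl; set a := amax _ in aA la hy.
  have [aZ na ev eg] := label_disc la.
  have [e0 [_ e1]] := height_scale na aZ; rewrite -ev in e0 e1.
  have [vZ h1 h2 h3] := high_pickP na; rewrite -ev in vZ h1 h2 h3.
  have [_ hd] := disc_dist e0 eg; rewrite -/(centre (inr (inl (v, (i, j))))) in hd.
  set c := centre _ in hd hy *.
  have hy2 : cabs (y - c) <= 5 * K * (h v / L').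
    by apply: le_trans hy _; rewrite [5 * K]mulrC -mulrA ler_wpM2l //; lra.
  have ay : cabs (a - y) <= t a / 4.
    have := cabs_tri c a y; rewrite [cabs (c - y)]cabsC.
    have : 5 * (h v / L') <= 5 * K * (h v / L').
      by rewrite -mulrA ler_wpM2l // ler_peMl // ltW.
    lra.
  have ta0 := t_gt0 aZ.
  have l1 := t_lip a y; have l2 := t_lip y a; rewrite [cabs (y - a)]cabsC in l2.
  split => //.
  - by lra.
  - apply: le_trans h1.
    rewrite ler_pdivrMr; last by lra.
    have -> : t a / L * (2 * L) = 2 * t a by field; rewrite gt_eqF //; lra.
    by lra.
  - have := cabs_tri a v y; rewrite [cabs (v - a)]cabsC.
    have : L * t a <= L * (4 / 3 * t y) by rewrite ler_wpM2l //; lra.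
    have : 64 * t y <= L * t y by rewrite ler_wpM2r //; lra.
    by lra.
pose Zy := [seq v <- Z | (t y / (2 * L) <= h v) && (cabs (v - y) <= 3 * L * t y)].
rewrite -size_filter.
have [y0|y0] := lerP (t y) 0.
  rewrite (_ : [seq l <- _ | _] = [::]) //; apply/eqP; rewrite -size_eq0 size_filter eqn0Ngt -has_count.
  apply/hasPn => l hl; apply/negP => /andP[hr].
  by case: l hl hr => [z|[[v [i j]]|x]] // hl hr _; have [_] := key _ _ _ hl hr; lra.
have sZy : (size Zy <= (2 * kpick.+1 + 1) ^ 2)%N.
  have hp : 0 < t y / (2 * L) by rewrite divr_gt0 //; lra.
  apply: (@packing _ _ y (t y / (2 * L))) => //.
  - exact: filter_uniq.
  - move=> u w; rewrite !mem_filter => /andP[/andP[h1 _] hu] /andP[/andP[h2 _] hw] uw.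
    by have [_ hsep _] := netP; case: (hsep u w hu hw uw); apply: le_trans.
  - move=> u; rewrite mem_filter => /andP[/andP[_ h2] _]; apply: le_trans h2 _.
    apply: (@le_trans _ _ (12 * L * L * (t y / (2 * L) / 2))); last first.
      apply: ler_wpM2r; first by rewrite divr_ge0 // ltW.
      apply/ltW/archi_boundP; have L0 : 0 <= L by lra.
      exact: mulr_ge0 (mulr_ge0 _ L0) L0.
    have -> : 12 * L * L * (t y / (2 * L) / 2) = 3 * L * t y by field; rewrite gt_eqF //; lra.
    exact: lexx.
apply: leq_trans (_ : size Zy * (2 * kdisc + 1) ^ 2 <= _)%N; last by rewrite leq_mul2r sZy orbT.
apply: (@size_fibers_le _ _ _ _ (fun l => if l is inr (inl x) then x.1 else (0 : R[i]))).
  case=> [z|[[v [i j]]|x]]; rewrite mem_filter; [by rewrite andbF| |by rewrite andbF].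
  case/andP=> /andP[hr _] hl; have [[vZ _] _ h1 h2 _] := key _ _ _ hl hr.
  by rewrite /= mem_filter h1 h2 vZ.
move=> v _; rewrite -size_filter; pose e := h v / L'.
set X := complex.Re (y - v) / e + 3; set Y := complex.Im (y - v) / e.
rewrite -(size_grid_window kdisc X Y); set win := grid_window _ _ _.
apply: (@uniq_size_image _ _ _ _ (fun l => if l is inr (inl x) then x.2 else (0 : int, 0 : int))).
- by rewrite !filter_uniq // undup_uniq.
- case=> [z|[[w g]|x]] [z'|[[w' g']|x']]; rewrite !mem_filter ?andbF //=.
  by case/and3P => /eqP -> _ _ /and3P[/eqP -> _ _] ->.
case=> [z|[[w [i j]]|x]]; rewrite mem_filter; [|rewrite mem_filter|]; last first.
- by rewrite mem_filter !andbF.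
- case/and3P => /eqP /= ew /andP[hr _] hl; subst w.
  have [[vZ e0] _ _ _ h1] := key _ _ _ hl hr; rewrite -/e in e0 h1.
  set c := y - _ in h1.
  have eR : complex.Re c = e * (X - i%:~R).
    by rewrite /c /X !(raddfB, raddfD) /= -/e; field; rewrite gt_eqF.
  have eI : complex.Im c = e * (Y - j%:~R).
    by rewrite /c /Y !(raddfB, raddfD) /= -/e; field; rewrite gt_eqF.
  have k5 : 5 * K <= kdisc%:R by apply/ltW/archi_boundP; rewrite mulr_ge0 //; lra.
  have fin (x : R) : `|e * x| <= cabs c -> `|x| <= kdisc%:R.
    move=> hx; apply: le_trans k5; rewrite -(ler_pM2l e0) -{1}(gtr0_norm e0) -normrM mulrC.
    by rewrite [e * x]mulrC in hx; rewrite [X in _ <= X]mulrC; exact: le_trans hx h1.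
  apply/allpairsP; exists (i, j); split => //; apply: mem_int_window => /=.
    by rewrite distrC; apply: fin; rewrite -eR; exact: cabs_Re.
  by rewrite distrC; apply: fin; rewrite -eI; exact: cabs_Im.
- by rewrite mem_filter !andbF.
Qed.

Definition kchain := Num.bound (8 * K * K).

(** Blocks strictly between two reached ones are full and lie in the annulus of radii [s / K] and
    [K * s] around [u]. Boundedly many squares of mesh [s / (8 * K)] cover this annulus, and each
    holds at most [m] points of the group by [close_count]. The two extreme blocks are the summand
    2. *)
Lemma reached_chain_group y u i (qs : seq nat) : uniq qs ->
  (forall q, q \in qs -> inr (inr (u, i, q)) \in labels /\ reached y (inr (inr (u, i, q)))) ->
  (size qs <= (2 * kchain.+1 + 1) ^ 2 + 2)%N.
Proof.
move=> uqs hqs; apply: leq_trans (middle_size uqs) _; rewrite leq_add2r.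
set qm := [seq q <- qs | _].
pose s := cabs (y - u); have K0 : 0 < K by have := K1; lra.
pose F := [seq a <- chain_group u i | (s <= K * cabs (a - u)) && (cabs (a - u) <= K * s)].
have [mono hle hfull] := blkP (u, i); rewrite /= in mono hle hfull.
have inG q a : a \in A -> label a = inr (inr (u, i, q)) -> a \in chain_group u i /\ blk (u, i) a = q.
  by move=> aA /(label_chain aA) [].
have hqm : (size qm * m <= size F)%N.
  rewrite -[X in (_ <= X)%N]mul1n.
  apply: (@size_mul_le_disjoint _ _ qm F (fun q a => blk (u, i) a == q)).
    by move=> a _; apply: count_fiber_uniq; exact: filter_uniq.
  move=> q; rewrite mem_filter => /andP[/andP[/hasP [p pq hp] /hasP [p' pq' hp']] qqs].
  have [l1 /andP[r1 r2]] := hqs p pq; have [l2 /andP[r3 r4]] := hqs p' pq'.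
  have [xA lx _] := amaxP l1; have [xG bx] := inG _ _ xA lx.
  have [xA' lx' _] := aminP l2; have [xG' bx'] := inG _ _ xA' lx'.
  have := hfull (amin (inr (inr (u, i, p')))) q xG'; rewrite bx' => /(_ hp') hm.
  apply: leq_trans hm _; rewrite [X in (_ <= X)%N]count_filter; apply: sub_count_in => a aG ha.
  rewrite /= ha /=; move/eqP: ha => ha; apply/andP; split.
    have m1 : cabs (amax (inr (inr (u, i, p))) - u) <= cabs (a - u).
      by apply: mono => //; rewrite bx ha.
    by apply: le_trans r2 _; rewrite ler_wpM2l // ltW.
  apply: le_trans r3; apply: mono => //; by rewrite bx' ha.
rewrite -(leq_pmul2r m0); apply: leq_trans hqm _.
have [s0|s0] := lerP s 0.
  rewrite (_ : F = [::]) //; apply/eqP; rewrite -size_eq0 size_filter eqn0Ngt -has_count.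
  apply/hasPn => a aG; apply/negP => /andP[_ h1].
  have [aA la] := chain_group_label aG; have := centre_gt0 aA; rewrite la /=.
  have : K * s <= 0 by rewrite pmulr_rle0.
  lra.
have e0 : 0 < s / (8 * K) by rewrite divr_gt0 //; lra.
rewrite -(size_grid_window kchain.+1 (0 : R) 0).
apply: (@size_fibers_le _ _ _ _ (grid (s / (8 * K)) u)).
  move=> a; rewrite mem_filter => /andP[/andP[_ h2] _]; apply: grid_mem_window => //.
  apply: le_trans h2 _; apply: (@le_trans _ _ (8 * K * K * (s / (8 * K)))).
    have -> : 8 * K * K * (s / (8 * K)) = K * s by field; rewrite gt_eqF.
    exact: lexx.
  apply: ler_wpM2r; first exact: ltW.
  by apply/ltW/archi_boundP; rewrite !mulr_ge0 // ltW.
move=> g _; rewrite count_filter count_filter.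
apply: close_count => a b /andP[/andP[/= /eqP ga /andP[h1 h2]] ca] /andP[/andP[/= /eqP gb _] cb] aA bA.
have aG : a \in chain_group u i by rewrite mem_filter ca.
have [_ la] := chain_group_label aG.
have [[_ _ [t1 t2] _ _] _] := isolated_label aA la.
apply: lt_le_trans (grid_same e0 (etrans gb (esym ga))) _.
have : s / (8 * K) <= cabs (a - u) / 8.
  by rewrite ler_pdivrMr ?mulr_gt0 // (_ : _ * (8 * K) = K * cabs (a - u)) //; field.
lra.
Qed.

(** By [isolated_gap] the set [Z] avoids the annulus of the block even when widened by factors of
    order [L]. As [L = 64 * K], a reached [y] is well inside this gap and still sees [Z] nearby as
    the single point [u]. *)
Lemma reached_chain_data y u i q : inr (inr (u, i, q)) \in labels -> reached y (inr (inr (u, i, q))) ->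
  [/\ u \in Z, 0 < cabs (y - u), cabs (y - u) / 2 <= t y, t y <= cabs (y - u) & 32 * cabs (y - u) < h u].
Proof.
move=> hl /andP[r1 r2].
have [a1A l1 _] := aminP hl; have [a2A l2 hmax] := amaxP hl.
set a1 := amin _ in a1A l1 r1; set a2 := amax _ in a2A l2 r2 hmax.
have [iso1 k1] := isolated_label a1A l1; have [iso2 k2] := isolated_label a2A l2.
have [a1Z _ _ _ _] := label_chain a1A l1; have [a2Z _ _ _ _] := label_chain a2A l2.
have hL := L_ge; have hK := K1; have K0 : 0 < K by lra.
have gap := @isolated_gap _ Z H h L (t a1) (t a2) a1 a2 u netP (_ : 32 <= L) (t_gt0 a1Z) (t_gt0 a2Z)
  (tH a2A) iso1 iso2 (hmax a1 a1A l1) (etrans k1 (esym k2)).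
rewrite /= in r1 r2.
have p1 := centre_gt0 a1A; rewrite l1 /= in p1.
set s := cabs (y - u) in r1 r2 *.
have s0 : 0 < s by rewrite -(pmulr_rgt0 _ K0); lra.
have [hZ hu [_ u2] _ _] := iso2.
have [ny hy] := nearP y.
have e1 : cabs (a1 - u) / L <= s / 64.
  rewrite ler_pdivrMr; last by lra.
  by rewrite /L (_ : s / 64 * (64 * K) = K * s) //; field.
have e2 : 4 * s <= L * cabs (a2 - u) / 16.
  have -> : L * cabs (a2 - u) / 16 = 4 * (K * cabs (a2 - u)) by rewrite /L; field.
  by rewrite ler_pM2l.
split => //.
- have := cabs_tri (near y) y u; rewrite -/(t y) -/s.
  have := cabs_tri y (near y) u; rewrite -/s [cabs (near y - y)]cabsC -/(t y).
  by case: (gap (ltac:(lra)) _ ny) => h1; lra.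
- exact: hy.
- have : L * cabs (a2 - u) <= L * (2 * t a2) by rewrite ler_wpM2l //; lra.
  have : 64 * s <= L * cabs (a2 - u).
    have -> : L * cabs (a2 - u) = 64 * (K * cabs (a2 - u)) by rewrite /L; ring.
    by rewrite ler_pM2l.
  lra.
Qed.

(** Two points of [Z] whose heights exceed 32 times their distances to [y] coincide. A larger rank
    stretches the distances to [u] by a factor [L ^ 2 / 8 = 512 * K ^ 2], whereas a common reached
    [y] allows only [K ^ 2]. *)
Lemma reached_chain_same y u i q u' i' q' :
  inr (inr (u, i, q)) \in labels -> reached y (inr (inr (u, i, q))) ->
  inr (inr (u', i', q')) \in labels -> reached y (inr (inr (u', i', q'))) ->
  u = u' /\ (i' <= i)%N.
Proof.
move=> hl hr hl' hr'.
have [hZ s0 d1 d2 d3] := reached_chain_data hl hr.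
have [hZ' s0' d1' d2' d3'] := reached_chain_data hl' hr'.
have eu : u = u'.
  apply/eqP/negPn/negP => ne; have [_ hsep _] := netP.
  have := cabs_tri y u u'; rewrite [cabs (u - y)]cabsC.
  by case: (hsep u u' hZ hZ' ne); lra.
split => //; subst u'; rewrite leqNgt; apply/negP => ii.
have [a1A l1 _] := aminP hl'; have [a2A l2 _] := amaxP hl.
case/andP: hr => _ r2; case/andP: hr' => r1 _; rewrite /= in r1 r2.
set a1 := amin _ in a1A l1 r1; set a2 := amax _ in a2A l2 r2.
have [iso1 k1] := isolated_label a1A l1; have [iso2 k2] := isolated_label a2A l2.
have [a1Z _ _ _ _] := label_chain a1A l1; have [a2Z _ _ _ _] := label_chain a2A l2.
have hL := L_ge; have hK := K1; have K0 : 0 < K by lra.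
have L32 : 32 <= L by lra.
have := isolated_rank_gap netP L32 (t_gt0 a2Z) (t_gt0 a1Z) iso2 iso1.
rewrite k1 k2 => /(_ ii).
have p2 := centre_gt0 a2A; rewrite l2 /= in p2.
have : K * cabs (y - u) <= K * (K * cabs (a2 - u)) by rewrite ler_pM2l.
have -> : L * (L * cabs (a2 - u)) = 4096 * (K * (K * cabs (a2 - u))) by rewrite /L; ring.
have : 0 < K * (K * cabs (a2 - u)) by rewrite !mulr_gt0.
lra.
Qed.

Lemma reached_chain y : (count (fun l => reached y l && is_chain l) labels <=
  (2 * kchain.+1 + 1) ^ 2 + 2)%N.
Proof.
rewrite -size_filter; set s := [seq l <- _ | _].
have us : uniq s by rewrite filter_uniq // undup_uniq.
have hs l : l \in s -> [/\ is_chain l, l \in labels & reached y l].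
  by rewrite mem_filter => /andP[/andP[-> ->] ->].
have [->//|s0] := eqVneq s [::].
have [l0 l0s] : exists l0, l0 \in s by case: (s) s0 => // x s' _; exists x; exact: mem_head.
case: l0 l0s => [z|[x|[[u i] q0]]] l0s; [by have [] := hs _ l0s|by have [] := hs _ l0s|].
have [_ l0l l0r] := hs _ l0s.
have hsame l : l \in s -> exists q, l = inr (inr (u, i, q)).
  move=> ls; have [c ll lr] := hs _ ls; case: l ls c ll lr => // -[//|[[u' i'] q]] ls _ ll lr.
  exists q; have [e1 e2] := reached_chain_same ll lr l0l l0r.
  have [_ e3] := reached_chain_same l0l l0r ll lr.
  by rewrite e1 (_ : i' = i) //; apply/eqP; rewrite eqn_leq e3 e2.
pose f (l : R[i] + (R[i] * (int * int) + R[i] * nat * nat)) := if l is inr (inr x) then x.2 else 0%N.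
rewrite -(size_map f); apply: (@reached_chain_group y u i).
  rewrite map_inj_in_uniq // => l l' ls ls'.
  by have [q ->] := hsame l ls; have [q' ->] := hsame l' ls' => /= ->.
move=> q /mapP [l ls ->]; have [_ h1 h2] := hs _ ls; have [q' e] := hsame l ls.
by rewrite e /= -e.
Qed.

Lemma reached_labels y : (count (reached y) labels <=
  1 + ((2 * kpick.+1 + 1) ^ 2 * (2 * kdisc + 1) ^ 2 + ((2 * kchain.+1 + 1) ^ 2 + 2)))%N.
Proof.
rewrite count_labels; apply: leq_add (reached_single y) _.
exact: leq_add (reached_disc y) (reached_chain y).
Qed.

End Cells.

(** The last property is the purpose of the construction: a zero found on a test line is charged to
    boundedly many cells, although the annuli are dilated by [K]. *)
Lemma cells_exist (R : realType) (K : R) : 1 <= K ->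
  exists M : nat, forall (A : seq R[i]) (m r : nat), uniq A -> (0 < m)%N -> (size A <= m * r)%N ->
  exists (T : eqType) (lab : R[i] -> T) (ctr : T -> R[i]) (r0 r1 : T -> R),
  [/\ (size (undup [seq lab a | a <- A]) <= M * r)%N,
     forall a, a \in A -> [/\ 0 < r0 (lab a), r0 (lab a) <= cabs (a - ctr (lab a)) &
       cabs (a - ctr (lab a)) <= r1 (lab a)],
     forall l, (count (fun a => lab a == l) A <= m)%N &
     forall y, (count (fun l => (r0 l <= K * cabs (y - ctr l))%R && (cabs (y - ctr l) <= K * r1 l)%R)
       (undup [seq lab a | a <- A]) <= M)%N].
Proof.
move=> K1; pose M1 := (228 + (2 * (kmesh K).+1 + 1) ^ 2)%N.
pose M2 := (1 + ((2 * (kpick K).+1 + 1) ^ 2 * (2 * (kdisc K) + 1) ^ 2 + ((2 * (kchain K).+1 + 1) ^ 2 + 2)))%N.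
exists (M1 + M2)%N => A m r uA m0 Amr.
have [->|A0] := eqVneq A [::].
  by exists (unit : eqType), (fun=> tt), (fun=> 0), (fun=> 1), (fun=> 1); split.
have [Z0 [Z0A Z0m Z0d]] := greedy_centres A m0.
have r0 : (0 < r)%N.
  rewrite lt0n; apply: contraNneq A0 => r00.
  by rewrite -size_eq0 -leqn0 (leq_trans Amr) // r00 muln0.
have [Z [uZ Zn Zr dens]] : exists Z : seq R[i], [/\ uniq Z, Z != [::], (size Z <= r)%N &
    forall a s, a \in A -> (m <= count (fun b => (cabs (b - a) < s)%R) A)%N ->
    exists2 z, z \in Z & cabs (a - z) < 2 * s].
  (* Without a selected centre no disc around a point of [A] contains [m] points, so an arbitrary
     point can serve as [Z]. *)
  have [e|Z0n] := eqVneq Z0 [::].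
    exists [:: 0]; split => // a s aA ha; have [z] := Z0d a s aA ha.
    by rewrite e.
  exists (undup Z0); split.
  - exact: undup_uniq.
  - by case: (Z0) Z0n => // x s _; apply/eqP => e; have := mem_head x s; rewrite -mem_undup e.
  - apply: leq_trans (size_undup _) _; rewrite -(leq_pmul2r m0) [(r * m)%N]mulnC.
    exact: leq_trans Z0m Amr.
  - by move=> a s aA ha; have [z zZ hz] := Z0d a s aA ha; exists z; rewrite ?mem_undup.
have [nr nearP] : {nr : R[i] -> R[i] & forall y, nr y \in Z /\
    forall z, z \in Z -> cabs (y - nr y) <= cabs (y - z)}.
  apply: (@choice _ _ (fun y v : R[i] => v \in Z /\
    forall z, z \in Z -> cabs (y - v) <= cabs (y - z))) => y.
  have [v vZ hv] := seq_argmin (fun z => cabs (y - z)) Zn.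
  by exists v.
have [am _ ham] := seq_argmax (fun a => cabs (a - nr a)) A0.
pose H := 1 + cabs (am - nr am).
have H0 : 0 < H by rewrite /H; have := cabs_ge0 (am - nr am); lra.
have tH a : a \in A -> cabs (a - nr a) <= H by move/ham; rewrite /H; lra.
have [h netP] := net_height_exists Zn H0.
have [hpos hsep _] := netP.
pose L := 64 * K.
have [up upP] : {up : R[i] -> R[i] & forall a, a \in A -> a \notin Z ->
    ~~ near_high K Z nr h a -> isolated_at Z h L (cabs (a - nr a)) a (up a)}.
  apply: (@choice _ _ (fun a u : R[i] => a \in A -> a \notin Z ->
    ~~ near_high K Z nr h a -> isolated_at Z h L (cabs (a - nr a)) a u)) => a.
  case: (boolP [&& a \in A, a \notin Z & ~~ near_high K Z nr h a]) => [/and3P[aA aZ na]|hn]; last first.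
    by exists 0 => h1 h2 h3; rewrite h1 h2 h3 in hn.
  have [nZ hn] := nearP a.
  have t0 : 0 < cabs (a - nr a).
    by rewrite cabs_gt0 subr_eq0; apply: contra aZ => /eqP ->.
  have L32 : 32 <= L by rewrite /L; lra.
  have hiso : isolated Z h L (cabs (a - nr a)) a.
    move=> v vZ hv; move: na; rewrite /near_high -all_predC => /allP /(_ v vZ) /=.
    by rewrite -/L hv andbT negb_and -!ltNge => /orP[]; [left|right].
  have [u hu] := isolated_centre netP L32 t0 (tH a aA) nZ erefl hn hiso.
  by exists u.
have [blk blkP] : {blk : R[i] * nat -> R[i] -> nat & forall g, [/\
  forall a b, a \in chain_group K A Z nr h up g.1 g.2 -> b \in chain_group K A Z nr h up g.1 g.2 ->
    (blk g a < blk g b)%N -> cabs (a - g.1) <= cabs (b - g.1),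
  forall q, (count (fun a => blk g a == q) (chain_group K A Z nr h up g.1 g.2) <= m)%N &
  forall a q, a \in chain_group K A Z nr h up g.1 g.2 -> (q < blk g a)%N ->
    (m <= count (fun a => blk g a == q) (chain_group K A Z nr h up g.1 g.2))%N]}.
  apply: (@choice _ _ (fun (g : R[i] * nat) (blk : R[i] -> nat) => [/\
  forall a b, a \in chain_group K A Z nr h up g.1 g.2 -> b \in chain_group K A Z nr h up g.1 g.2 ->
    (blk a < blk b)%N -> cabs (a - g.1) <= cabs (b - g.1),
  forall q, (count (fun a => blk a == q) (chain_group K A Z nr h up g.1 g.2) <= m)%N &
  forall a q, a \in chain_group K A Z nr h up g.1 g.2 -> (q < blk a)%N ->
    (m <= count (fun a => blk a == q) (chain_group K A Z nr h up g.1 g.2))%N])) => g.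
  by apply: block_partition => //; exact: filter_uniq.
have [zm zmZ hzm] := seq_argmin h Zn.
(* Since [zm] has the least height, distinct points of [Z] are at least [8 * K * eta] apart, and the
   dilated cells of single points stay disjoint. *)
pose eta := h zm / (8 * K).
have eta0 : 0 < eta by rewrite divr_gt0 ?hpos //; lra.
have eta_sep u v : u \in Z -> v \in Z -> u != v -> 8 * K * eta <= cabs (u - v).
  have -> : 8 * K * eta = h zm by rewrite /eta; field; lra.
  by move=> uZ' vZ /(hsep u v uZ' vZ) []; apply: le_trans; exact: hzm.
pose lab := label K Z nr h up blk; pose ctr := centre K h eta.
pose labs := labels K A Z nr h up blk.
have mem_lab l : l \in labs -> [seq a <- A | lab a == l] != [::].
  move/labelsP => [a aA la]; rewrite -has_filter; apply/hasP; exists a => //.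
  exact/eqP.
have [amin aminP] : {amin : R[i] + (R[i] * (int * int) + R[i] * nat * nat) -> R[i] &
    forall l, l \in labs -> [/\ amin l \in A, lab (amin l) = l &
    forall b, b \in A -> lab b = l -> cabs (amin l - ctr l) <= cabs (b - ctr l)]}.
  apply: (@choice _ _ (fun l (x : R[i]) => l \in labs -> [/\ x \in A, lab x = l &
    forall b, b \in A -> lab b = l -> cabs (x - ctr l) <= cabs (b - ctr l)])) => l.
  case: (boolP (l \in labs)) => hl; last by exists 0.
  have [x] := seq_argmin (fun b => cabs (b - ctr l)) (mem_lab l hl).
  rewrite mem_filter => /andP[/eqP lx xA] hx; exists x => _; split => // b bA lb.
  by apply: hx; rewrite mem_filter lb eqxx.
have [amax amaxP] : {amax : R[i] + (R[i] * (int * int) + R[i] * nat * nat) -> R[i] &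
    forall l, l \in labs -> [/\ amax l \in A, lab (amax l) = l &
    forall b, b \in A -> lab b = l -> cabs (b - ctr l) <= cabs (amax l - ctr l)]}.
  apply: (@choice _ _ (fun l (x : R[i]) => l \in labs -> [/\ x \in A, lab x = l &
    forall b, b \in A -> lab b = l -> cabs (b - ctr l) <= cabs (x - ctr l)])) => l.
  case: (boolP (l \in labs)) => hl; last by exists 0.
  have [x] := seq_argmax (fun b => cabs (b - ctr l)) (mem_lab l hl).
  rewrite mem_filter => /andP[/eqP lx xA] hx; exists x => _; split => // b bA lb.
  by apply: hx; rewrite mem_filter lb eqxx.
have labA a : a \in A -> lab a \in labs by move=> aA; apply/labelsP; exists a.
exists (R[i] + (R[i] * (int * int) + R[i] * nat * nat))%type, lab, ctr,
  (fun l => cabs (amin l - ctr l)), (fun l => cabs (amax l - ctr l)); split.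
- apply: (@leq_trans (M1 * r)); last by rewrite leq_mul2r leq_addr orbT.
  exact: (num_labels K1 uA m0 uZ nearP netP upP blkP Amr Zr).
- move=> a aA; have [xA lx hx] := aminP _ (labA a aA); have [yA ly hy] := amaxP _ (labA a aA).
  split; [|exact: hx|exact: hy].
  rewrite -{2}lx; by apply: (centre_gt0 blk K1 nearP netP upP eta0).
- by move=> l; exact: (label_class_size K1 uA m0 dens nearP netP blkP l).
- move=> y; apply: leq_trans (leq_addl _ _).
  exact: (reached_labels K1 uA m0 uZ dens nearP netP tH upP blkP eta0 eta_sep aminP amaxP y).
Qed.

(** * Incidences *)

Lemma bipoly_roots (R : rcfType) (D : nat) (c : nat -> nat -> R[i]) (x : R[i]) :
  exists rs : seq R[i], (size rs <= D)%N /\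
  ((exists y, bipoly D c x y != 0) -> forall y, bipoly D c x y = 0 -> y \in rs).
Proof.
set p := \poly_(j < D) (\poly_(i < D) c i j).[x].
have [p0|p0] := eqVneq p 0.
  by exists [::]; split => // -[y]; rewrite bipoly_row -/p p0 horner0 eqxx.
have [rs ep] := complex_poly_split p; exists rs; split.
  have : (size p <= D)%N by exact: size_poly.
  rewrite ep size_scale ?lead_coef_eq0 // size_prod_XsubC; exact: ltnW.
move=> _ y; rewrite bipoly_row -/p ep hornerZ => /eqP.
rewrite mulf_eq0 lead_coef_eq0 (negPf p0) /= => h.
by rewrite -root_prod_XsubC.
Qed.

Lemma size_flatten_le (T U : eqType) (s : seq T) (f : T -> seq U) (b : nat) :
  (forall x, x \in s -> (size (f x) <= b)%N) ->
  (size (flatten [seq f x | x <- s]) <= size s * b)%N.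
Proof.
elim: s => //= x s IH h; rewrite size_cat mulSn leq_add ?h ?mem_head //.
by apply: IH => y ys; apply: h; rewrite inE ys orbT.
Qed.

Lemma size_ray_points (R : rcfType) (N : nat) (t : R) : size (ray_points N t) = N.
Proof. by rewrite size_map size_iota. Qed.

(** A cell has [2 * (D * D).+1] test abscissas, each carries at most [D] zeros unless the curve
    contains the whole line, and each zero is near at most [M] cells. *)
Lemma charged_cells (R : rcfType) (D : nat) (c : nat -> nat -> R[i]) (T : eqType)
    (ctr : T -> R[i]) (r0 r1 : T -> R) (labs : seq T) (K : R) (M : nat) :
  (forall y, (count (fun l => (r0 l <= K * cabs (y - ctr l))%R && (cabs (y - ctr l) <= K * r1 l)%R)
    labs <= M)%N) ->
  exists H : seq (T * T), (size H <= size labs * ((D * D).+1 * 2 * D * M))%N /\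
  forall X Y x' y', X \in labs -> Y \in labs ->
    x' - ctr X \in ray_points (D * D).+1 (r0 X) ++ ray_points (D * D).+1 (r1 X) ->
    (exists y, bipoly D c x' y != 0) -> bipoly D c x' y' = 0 ->
    r0 Y <= K * cabs (y' - ctr Y) -> cabs (y' - ctr Y) <= K * r1 Y -> (X, Y) \in H.
Proof.
move=> hM; have [rt hrt] := @choice _ _ _ (bipoly_roots D c).
pose near y l := (r0 l <= K * cabs (y - ctr l)) && (cabs (y - ctr l) <= K * r1 l).
pose tests X := [seq t + ctr X | t <- ray_points (D * D).+1 (r0 X) ++ ray_points (D * D).+1 (r1 X)].
exists (flatten [seq flatten [seq flatten [seq [seq (X, Y) | Y <- labs & near y' Y]
  | y' <- rt x'] | x' <- tests X] | X <- labs]); split.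
  apply: size_flatten_le => X _; apply: leq_trans.
    apply: (@size_flatten_le _ _ _ _ (D * M)) => x' _; apply: leq_trans.
      apply: (@size_flatten_le _ _ _ _ M) => y' _.
      by rewrite size_map size_filter; exact: hM.
    by rewrite leq_mul2r (hrt x').1 orbT.
  by rewrite size_map size_cat !size_ray_points addnn -muln2 -!mulnA.
move=> X Y x' y' Xl Yl hx' ny e0 h0 h1.
apply/flatten_mapP; exists X => //; apply/flatten_mapP; exists x'.
  by apply/mapP; exists (x' - ctr X) => //; rewrite subrK.
apply/flatten_mapP; exists y'; first exact: (hrt x').2.
by apply/mapP; exists Y => //; rewrite mem_filter /near h0 h1.
Qed.

(** [charged_cells] is applied to the coefficients and to their transpose, for the vertical and the
    horizontal test lines of [dichotomy]. *)
Lemma hit_cells (R : rcfType) (D : nat) :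
  exists2 K : R, 1 <= K & forall (M : nat) (c : nat -> nat -> R[i]) (T : eqType)
    (ctr : T -> R[i]) (r0 r1 : T -> R) (lab : R[i] -> T) (A : seq R[i]),
  (exists x y, bipoly D c x y != 0) ->
  (forall a, a \in A -> [/\ 0 < r0 (lab a), r0 (lab a) <= cabs (a - ctr (lab a)) &
       cabs (a - ctr (lab a)) <= r1 (lab a)]) ->
  (forall y, (count (fun l => (r0 l <= K * cabs (y - ctr l))%R && (cabs (y - ctr l) <= K * r1 l)%R)
    (undup [seq lab a | a <- A]) <= M)%N) ->
  exists H : seq (T * T),
    (size H <= size (undup [seq lab a | a <- A]) * (2 * ((D * D).+1 * 2 * D * M)))%N /\
    forall x y, x \in A -> y \in A -> bipoly D c x y = 0 -> (lab x, lab y) \in H.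
Proof.
have [K K1 hK] := dichotomy R D; exists K => // M c T ctr r0 r1 lab A cn hr hM.
set labs := undup _.
have [H1 [s1 h1]] := charged_cells D c hM.
have [H2 [s2 h2]] := charged_cells D (fun i j => c j i) hM.
exists (H1 ++ [seq (p.2, p.1) | p <- H2]); split.
  by rewrite size_cat size_map mul2n -addnn mulnDr leq_add.
move=> x y xA yA e; rewrite mem_cat.
have lA a : a \in A -> lab a \in labs by move=> aA; rewrite mem_undup map_f.
have [x0 x1 x2] := hr x xA; have [y0 y1 y2] := hr y yA.
have [[x' [y' [tx ny ez u1 u2]]]|[x' [y' [ty nx ez u1 u2]]]] :=
  hK c _ _ _ _ _ _ x y cn x0 (le_trans x1 x2) y0 (le_trans y1 y2) x1 x2 y1 y2 e.
  by rewrite (h1 _ _ x' y') //; exact: lA.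
apply/orP; right; apply/mapP; exists (lab y, lab x) => //=.
apply: (h2 _ _ y' x') => //; try exact: lA.
  by have [z hz] := nx; exists z; rewrite -bipoly_swap.
by rewrite -bipoly_swap.
Qed.

(* Inside one cell, a set of more than [MB] elements contains for each of its elements a partner
   outside the bad list of that element. *)
Lemma cell_count (T L : eqType) (lab : T -> L) (U V : seq T) (inc : T -> T -> bool)
    (h MB M2 w : nat) :
  (forall v, v \in V -> exists H : seq L, (size H <= h)%N /\
     forall u, u \in U -> inc v u -> lab u \in H) ->
  (forall u, u \in U -> exists bl : seq T, (size bl <= MB)%N /\
     forall u', u' \in U -> u' \notin bl -> (count (fun v => inc v u && inc v u') V <= M2)%N) ->
  (forall l, (count (fun u => lab u == l) U <= w)%N) -> uniq U ->
  (\sum_(v <- V) count (inc v) U <= size V * (h * MB) + size U * (w * M2))%N.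
Proof.
move=> hH hB hw uU.
have [bl blP] : {bl : T -> seq T & forall u, u \in U -> (size (bl u) <= MB)%N /\
     forall u', u' \in U -> u' \notin bl u -> (count (fun v => inc v u && inc v u') V <= M2)%N}.
  apply: (@choice _ _ (fun u (b : seq T) => u \in U -> (size b <= MB)%N /\
     forall u', u' \in U -> u' \notin b -> (count (fun v => inc v u && inc v u') V <= M2)%N)) => u.
  by case: (boolP (u \in U)) => uU'; [have [b hb] := hB u uU'; exists b|exists [::]].
pose F v l := [seq u <- U | inc v u & lab u == l].
(* An element incident to [v] either is in a cell with at most [MB] incidences of [v] or has a
   partner in the sense of [gp]. For fixed [u] and [u'] off the bad list, at most [M2] elements [v]
   occur. *)
pose gp v u u' := [&& inc v u, inc v u', lab u' == lab u & u' \notin bl u].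
have step v : v \in V ->
    (count (inc v) U <= h * MB + \sum_(u <- U) count (gp v u) U)%N.
  move=> vV; have [H [sH hH']] := hH v vV.
  pose small u := (size (F v (lab u)) <= MB)%N.
  have -> : (count (inc v) U = count (fun u => inc v u && small u) U
       + count (fun u => inc v u && ~~ small u) U)%N.
    rewrite -[RHS]count_predUI.
    rewrite [X in (_ + X)%N](eq_count (a2 := pred0)).
      by rewrite count_pred0 addn0; apply: eq_count => u /=; case: (inc v u); case: (small u).
    by move=> u /=; case: (inc v u); case: (small u).
  apply: leq_add.
    rewrite -size_filter; apply: leq_trans (_ : size H * MB <= _)%N; last by rewrite leq_mul2r sH orbT.
    apply: (@size_fibers_le _ _ _ _ lab).
      by move=> u; rewrite mem_filter => /andP[/andP[iu _] uU']; exact: hH'.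
    move=> l lH; rewrite count_filter.
    case: (leqP (size (F v l)) MB) => hl.
      apply: leq_trans hl; rewrite size_filter; apply: sub_count => u /= /andP[-> /andP[-> _]] //.
    rewrite (eq_count (a2 := pred0)) ?count_pred0 // => u /=.
    case: eqP => //= e; rewrite /small e [X in _ && X]leqNgt hl andbF //.
  rewrite -sum1_count big_mkcond /=; rewrite big_seq [leqRHS]big_seq.
  apply: leq_sum => u uU'; case: ifP => // /andP[iu nu].
  rewrite -has_count; apply: contraNT nu; rewrite -all_predC => /allP ha.
  have [sb _] := blP u uU'; rewrite /small; apply: leq_trans sb.
  apply: uniq_leq_size; first exact: filter_uniq.
  move=> u'; rewrite mem_filter => /andP[/andP[iu' lu'] u'U].
  by have := ha u' u'U; rewrite /gp /= iu iu' lu' /= negbK.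
apply: leq_trans (_ : \sum_(v <- V) (h * MB + \sum_(u <- U) count (gp v u) U) <= _)%N.
  by rewrite big_seq [leqRHS]big_seq; apply: leq_sum.
rewrite big_split /= sum_nat_const_seq leq_add2l exchange_big /= -sum_nat_const_seq.
rewrite big_seq [leqRHS]big_seq; apply: leq_sum => u uU'.
have [sb hb] := blP u uU'.
apply: leq_trans (_ : count (fun u' => lab u' == lab u) U * M2 <= _)%N; last first.
  by rewrite leq_mul2r hw orbT.
under eq_bigr => v _ do rewrite -sum1_count big_mkcond.
rewrite exchange_big /= -sum1_count big_distrl /= [leqRHS]big_mkcond /=.
rewrite big_seq [leqRHS]big_seq; apply: leq_sum => u' u'U.
rewrite -big_mkcond sum1_count mul1n /gp; case: ifP => e; last first.
  by rewrite (eq_count (a2 := pred0)) ?count_pred0 // => v /=; rewrite ?andbF.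
case: (boolP (u' \in bl u)) => hu'.
  by rewrite (eq_count (a2 := pred0)) ?count_pred0 // => v /=; rewrite ?andbF.
apply: leq_trans (hb u' u'U hu'); apply: sub_count => v /=.
by case: (inc v u) => //=; case: (inc v u').
Qed.

Lemma count_allpairs (T U : Type) (s : seq T) (t : seq U) (P : pred T) (Q : pred U) :
  count (fun u => P u.1 && Q u.2) [seq (x, y) | x <- s, y <- t] = (count P s * count Q t)%N.
Proof.
elim: s => //= x s IH; rewrite count_cat IH count_map mulnDl; congr addn.
rewrite /preim /=; case: (P x); first by rewrite mul1n.
by rewrite mul0n (eq_count (a2 := pred0)) ?count_pred0.
Qed.

(** The cells of the abscissas induce product cells of pairs with at most [(m * dd) ^ 2] elements,
    since at most [dd] points share an abscissa. Each curve hits [O(r)] of them by [hit_cells]. *)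
Lemma incidence_bound (R : realType) (D dd MB M2 : nat) :
  exists K' : nat, forall (P : seq (R[i] * R[i]))
    (inc : (R[i] * R[i]) * (R[i] * R[i]) -> (R[i] * R[i]) * (R[i] * R[i]) -> bool) (m r : nat),
  uniq P -> (0 < m)%N -> (size P <= m * r)%N ->
  (forall x, (count (fun p => p.1 == x) P <= dd)%N) ->
  (forall p q, p \in P -> q \in P -> exists c : nat -> nat -> R[i],
     (exists x y, bipoly D c x y != 0) /\
     forall s t, s \in P -> t \in P -> inc (p, q) (s, t) -> bipoly D c s.1 t.1 = 0) ->
  (forall u, u \in [seq (s, t) | s <- P, t <- P] ->
     exists bl : seq ((R[i] * R[i]) * (R[i] * R[i])), (size bl <= MB)%N /\
     forall u', u' \in [seq (s, t) | s <- P, t <- P] -> u' \notin bl ->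
     (count (fun v => inc v u && inc v u') [seq (s, t) | s <- P, t <- P] <= M2)%N) ->
  (\sum_(v <- [seq (s, t) | s <- P, t <- P]) count (inc v) [seq (s, t) | s <- P, t <- P]
    <= K' * (size P ^ 2 * (r + m ^ 2)))%N.
Proof.
have [K K1 hK] := hit_cells R D; have [M hM] := cells_exist K1.
pose k1 := (M * (2 * ((D * D).+1 * 2 * D * M)) * MB)%N.
exists (k1 + dd ^ 2 * M2)%N => P inc m r uP m0 Pmr hd hF hB.
pose A := undup [seq p.1 | p <- P].
have uA : uniq A by exact: undup_uniq.
have As : (size A <= m * r)%N by rewrite (leq_trans (size_undup _)) // size_map.
have [T [lab [ctr [r0 [r1 [nl hl hm hr]]]]]] := hM A m r uA m0 As.
have PA p : p \in P -> p.1 \in A by move=> pP; rewrite mem_undup map_f.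
pose lab2 (u : (R[i] * R[i]) * (R[i] * R[i])) := (lab u.1.1, lab u.2.1).
set U := [seq (s, t) | s <- P, t <- P].
have sU : size U = (size P ^ 2)%N by rewrite size_allpairs.
have uU : uniq U by apply: allpairs_uniq => // -[? ?] [? ?].
have cl l : (count (fun p => lab p.1 == l) P <= m * dd)%N.
  rewrite -size_filter; apply: leq_trans (_ : size [seq a <- A | lab a == l] * dd <= _)%N.
    apply: (@size_fibers_le _ _ _ _ (fun p => p.1)).
      by move=> p; rewrite !mem_filter => /andP[-> /PA].
    move=> x _; apply: leq_trans (hd x); rewrite count_filter; apply: sub_count => p /=.
    by case/andP.
  by rewrite size_filter leq_mul2r hm orbT.
have := @cell_count _ _ lab2 U U inc (M * r * (2 * ((D * D).+1 * 2 * D * M))) MB M2 ((m * dd) ^ 2).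
move=> /(_ _ hB _ uU) h; apply: leq_trans (h _ _) _.
- move=> [p q] /allpairsP [[p' q'] [pP qP /= [-> ->]]].
  have [c [cn hc]] := hF _ _ pP qP.
  have [H [sH hH]] := hK M c T ctr r0 r1 lab A cn hl hr.
  exists H; split; first by apply: leq_trans sH _; rewrite leq_mul2r nl orbT.
  move=> [s t] /allpairsP [[s' t'] [sP tP /= [-> ->]]] i; apply: hH; try exact: PA.
  exact: hc.
- move=> [l1 l2]; rewrite (eq_count (a2 := fun u : (R[i] * R[i]) * (R[i] * R[i]) =>
     (lab u.1.1 == l1) && (lab u.2.1 == l2))); last by move=> u; rewrite /lab2 xpair_eqE.
  rewrite (@count_allpairs _ _ P P (fun p => lab p.1 == l1) (fun p => lab p.1 == l2)).
  by rewrite expnS expn1 leq_mul.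
rewrite sU /k1; nia.
Qed.

(** * Plane curves with many common zeros *)

Lemma size_det_le (F : idomainType) (n b : nat) (A : 'M[{poly F}]_n) :
  (forall i j, (size (A i j) <= b.+1)%N) -> (size (\det A) <= (n * b).+1)%N.
Proof.
move=> h; apply: leq_trans (size_sum _ _ _) _; apply/bigmax_leqP => s _.
have : (size (\prod_i A i (s i))%R <= (n * b).+1)%N.
  have e : (\sum_i size (A i (s i)) <= n + n * b)%N.
    apply: leq_trans (_ : \sum_(i < n) b.+1 <= _)%N; first by apply: leq_sum.
    by rewrite sum_nat_const card_ord mulnS.
  apply: leq_trans (size_poly_prod_leq _ _) _; rewrite leq_subLR addnS ltnS.
  by apply: leq_trans e _; rewrite leq_add2r -[leqLHS]card_ord.
by case: (odd_perm s); rewrite ?expr0 ?mul1r // expr1 mulN1r size_polyN.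
Qed.

Lemma inner_root_scale (F : fieldType) (u : {poly {poly F}}) (a : F) :
  map_poly (horner_eval a) u = 0 -> exists u', u = ('X - a%:P) *: u'.
Proof.
move=> h; have rt i : root u`_i a.
  apply/eqP; have := congr1 (fun p : {poly F} => p`_i) h.
  by rewrite coef_map_id0 ?coef0 //= ?horner_evalE // ?horner0.
exists (\poly_(i < size u) (u`_i %/ ('X - a%:P))); apply/polyP => i.
rewrite coefZ coef_poly; case: ltnP => hi; last by rewrite nth_default ?mulr0.
by rewrite mulrC divpK // dvdp_XsubCl.
Qed.

(** Over a closed field this is primitivity in the inner variable: the coefficients have no common
    root, hence no common factor. *)
Definition inner_primitive (F : nzRingType) (u : {poly {poly F}}) :=
  forall a : F, map_poly (horner_eval a) u != 0.

Lemma exists_inner_primitive (F : fieldType) (u : {poly {poly F}}) : u != 0 ->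
  exists c u0, [/\ c != 0, u = c *: u0 & inner_primitive u0].
Proof.
move: {2}(size (lead_coef u)) (leqnn (size (lead_coef u))) => n.
elim: n u => [|n IH] u hn u0.
  by move: hn; rewrite leqn0 size_poly_eq0 lead_coef_eq0 (negPf u0).
case: (pselect (exists a, map_poly (horner_eval a) u = 0)) => [[a /inner_root_scale [u' eu]]|h]; last first.
  by exists 1, u; rewrite scale1r oner_eq0; split => // a; apply/eqP => ha; apply: h; exists a.
have u'0 : u' != 0 by apply: contraNneq u0 => u'0; rewrite eu u'0 scaler0.
have lc : lead_coef u = ('X - a%:P) * lead_coef u'.
  by rewrite eu -mul_polyC lead_coefM lead_coefC.
have [|c [u1 [c0 e hp]]] := IH u' _ u'0.
  by move: hn; rewrite lc mulrC size_Mmonic ?monicXsubC ?lead_coef_eq0 // size_XsubC addn2.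
exists (('X - a%:P) * c), u1; split => //; first by rewrite mulf_neq0 ?polyXsubC_eq0.
by rewrite eu e scalerA.
Qed.

(* Gauss: a linear factor of [c] divides [r * h], hence [r], since [h] is primitive. *)
Lemma inner_primitive_cancel (F : closedFieldType) (c : {poly F}) (p r h : {poly {poly F}}) :
  c != 0 -> inner_primitive h -> c *: p = r * h -> exists r', p = r' * h.
Proof.
move=> c0 hh; move: {2}(size c) (leqnn (size c)) => n.
elim: n c r c0 => [|n IH] c r c0 hn e.
  by move: hn; rewrite leqn0 size_poly_eq0 (negPf c0).
have [/closed_rootP [a ra]|] := boolP (size c != 1); last first.
  rewrite negbK => /size_poly1P [b b0 ec]; exists (b^-1%:P *: r).
  rewrite -scalerAl -e ec scalerA -polyCM mulVf // scale1r //.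
have /inner_root_scale [r' er] : map_poly (horner_eval a) r = 0.
  have := congr1 (map_poly (horner_eval a)) e.
  rewrite rmorphM /= -mul_polyC rmorphM /= map_polyC /= horner_evalE (eqP ra) polyC0 mul0r.
  by move=> /esym /eqP; rewrite mulf_eq0 (negPf (hh a)) orbF => /eqP.
have [c' ec] : exists c', c = c' * ('X - a%:P) by apply/factor_theorem.
have c'0 : c' != 0 by apply: contraNneq c0 => z; rewrite ec z mul0r.
apply: (IH c' r') => //.
  by move: hn; rewrite ec size_Mmonic ?monicXsubC // size_XsubC addn2.
apply: (@mulfI _ ('X - a%:P)%:P); first by rewrite polyC_eq0 polyXsubC_eq0.
by rewrite !mul_polyC scalerA mulrC -ec e er -scalerAl.
Qed.

(** The resultant in the outer variable decides. If it is zero, the greatest common divisor, made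
    primitive, divides both by Gauss. Otherwise it lies in the ideal of [p] and [q], so it vanishes
    at the ordinates of the common zeros, and its size is read off the Sylvester determinant. *)
Lemma poly2_common_factor (F : closedFieldType) (D : nat) (p q : {poly {poly F}}) :
  p != 0 -> q != 0 -> (size p <= D)%N -> (size q <= D)%N -> (sizeY p <= D)%N -> (sizeY q <= D)%N ->
  (exists h u v : {poly {poly F}}, [/\ (1 < size h)%N, p = u * h & q = v * h]) \/
  (exists rho : {poly F}, [/\ rho != 0, (size rho <= (2 * D * D).+1)%N &
    forall x y, p.[x, y] = 0 -> q.[x, y] = 0 -> rho.[y] = 0]).
Proof.
move=> p0 q0 sp sq yp yq.
have D0 : (0 < D)%N by apply: leq_trans sp; rewrite size_poly_gt0.
have cst (t : {poly {poly F}}) : t != 0 -> (size t <= 1)%N -> (sizeY t <= D)%N ->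
    exists rho : {poly F}, [/\ rho != 0, (size rho <= (2 * D * D).+1)%N &
    forall x y, t.[x, y] = 0 -> rho.[y] = 0].
  move=> t0 /size1_polyC et yt; exists t`_0; split.
  - by apply: contraNneq t0 => z; rewrite et z polyC0.
  - apply: leq_trans (max_size_coefXY t 0) _; apply: leq_trans yt _; nia.
  - by move=> x y; rewrite {1}et hornerC.
have [p1|p1] := leqP (size p) 1.
  by right; have [rho [r1 r2 r3]] := cst p p0 p1 yp; exists rho; split => // x y /r3.
have [q1|q1] := leqP (size q) 1.
  by right; have [rho [r1 r2 r3]] := cst q q0 q1 yq; exists rho; split => // x y _ /r3.
have [r0|r0] := eqVneq (resultant p q) 0.
  left; have hg : (1 < size (gcdp p q))%N by rewrite -resultant_eq0 r0.
  have g0 : gcdp p q != 0 by rewrite -size_poly_gt0; apply: leq_trans hg.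
  have [c [h [c0 eh hh]]] := exists_inner_primitive g0.
  have sh : size h = size (gcdp p q) by rewrite eh -mul_polyC size_Cmul.
  have cancel (t : {poly {poly F}}) : gcdp p q %| t -> exists r, t = r * h.
    move=> /Pdiv.Idomain.dvdpP [[a r] /= a0 e].
    apply: (@inner_primitive_cancel _ a _ (c *: r)) => //.
    by rewrite e eh -scalerAr -scalerAl.
  have [u eu] := cancel p (dvdp_gcdl p q); have [v ev] := cancel q (dvdp_gcdr p q).
  by exists h, u, v; rewrite sh.
right; exists (resultant p q); split => //.
  have szc (t : {poly {poly F}}) i : (sizeY t <= D)%N -> (size (t`_i)%R <= D.-1.+1)%N.
    by move=> yt; rewrite prednK //; apply: leq_trans (max_size_coefXY t i) yt.
  apply: leq_trans (@size_det_le _ _ D.-1 _ _) _.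
    move=> i j; rewrite Sylvester_mxE.
      by case: (fintype.split i) => k; case: (k <= j)%N; rewrite ?mulr1n ?mulr0n ?size_poly0 //; apply: szc.
  rewrite ltnS; apply: leq_mul; last exact: leq_pred.
  by rewrite mul2n -addnn leq_add // (leq_trans (leq_pred _)).
move=> x y ep eq; have [[u v] /= _ e] := resultant_in_ideal p1 q1.
have := congr1 (fun t : {poly {poly F}} => t.[x, y]) e.
by rewrite hornerC => ->; rewrite hornerD !hornerM !hornerD !hornerM ep eq !mulr0 addr0.
Qed.

(** Resultants in both variables confine the common zeros to a finite grid. The bound is cruder than
    the product of the degrees, but it depends on [D] only. *)
Lemma poly2_bezout (F : closedFieldType) (D : nat) (p q : {poly {poly F}}) :
  p != 0 -> q != 0 -> (size p <= D)%N -> (size q <= D)%N -> (sizeY p <= D)%N -> (sizeY q <= D)%N ->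
  (exists h u v : {poly {poly F}}, [/\ (1 < size h)%N || (1 < sizeY h)%N, p = u * h & q = v * h]) \/
  (forall s : seq (F * F), uniq s -> (forall z, z \in s -> p.[z.1, z.2] = 0 /\ q.[z.1, z.2] = 0) ->
    (size s <= (2 * D * D) ^ 2)%N).
Proof.
move=> p0 q0 sp sq yp yq.
have [[h [u [v [h1 e1 e2]]]]|[rho [r0 r1 r2]]] := poly2_common_factor p0 q0 sp sq yp yq.
  by left; exists h, u, v; rewrite h1.
have [||||||[h [u [v [h1 e1 e2]]]]|[rho' [t0 t1 t2]]] := @poly2_common_factor _ D (swapXY p) (swapXY q).
- by rewrite swapXY_eq0.
- by rewrite swapXY_eq0.
- by rewrite -sizeYE.
- by rewrite -sizeYE.
- by rewrite sizeYE swapXYK.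
- by rewrite sizeYE swapXYK.
- left; exists (swapXY h), (swapXY u), (swapXY v); rewrite [sizeY _]sizeYE swapXYK h1 orbT.
  by split => //; rewrite -[LHS]swapXYK ?e1 ?e2 rmorphM.
have rl (t : {poly F}) : t != 0 -> (size t <= (2 * D * D).+1)%N ->
    exists rs : seq F, (size rs <= 2 * D * D)%N /\ forall y, t.[y] = 0 -> y \in rs.
  move=> tn tb; have [rs e] := closed_field_poly_normal t; exists rs; split.
    by move: tb; rewrite e size_scale ?lead_coef_eq0 // size_prod_XsubC.
  move=> y; rewrite e hornerZ => /eqP; rewrite mulf_eq0 lead_coef_eq0 (negPf tn) /= => hy.
  by rewrite -root_prod_XsubC.
have [ys [sy hy]] := rl _ r0 r1; have [xs [sx hx]] := rl _ t0 t1.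
right=> s us hs; apply: (@leq_trans (size [seq (x, y) | x <- xs, y <- ys])).
  apply: uniq_leq_size => // -[x y] /hs /= [ex ey]; apply/allpairsP; exists (x, y); split => //=.
    by apply: hx; apply: (t2 y x); rewrite horner2_swapXY.
  by apply: hy; apply: (r2 x).
by rewrite size_allpairs expnS expn1 leq_mul.
Qed.

(** Cardinality at most [N], phrased through duplicate-free lists so that [P] may be any
    proposition; [escapes] is infinitude in the same style. *)
Definition atmost (T : eqType) (N : nat) (P : T -> Prop) :=
  forall s : seq T, uniq s -> (forall x, x \in s -> P x) -> (size s <= N)%N.

Definition escapes (T : eqType) (P : T -> Prop) := forall s : seq T, exists2 x, x \notin s & P x.

Lemma escapes_not_atmost (T : eqType) (P : T -> Prop) N : escapes P -> ~ atmost N P.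
Proof.
move=> h; have [s [us ss hs]] : exists s : seq T, [/\ uniq s, size s = N.+1 & forall x, x \in s -> P x].
  elim: N.+1 => [|n [s [us ss hs]]]; first by exists [::].
  have [x xs px] := h s; exists (x :: s); rewrite /= xs us ss; split => // y.
  by rewrite inE => /orP[/eqP ->|/hs].
by move=> /(_ s us hs); rewrite ss ltnn.
Qed.

Lemma not_atmost_escapes (T : eqType) (P : T -> Prop) : (forall N, ~ atmost N P) -> escapes P.
Proof.
move=> h s; apply: contrapT => hn; apply: (h (size s)) => t ut ht.
by apply: uniq_leq_size => // x xt; apply: contrapT => /negP xs; apply: hn; exists x => //; exact: ht.
Qed.

Lemma atmost_sub (T : eqType) (P Q : T -> Prop) N M :
  (forall x, P x -> Q x) -> (N <= M)%N -> atmost N Q -> atmost M P.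
Proof. by move=> h NM hQ s us hs; apply: leq_trans NM; apply: hQ us _ => x /hs /h. Qed.

Lemma atmost_or (T : eqType) (P Q : T -> Prop) N M :
  atmost N P -> atmost M Q -> atmost (N + M) (fun x => P x \/ Q x).
Proof.
move=> hP hQ s us hs; rewrite -(count_predC (fun x => `[< P x >]) s) leq_add // -size_filter.
  by apply: hP; rewrite ?filter_uniq // => x; rewrite mem_filter => /andP[/asboolP].
apply: hQ; rewrite ?filter_uniq // => x; rewrite mem_filter /= => /andP[/asboolP nP xs].
by case: (hs x xs).
Qed.

Lemma atmost_bigor (T I : eqType) (r : seq I) (P : I -> T -> Prop) N :
  (forall i, i \in r -> atmost N (P i)) ->
  atmost (size r * N) (fun x => exists2 i, i \in r & P i x).
Proof.
elim: r => [|i r IH] h; first by move=> [|x s] // _ /(_ x (mem_head _ _)) [].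
rewrite /= mulSn; apply: (@atmost_sub _ _ (fun x => P i x \/ exists2 i, i \in r & P i x)) (leqnn _) _.
  by move=> x [j]; rewrite inE => /orP[/eqP ->|jr] pj; [left|right; exists j].
apply: atmost_or; first exact: h (mem_head _ _).
by apply: IH => j jr; apply: h; rewrite inE jr orbT.
Qed.

Lemma atmost_seq (T : eqType) (P : T -> Prop) (s : seq T) :
  (forall x, P x -> x \in s) -> atmost (size s) P.
Proof. by move=> h t ut ht; apply: uniq_leq_size => // x /ht /h. Qed.

Lemma escapes_or (T : eqType) (P Q : T -> Prop) N :
  escapes P -> atmost N (fun x => P x /\ ~ Q x) -> escapes (fun x => P x /\ Q x).
Proof.
move=> hP hN; apply: not_atmost_escapes => M hM.
apply: (@escapes_not_atmost _ P (N + M) hP).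
apply: atmost_sub (leqnn _) (atmost_or hN hM) => x px.
by case: (pselect (Q x)) => qx; [right|left].
Qed.

Lemma poly_nonroot (F : numFieldType) (p : {poly F}) (s : seq F) :
  p != 0 -> exists2 x, x \notin s & p.[x] != 0.
Proof.
move=> p0; pose q := p * \prod_(a <- s) ('X - a%:P).
have q0 : q != 0 by rewrite mulf_neq0 // monic_neq0 // monic_prod_XsubC.
have : exists x, q.[x] != 0.
  apply: contrapT => hn; pose rs : seq F := [seq k%:R | k <- iota 0 (size q)].
  have : (size rs < size q)%N.
    apply: max_poly_roots => //; last first.
      by rewrite map_inj_uniq ?iota_uniq // => k l /eqP; rewrite eqr_nat => /eqP.
    apply/allP => x _; apply: contrapT => /negP hx; apply: hn; exists x; exact: hx.
  by rewrite size_map size_iota ltnn.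
move=> [x]; rewrite hornerM mulf_eq0 negb_or => /andP[px hx]; exists x => //.
by rewrite -root_prod_XsubC.
Qed.

Lemma horner2_map (F : comNzRingType) (u : {poly {poly F}}) (x y : F) :
  u.[x, y] = (map_poly (horner_eval y) u).[x].
Proof. by rewrite -horner_swapXY horner2_swapXY. Qed.

Lemma poly2_nonroot (F : numFieldType) (u : {poly {poly F}}) :
  u != 0 -> exists x y, u.[x, y] != 0.
Proof.
move=> u0; have [|y _ hy] := @poly_nonroot _ (lead_coef u) [::]; first by rewrite lead_coef_eq0.
have [|x _ hx] := @poly_nonroot _ (map_poly (horner_eval y) u) [::].
  apply: contraNneq hy => h; have := congr1 (fun p : {poly F} => p`_(size u).-1) h.
  by rewrite coef_map_id0 ?coef0 //= ?horner_evalE ?horner0 // => ->.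
by exists x, y; rewrite horner2_map.
Qed.

(** Choose an ordinate that no point of the list has and where the leading coefficient survives; the
    remaining polynomial in one variable has a root. *)
Lemma poly2_zero_escapes (F : numClosedFieldType) (u : {poly {poly F}}) :
  (1 < size u)%N || (1 < sizeY u)%N -> escapes (fun p : F * F => u.[p.1, p.2] = 0).
Proof.
have key (t : {poly {poly F}}) (s : seq (F * F)) : (1 < size t)%N ->
    exists x y, (x, y) \notin s /\ t.[x, y] = 0.
  move=> h; have t0 : lead_coef t != 0 by rewrite lead_coef_eq0 -size_poly_gt0 (leq_trans _ h).
  have [y ys hy] := poly_nonroot [seq p.2 | p <- s] t0.
  have st : size (map_poly (horner_eval y) t) = size t by rewrite size_map_poly_id0.
  have /closed_rootP [x /eqP hx] : size (map_poly (horner_eval y) t) != 1%N.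
    by rewrite st gtn_eqF.
  exists x, y; split; last by rewrite horner2_map.
  by apply: contraNN ys => xs; apply/mapP; exists (x, y).
case/orP => h s; first by have [x [y [xs hx]]] := key u s h; exists (x, y).
have [|x [y [xs hx]]] := key (swapXY u) [seq (p.2, p.1) | p <- s]; first by rewrite -sizeYE.
exists (y, x); last by move: hx; rewrite horner2_swapXY.
by apply: contraNN xs => ys; apply/mapP; exists (y, x).
Qed.

(** * Polynomials in two variables as functions on the plane *)

Section Plane.
Variable R : realType.
Local Notation pt := (R[i] * R[i])%type.
Implicit Types (f g h u v : {mpoly R[i][2]}) (p : pt).

Lemma eval2D f g p : eval2 (f + g) p = eval2 f p + eval2 g p.
Proof. exact: mevalD. Qed.

Lemma eval2N f p : eval2 (- f) p = - eval2 f p.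
Proof. exact: mevalN. Qed.

Lemma eval2M f g p : eval2 (f * g) p = eval2 f p * eval2 g p.
Proof. exact: mevalM. Qed.

Lemma eval2C c p : eval2 c%:MP p = c.
Proof. exact: mevalC. Qed.

Lemma eval2Z c f p : eval2 (c *: f) p = c * eval2 f p.
Proof. exact: mevalZ. Qed.

Lemma eval2_0 p : eval2 0 p = 0.
Proof. exact: meval0. Qed.

Lemma eval2_sum (I : Type) (r : seq I) (P : pred I) (F : I -> {mpoly R[i][2]}) p :
  eval2 (\sum_(i <- r | P i) F i) p = \sum_(i <- r | P i) eval2 (F i) p.
Proof. exact: raddf_sum. Qed.

Definition mnm2 (i j : nat) : 'X_{1..2} := (U_(ord0) *+ i + U_(ord_max) *+ j)%MM.

Lemma mnm2_0 i j : mnm2 i j ord0 = i.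
Proof. by rewrite mnmDE !mulmnE !mnm1E /= mul1n mul0n addn0. Qed.

Lemma mnm2_1 i j : mnm2 i j ord_max = j.
Proof. by rewrite mnmDE !mulmnE !mnm1E /= mul1n mul0n. Qed.

Lemma mnm2E (m : 'X_{1..2}) : m = mnm2 (m ord0) (m ord_max).
Proof.
apply/mnmP => i; case: (eqVneq i ord0) => [->|i0]; first by rewrite mnm2_0.
have -> : i = ord_max by apply/val_inj; case: i i0 => [[|[|]]].
by rewrite mnm2_1.
Qed.

Lemma eval2X (m : 'X_{1..2}) p : eval2 'X_[m] p = p.1 ^+ m ord0 * p.2 ^+ m ord_max.
Proof. by rewrite /eval2 mevalX big_ord_recl big_ord1 /=; congr (_ * _ ^+ m _); exact: val_inj. Qed.

Definition coef2 f (i j : nat) := f@_(mnm2 i j).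

Lemma msupp2_lt f m : m \in msupp f -> (m ord0 < msize f)%N /\ (m ord_max < msize f)%N.
Proof.
move=> /msize_mdeg_lt h; have := mdegE m; rewrite big_ord_recl big_ord1.
have -> : lift ord0 ord0 = ord_max :> 'I_2 by exact: val_inj.
by move=> e; move: h; rewrite e => h; split; apply: leq_ltn_trans h; rewrite ?leq_addr ?leq_addl.
Qed.

Lemma eval2_bipoly (D : nat) f p : (msize f <= D)%N -> eval2 f p = bipoly D (coef2 f) p.1 p.2.
Proof.
move=> fD; rewrite [in LHS](mpolyE f) eval2_sum /bipoly.
have -> : \sum_(i < D) \sum_(j < D) coef2 f i j * p.1 ^+ i * p.2 ^+ j =
    \sum_(i < D) \sum_(j < D) \sum_(m <- msupp f) f@_m * (m == mnm2 i j)%:R * (p.1 ^+ i * p.2 ^+ j).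
  apply: eq_bigr => i _; apply: eq_bigr => j _; rewrite -mulrA -big_distrl /=; congr (_ * _).
  rewrite /coef2 [in LHS](mpolyE f) raddf_sum /=; apply: eq_bigr => m _.
  by rewrite mcoeffZ mcoeffX.
under [RHS]eq_bigr => i _ do rewrite exchange_big /=.
rewrite [RHS]exchange_big /= big_seq [RHS]big_seq; apply: eq_bigr => m ms.
have [h0 h1] := msupp2_lt ms.
rewrite (bigD1 (Ordinal (leq_trans h0 fD))) //= [X in _ = _ + X]big1 => [|i ni].
  rewrite (bigD1 (Ordinal (leq_trans h1 fD))) //= big1 => [|j nj].
    by rewrite -mnm2E eqxx mulr1 !addr0 eval2Z eval2X.
  rewrite (_ : (m == _) = false) ?mulr0 ?mul0r //; apply: contra_neqF nj => /eqP e.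
  by apply/val_inj; rewrite /= e mnm2_1.
rewrite big1 // => j _; rewrite (_ : (m == _) = false) ?mulr0 ?mul0r //.
by apply: contra_neqF ni => /eqP e; apply/val_inj; rewrite /= e mnm2_0.
Qed.

Definition poly2_of f : {poly {poly R[i]}} :=
  \poly_(i < msize f) \poly_(j < msize f) coef2 f i j.

Lemma poly2_ofE f p : (poly2_of f).[p.1, p.2] = eval2 f p.
Proof.
rewrite (eval2_bipoly p (leqnn _)) horner_poly horner_sum; apply: eq_bigr => i _.
rewrite hornerM -rmorphXn hornerC horner_poly mulr_suml; apply: eq_bigr => j _.
by rewrite mulrAC.
Qed.

Lemma poly2_of_eq0 f : (poly2_of f == 0) = (f == 0).
Proof.
apply/eqP/eqP => [h|->]; last by apply/polyP => i; rewrite coef_poly msize0 coef0.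
apply/mpolyP => m; rewrite mcoeff0; apply/eqP; rewrite mcoeff_eq0; apply/negP => ms.
have [h0 h1] := msupp2_lt ms.
have := congr1 (fun u : {poly {poly R[i]}} => u`_(m ord0)`_(m ord_max)) h.
rewrite !coef0 coef_poly h0 coef_poly h1 /coef2 -mnm2E => /eqP.
by rewrite mcoeff_eq0 ms.
Qed.

Lemma size_poly2_of f : (size (poly2_of f) <= msize f)%N.
Proof. exact: size_poly. Qed.

Lemma sizeY_poly2_of f : (sizeY (poly2_of f) <= msize f)%N.
Proof.
apply/bigmax_leqP => i _; rewrite coef_poly; case: ifP => _; last by rewrite size_poly0.
exact: size_poly.
Qed.

Definition of_poly2 (u : {poly {poly R[i]}}) : {mpoly R[i][2]} :=
  \sum_(i < size u) \sum_(j < sizeY u) u`_i`_j *: 'X_[mnm2 i j].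

Lemma of_poly2E (u : {poly {poly R[i]}}) p : eval2 (of_poly2 u) p = u.[p.1, p.2].
Proof.
rewrite [u.[_]]horner_coef horner_sum eval2_sum; apply: eq_bigr => i _.
rewrite hornerM -rmorphXn hornerC eval2_sum (horner_coef_wide _ (max_size_coefXY u i)) mulr_suml.
by apply: eq_bigr => j _; rewrite eval2Z eval2X mnm2_0 mnm2_1 -[RHS]mulrA [p.2 ^+ _ * _]mulrC.
Qed.

Lemma eval2_neq0 f : f != 0 -> exists p, eval2 f p != 0.
Proof.
by rewrite -poly2_of_eq0 => /poly2_nonroot [x [y h]]; exists (x, y); rewrite -poly2_ofE.
Qed.

Lemma eval2_inj f g : (forall p, eval2 f p = eval2 g p) -> f = g.
Proof.
move=> h; apply/eqP; rewrite -subr_eq0; apply: contraT => /eval2_neq0 [p].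
by rewrite eval2D eval2N h subrr eqxx.
Qed.

Lemma nonconstant_escapes f : (1 < msize f)%N -> escapes (fun p => eval2 f p = 0).
Proof.
move=> hf s; have [p ps hp] : exists2 p, p \notin s & (poly2_of f).[p.1, p.2] = 0; last first.
  by exists p => //; rewrite -poly2_ofE.
apply: poly2_zero_escapes; apply: contraT; rewrite negb_or -!leqNgt => /andP[s1 s2].
suff : (msize f <= 1)%N by rewrite leqNgt hf.
have e : f = ((poly2_of f)`_0`_0)%:MP.
  apply: eval2_inj => p; rewrite eval2C -poly2_ofE [in LHS](size1_polyC s1) hornerC.
  by rewrite [in LHS](size1_polyC (leq_trans (max_size_coefXY _ _) s2)) hornerC.
by rewrite e msizeC; case: eqP.
Qed.

Lemma mpoly_bezout (D : nat) f g : f != 0 -> g != 0 -> (msize f <= D)%N -> (msize g <= D)%N ->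
  (exists h u v, [/\ (1 < msize h)%N, f = u * h & g = v * h]) \/
  atmost ((2 * D * D) ^ 2) (fun p => eval2 f p = 0 /\ eval2 g p = 0).
Proof.
move=> f0 g0 fD gD.
have [||||||[h [u [v [h1 e1 e2]]]]|hs] := @poly2_bezout _ D (poly2_of f) (poly2_of g).
- by rewrite poly2_of_eq0.
- by rewrite poly2_of_eq0.
- exact: leq_trans (size_poly2_of f) fD.
- exact: leq_trans (size_poly2_of g) gD.
- exact: leq_trans (sizeY_poly2_of f) fD.
- exact: leq_trans (sizeY_poly2_of g) gD.
- left; exists (of_poly2 h), (of_poly2 u), (of_poly2 v); split.
  + rewrite ltnNge; apply/negP => /msize1_polyC e.
    have hc : h = (((of_poly2 h)@_0)%:P)%:P.
      apply/eqP; rewrite -subr_eq0; apply: contraT => /poly2_nonroot [x [y]].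
      by rewrite !hornerE -(of_poly2E h (x, y)) {1}e eval2C subrr eqxx.
    have a : (size h <= 1)%N by rewrite hc size_polyC_leq1.
    have b : (sizeY h <= 1)%N.
      rewrite sizeYE hc swapXY_polyC map_polyC /= size_polyC; by case: (_ == _).
    by move: h1; rewrite !ltnNge a b.
  + by apply: eval2_inj => p; rewrite eval2M !of_poly2E -hornerM -hornerM -e1 poly2_ofE.
  + by apply: eval2_inj => p; rewrite eval2M !of_poly2E -hornerM -hornerM -e2 poly2_ofE.
by right=> s us hz; apply: hs => // z /hz [z1 z2]; rewrite !poly2_ofE.
Qed.

Definition irreducible2 g :=
  (1 < msize g)%N /\ forall u v, g = u * v -> (msize u <= 1)%N \/ (msize v <= 1)%N.

Lemma msize_gt0_neq0 f : (0 < msize f)%N -> f != 0.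
Proof. by apply: contraTneq => ->; rewrite msize0. Qed.

(** A common factor is [g] itself up to a constant, by irreducibility; without one, [mpoly_bezout]
    bounds the common zeros. *)
Lemma irreducible2_zeros (D : nat) g f : irreducible2 g -> (msize g <= D)%N -> (msize f <= D)%N ->
  (forall p, eval2 g p = 0 -> eval2 f p = 0) \/
  atmost ((2 * D * D) ^ 2) (fun p => eval2 g p = 0 /\ eval2 f p = 0).
Proof.
move=> [g1 gi] gD fD; have g0 : g != 0 by apply: msize_gt0_neq0; apply: ltnW.
have [->|f0] := eqVneq f 0; first by left => p _; rewrite eval2_0.
have [[h [u [v [h1 e1 e2]]]]|] := mpoly_bezout g0 f0 gD fD; last by right.
left=> p; rewrite e1 e2 !eval2M.
have [u1|] := gi u h e1; last by rewrite leqNgt h1.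
have u0 : u@_0 != 0.
  by apply: contraNneq g0 => z; rewrite e1 (msize1_polyC u1) z mpolyC0 mul0r.
rewrite (msize1_polyC u1) eval2C => /eqP; rewrite mulf_eq0 (negPf u0) /= => /eqP ->.
by rewrite mulr0.
Qed.

Lemma irreducible2_factors f : (1 < msize f)%N -> exists gs : seq {mpoly R[i][2]},
  [/\ (size gs < msize f)%N, forall g, g \in gs -> irreducible2 g /\ (msize g <= msize f)%N &
    forall p, eval2 f p = 0 <-> exists2 g, g \in gs & eval2 g p = 0].
Proof.
have arith (a b c : nat) : (1 < a)%N -> (1 < b)%N -> c = (a + b).-1 -> (a < c)%N /\ (b < c)%N by lia.
have arith2 (a b c x y : nat) : (x < a)%N -> (y < b)%N -> c = (a + b).-1 -> (x + y < c)%N by lia.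
move: {2}(msize f) (leqnn (msize f)) => n; elim: n f => [|n IH] f hn f1.
  by move: f1; rewrite ltnNge (leq_trans hn).
have [hi|hi] := pselect (irreducible2 f).
  exists [:: f]; split => // [g|p]; first by rewrite inE => /eqP ->.
  split=> [h|[g]]; first by exists f; rewrite ?mem_head.
  by rewrite inE => /eqP ->.
have [u [v [e u1 v1]]] : exists u v, [/\ f = u * v, (1 < msize u)%N & (1 < msize v)%N].
  apply: contrapT => hn'; apply: hi; split => // u v e.
  case: (leqP (msize u) 1) => u1; first by left.
  case: (leqP (msize v) 1) => v1; first by right.
  by exfalso; apply: hn'; exists u, v.
have sf : msize f = (msize u + msize v).-1.
  by rewrite e msizeM // msize_gt0_neq0 // ltnW.
have [su sv] := arith _ _ _ u1 v1 sf.
have [|gu [zsu iu zu]] := IH u _ u1; first by rewrite -ltnS; apply: leq_trans su hn.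
have [|gv [zsv iv zv]] := IH v _ v1; first by rewrite -ltnS; apply: leq_trans sv hn.
exists (gu ++ gv); split.
- rewrite size_cat; exact: arith2 zsu zsv sf.
- move=> g; rewrite mem_cat => /orP[/iu|/iv] [ig hg]; split => //; apply: leq_trans hg (ltnW _); rewrite ?su ?sv //.
- move=> p; rewrite e eval2M; split.
    move=> /eqP; rewrite mulf_eq0 => /orP[/eqP/zu|/eqP/zv] [g gg eg]; exists g => //;
    by rewrite mem_cat gg ?orbT.
  case=> g; rewrite mem_cat => /orP[gg|gg] eg; apply/eqP; rewrite mulf_eq0; apply/orP.
    by left; apply/eqP/zu; exists g.
  by right; apply/eqP/zv; exists g.
Qed.

(** Polynomial functions of degree at most [e]. Working with functions lets the degrees of composed
    maps be tracked without writing the polynomials. *)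
Definition polyfun (e : nat) (phi : pt -> R[i]) :=
  exists2 f : {mpoly R[i][2]}, (msize f <= e.+1)%N & forall p, phi p = eval2 f p.

Lemma polyfun_ext e phi psi : (forall p, phi p = psi p) -> polyfun e phi -> polyfun e psi.
Proof. by move=> h [f fe hf]; exists f => // p; rewrite -h. Qed.

Lemma polyfun_mono e e' phi : (e <= e')%N -> polyfun e phi -> polyfun e' phi.
Proof. by move=> h [f fe hf]; exists f => //; apply: leq_trans fe _. Qed.

Lemma polyfunC e c : polyfun e (fun=> c).
Proof. by exists c%:MP => [|p]; rewrite ?eval2C // msizeC; case: eqP. Qed.

Lemma polyfun1 e : polyfun e.+1 (fun p => p.1).
Proof.
exists 'X_[mnm2 1 0] => [|p]; last by rewrite eval2X mnm2_0 mnm2_1 expr1 expr0 mulr1.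
by rewrite msizeX mdegD !mdegMn !mdeg1.
Qed.

Lemma polyfun2 e : polyfun e.+1 (fun p => p.2).
Proof.
exists 'X_[mnm2 0 1] => [|p]; last by rewrite eval2X mnm2_0 mnm2_1 expr1 expr0 mul1r.
by rewrite msizeX mdegD !mdegMn !mdeg1.
Qed.

Lemma polyfunD e phi psi : polyfun e phi -> polyfun e psi -> polyfun e (fun p => phi p + psi p).
Proof.
move=> [f fe hf] [g ge hg]; exists (f + g) => [|p]; last by rewrite eval2D hf hg.
by apply: leq_trans (msizeD_le _ _) _; rewrite geq_max fe.
Qed.

Lemma polyfunN e phi : polyfun e phi -> polyfun e (fun p => - phi p).
Proof. by move=> [f fe hf]; exists (- f) => [|p]; rewrite ?eval2N ?hf // mmeasureN. Qed.

Lemma polyfunB e phi psi : polyfun e phi -> polyfun e psi -> polyfun e (fun p => phi p - psi p).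
Proof. by move=> h1 h2; apply: polyfunD => //; exact: polyfunN. Qed.

Lemma polyfunM e1 e2 phi psi :
  polyfun e1 phi -> polyfun e2 psi -> polyfun (e1 + e2) (fun p => phi p * psi p).
Proof.
move=> [f fe hf] [g ge hg]; exists (f * g) => [|p]; last by rewrite eval2M hf hg.
have [->|f0] := eqVneq f 0; first by rewrite mul0r msize0.
have [->|g0] := eqVneq g 0; first by rewrite mulr0 msize0.
have arith (a b : nat) : (a <= e1.+1)%N -> (b <= e2.+1)%N -> ((a + b).-1 <= (e1 + e2).+1)%N by lia.
by rewrite msizeM //; exact: arith fe ge.
Qed.

Lemma polyfunZ e c phi : polyfun e phi -> polyfun e (fun p => c * phi p).
Proof. by move=> h; rewrite -[e]add0n; apply: polyfunM => //; exact: polyfunC. Qed.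

Lemma polyfunX e n phi : polyfun e phi -> polyfun (e * n) (fun p => phi p ^+ n).
Proof.
move=> h; elim: n => [|n IH]; first by rewrite muln0; apply: polyfunC.
by rewrite mulnS; apply: polyfun_ext (polyfunM h IH) => p; rewrite exprS.
Qed.

Lemma polyfun_sum e (I : Type) (r : seq I) (P : pred I) (F : I -> pt -> R[i]) :
  (forall i, polyfun e (F i)) -> polyfun e (fun p => \sum_(i <- r | P i) F i p).
Proof.
move=> h; elim: r => [|i r IH].
  by apply: polyfun_ext (polyfunC e 0) => p; rewrite big_nil.
case Pi : (P i); last by apply: polyfun_ext IH => p; rewrite big_cons Pi.
by apply: polyfun_ext (polyfunD (h i) IH) => p; rewrite big_cons Pi.
Qed.

Lemma irreducible2_polyfun (D : nat) g phi : irreducible2 g -> (msize g <= D.+1)%N -> polyfun D phi ->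
  (forall p, eval2 g p = 0 -> phi p = 0) \/
  atmost ((2 * D.+1 * D.+1) ^ 2) (fun p => eval2 g p = 0 /\ phi p = 0).
Proof.
move=> gi gD [f fe hf]; have [h|h] := irreducible2_zeros gi gD fe.
  by left => p /h; rewrite hf.
by right; apply: atmost_sub (leqnn _) h => p [-> ]; rewrite hf.
Qed.

Definition no_small_curve (C : set pt) :=
  ~ (exists (D : set pt) (e : nat), [/\ curve_of_degree D e, (e <= 4)%N & D `<=` C]).

Lemma low_degree_section (D : nat) (C : set pt) f phi : C = zero_set f -> no_small_curve C ->
  f != 0 -> (msize f <= D.+1)%N -> (4 <= D)%N -> polyfun 4 phi ->
  (forall p, phi p = 0) \/ atmost ((2 * D.+1 * D.+1) ^ 2) (fun p => C p /\ phi p = 0).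
Proof.
move=> eC nC f0 fD D4 [g ge hg].
have [g0|g0] := eqVneq g 0; first by left => p; rewrite hg g0 eval2_0.
have gD : (msize g <= D.+1)%N by apply: leq_trans ge _.
have [[h [u [v [h1 e1 e2]]]]|] := mpoly_bezout f0 g0 fD gD; last first.
  by right; apply: atmost_sub (leqnn _) b => p; rewrite eC hg.
exfalso; apply: nC.
have h0 : h != 0 by apply: msize_gt0_neq0; apply: ltnW.
have v0 : v != 0 by apply: contraNneq g0 => z; rewrite e2 z mul0r.
have h5 : (msize h <= 5)%N.
  have arith (a b : nat) : (a <= (b.+1 + a).-1)%N by lia.
  by apply: leq_trans ge; rewrite e2 msizeM // [msize v]mpolySpred //; exact: arith.
(* The degree of a curve refers to its least defining polynomial, so [h] is replaced by a polynomial
   of least size with the same zeros; the degree is at most four because [h] divides [g]. *)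
pose Q n := `[< exists2 t : {mpoly R[i][2]}, zero_set h = zero_set t & msize t = n >].
have hQ : exists n, Q n by exists (msize h); apply/asboolP; exists h.
case: (ex_minnP hQ) => n /asboolP [t et st] nmin.
have zh p : eval2 h p = 0 <-> eval2 t p = 0.
  by have := congr1 (fun A : set pt => A p) et; rewrite /zero_set /= => ->.
have n1 : (1 < n)%N.
  rewrite ltnNge -st; apply/negP => /msize1_polyC ec.
  have [p hp] := eval2_neq0 h0; have [q _ hq] := nonconstant_escapes h1 [::].
  move/zh: hq hp; rewrite ec eval2C => c0 /eqP; apply; apply/zh.
  by rewrite ec eval2C.
have n5 : (n <= msize h)%N by apply: nmin; apply/asboolP; exists h.
exists (zero_set h), n.-1; split.
- split; first by rewrite -ltnS prednK // ltnW.
    by exists t => //; rewrite st prednK // ltnW.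
  move=> t' et'; rewrite prednK; last exact: ltnW.
  by apply: nmin; apply/asboolP; exists t'.
- by rewrite -ltnS prednK ?(ltnW n1) //; apply: leq_trans n5 h5.
- by rewrite eC => p; rewrite /zero_set /= e1 eval2M => ->; rewrite mulr0.
Qed.

End Plane.

(** * The quadric of circles *)

Definition j0 : 'I_4 := @Ordinal 4 0 isT.
Definition j1 : 'I_4 := @Ordinal 4 1 isT.
Definition j2 : 'I_4 := @Ordinal 4 2 isT.
Definition j3 : 'I_4 := @Ordinal 4 3 isT.

Lemma sum4 (V : nmodType) (f : 'I_4 -> V) : \sum_i f i = f j0 + f j1 + f j2 + f j3.
Proof.
rewrite !big_ord_recl big_ord0 addr0 !addrA.
by congr (f _ + f _ + f _ + f _); exact: val_inj.
Qed.

Lemma row4P (F : Type) (u w : 'rV[F]_4) : u 0 j0 = w 0 j0 -> u 0 j1 = w 0 j1 ->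
  u 0 j2 = w 0 j2 -> u 0 j3 = w 0 j3 -> u = w.
Proof.
move=> h0 h1 h2 h3; apply/rowP => -[[|[|[|[|//]]]] hi].
- by rewrite (_ : Ordinal hi = j0) //; exact: val_inj.
- by rewrite (_ : Ordinal hi = j1) //; exact: val_inj.
- by rewrite (_ : Ordinal hi = j2) //; exact: val_inj.
- by rewrite (_ : Ordinal hi = j3) //; exact: val_inj.
Qed.

Section Forms.
Variable F : numFieldType.
Implicit Types (a b c u v w : 'rV[F]_4) (p q : F * F) (x y : F).

Definition dot c w : F := \sum_i c 0 i * w 0 i.

Lemma dotE c w : dot c w = c 0 j0 * w 0 j0 + c 0 j1 * w 0 j1 + c 0 j2 * w 0 j2 + c 0 j3 * w 0 j3.
Proof. exact: sum4. Qed.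

Lemma dotDr c u w : dot c (u + w) = dot c u + dot c w.
Proof. by rewrite !dotE !mxE; ring. Qed.

Lemma dotZr c x w : dot c (x *: w) = x * dot c w.
Proof. by rewrite !dotE !mxE; ring. Qed.

Lemma dot_mulmx c w (M : 'M[F]_4) : dot c (w *m M) = dot (c *m M^T) w.
Proof.
rewrite /dot; under eq_bigr => i _ do rewrite mxE big_distrr.
rewrite exchange_big /=; apply: eq_bigr => j _; rewrite mxE big_distrl /=.
by apply: eq_bigr => i _; rewrite mxE mulrCA mulrC.
Qed.

Lemma coord_dot (i : 'I_4) w : w 0 i = dot (delta_mx 0 i) w.
Proof.
rewrite /dot (bigD1 i) //= mxE !eqxx mul1r big1 ?addr0 // => j ji.
by rewrite mxE eqxx (negPf ji) mul0r.
Qed.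

Lemma dot_mx (M : 'M[F]_4) c : (forall i, dot c (row i M) = 0) <-> c *m M^T = 0.
Proof.
have e i : dot c (row i M) = (c *m M^T) 0 i.
  by rewrite mxE; apply: eq_bigr => j _; rewrite !mxE.
split=> [h|h i]; last by rewrite e h mxE.
by apply/rowP => i; rewrite -e h mxE.
Qed.

Definition mx4 a b c w : 'M[F]_4 := \matrix_(i, j) (nth 0 [:: a; b; c; w] i) 0 j.

Definition d4 a b c w : F := \det (mx4 a b c w).

Lemma row_mx4 a b c w : [/\ row j0 (mx4 a b c w) = a, row j1 (mx4 a b c w) = b,
  row j2 (mx4 a b c w) = c & row j3 (mx4 a b c w) = w].
Proof. by split; apply/rowP => i; rewrite !mxE. Qed.

Lemma forall_ord4 (P : 'I_4 -> Prop) : P j0 -> P j1 -> P j2 -> P j3 -> forall i, P i.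
Proof.
move=> h0 h1 h2 h3 [[|[|[|[|//]]]] hi].
- by rewrite (_ : Ordinal hi = j0) //; exact: val_inj.
- by rewrite (_ : Ordinal hi = j1) //; exact: val_inj.
- by rewrite (_ : Ordinal hi = j2) //; exact: val_inj.
- by rewrite (_ : Ordinal hi = j3) //; exact: val_inj.
Qed.

Lemma d4_form a b c w : d4 a b c w = 0 <->
  exists2 n, n != 0 & [/\ dot n a = 0, dot n b = 0, dot n c = 0 & dot n w = 0].
Proof.
have [ra rb rc rw] := row_mx4 a b c w.
split=> [/eqP|[n n0 [na nb nc nw]]].
  rewrite /d4 -det_tr => /det0P [n n0 h]; exists n => //.
  have {}h := (dot_mx (mx4 a b c w) n).2 h.
  by split; [rewrite -ra|rewrite -rb|rewrite -rc|rewrite -rw].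
apply/eqP; rewrite /d4 -det_tr; apply/det0P; exists n => //.
by apply/dot_mx; apply: forall_ord4; rewrite ?ra ?rb ?rc ?rw.
Qed.

Lemma d4_dep a b c w : d4 a b c w = 0 <-> exists x0 x1 x2 x3 : F,
  [\/ x0 != 0, x1 != 0, x2 != 0 | x3 != 0] /\ x0 *: a + x1 *: b + x2 *: c + x3 *: w = 0.
Proof.
have [ra rb rc rw] := row_mx4 a b c w.
have e n : n *m mx4 a b c w = n 0 j0 *: a + n 0 j1 *: b + n 0 j2 *: c + n 0 j3 *: w.
  by rewrite mulmx_sum_row sum4 ra rb rc rw.
split=> [/eqP /det0P [n n0 h]|[x0 [x1 [x2 [x3 [h e0]]]]]].
  exists (n 0 j0), (n 0 j1), (n 0 j2), (n 0 j3); rewrite -e h; split => //.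
  apply: contrapT => hn; move/eqP: n0; apply; apply: row4P; rewrite mxE; apply/eqP;
    apply: contrapT => /negP hz; apply: hn.
  - exact: Or41.
  - exact: Or42.
  - exact: Or43.
  - exact: Or44.
apply/eqP/det0P; exists (\row_(i < 4) [:: x0; x1; x2; x3]`_i); last by rewrite e !mxE.
by case: h => h; apply: contraNneq h => /rowP h;
  [have := h j0|have := h j1|have := h j2|have := h j3]; rewrite !mxE => /= ->.
Qed.

Definition d2 x y x' y' := x * y' - y * x'.

(** The generalised cross product: the cofactors along the first row, which make [d4] a linear form
    in its first argument. *)
Definition cof b c w : 'rV[F]_4 :=
  let m i j k := b 0 i * d2 (c 0 j) (c 0 k) (w 0 j) (w 0 k)
               - b 0 j * d2 (c 0 i) (c 0 k) (w 0 i) (w 0 k)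
               + b 0 k * d2 (c 0 i) (c 0 j) (w 0 i) (w 0 j) in
  \row_(i < 4) [:: m j1 j2 j3; - m j0 j2 j3; m j0 j1 j3; - m j0 j1 j2]`_i.

Lemma cofE b c w : let m i j k := b 0 i * d2 (c 0 j) (c 0 k) (w 0 j) (w 0 k)
               - b 0 j * d2 (c 0 i) (c 0 k) (w 0 i) (w 0 k)
               + b 0 k * d2 (c 0 i) (c 0 j) (w 0 i) (w 0 j) in
  [/\ cof b c w 0 j0 = m j1 j2 j3, cof b c w 0 j1 = - m j0 j2 j3,
      cof b c w 0 j2 = m j0 j1 j3 & cof b c w 0 j3 = - m j0 j1 j2].
Proof. by split; rewrite mxE. Qed.

Lemma det2E (A : 'M[F]_2) : \det A = A 0 0 * A 1 1 - A 0 1 * A 1 0.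
Proof.
rewrite (expand_det_row _ ord0) !big_ord_recl big_ord0 /cofactor !det_mx11 !mxE /= !addr0.
rewrite /bump /= !expr0 expr1 mul1r mulN1r mulrN.
by congr (A _ _ * A _ _ - A _ _ * A _ _); exact: val_inj.
Qed.

Lemma d4E a b c w : d4 a b c w = dot (cof b c w) a.
Proof.
rewrite dotE; have [-> -> -> ->] := cofE b c w.
rewrite /d4 (expand_det_row _ ord0) sum4 /cofactor.
rewrite !(expand_det_row _ ord0) !big_ord_recl !big_ord0 /cofactor !det2E !mxE /=.
have coord v : exists f : nat -> F, forall i : 'I_4, v 0 i = f i.
  by exists (fun n => v 0 (inord n)) => i; rewrite inord_val.
have [fb eb] := coord b; have [fc ec] := coord c; have [fw ew] := coord w.
by rewrite /d2 !eb !ec !ew /= /bump /=; ring.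
Qed.

Lemma d4_expand a b c w : d4 a b c w = (cof b c w) 0 j0 * a 0 j0 + (cof b c w) 0 j1 * a 0 j1
  + (cof b c w) 0 j2 * a 0 j2 + (cof b c w) 0 j3 * a 0 j3.
Proof. by rewrite d4E dotE. Qed.

Lemma d4_comb1 x y a a' b c w :
  d4 (x *: a + y *: a') b c w = x * d4 a b c w + y * d4 a' b c w.
Proof. by rewrite !d4E dotDr !dotZr. Qed.

Lemma d4_swap01 a b c w : d4 a b c w = - d4 b a c w.
Proof.
by rewrite !d4_expand; have [-> -> -> ->] := cofE b c w; have [-> -> -> ->] := cofE a c w; rewrite /d2; ring.
Qed.

Lemma d4_swap02 a b c w : d4 a b c w = - d4 c b a w.
Proof.
by rewrite !d4_expand; have [-> -> -> ->] := cofE b c w; have [-> -> -> ->] := cofE b a w; rewrite /d2; ring.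
Qed.

Lemma d4_swap03 a b c w : d4 a b c w = - d4 w b c a.
Proof.
by rewrite !d4_expand; have [-> -> -> ->] := cofE b c w; have [-> -> -> ->] := cofE b c a; rewrite /d2; ring.
Qed.

Lemma d4_same a b c : [/\ d4 a a b c = 0, d4 a b a c = 0 & d4 a b c a = 0].
Proof.
have h x : x = - x -> x = 0.
  by move=> e; apply/eqP; have := mulrn_eq0 x 2; rewrite mulr2n {2}e subrr eqxx => /esym.
split; apply: h; [exact: d4_swap01|exact: d4_swap02|exact: d4_swap03].
Qed.

(* The polarity of the quadric [w1^2 + w2^2 = w0 w3]; the points [par p] of the plane lie on it,
   and circles are its plane sections. *)
Definition bf u w : F := u 0 j1 * w 0 j1 + u 0 j2 * w 0 j2 - (u 0 j0 * w 0 j3 + u 0 j3 * w 0 j0) / 2.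

Lemma bfC u w : bf u w = bf w u.
Proof. by rewrite /bf; ring. Qed.

Lemma bfDl u v w : bf (u + v) w = bf u w + bf v w.
Proof. by rewrite /bf !mxE; ring. Qed.

Lemma bfZl x u w : bf (x *: u) w = x * bf u w.
Proof. by rewrite /bf !mxE; ring. Qed.

Lemma bfDr u v w : bf u (v + w) = bf u v + bf u w.
Proof. by rewrite /bf !mxE; ring. Qed.

Lemma bfZr x u w : bf u (x *: w) = x * bf u w.
Proof. by rewrite /bf !mxE; ring. Qed.

Lemma bfNl u w : bf (- u) w = - bf u w.
Proof. by rewrite /bf !mxE; ring. Qed.

Lemma bfNr u w : bf u (- w) = - bf u w.
Proof. by rewrite /bf !mxE; ring. Qed.

Definition bfE := (bfDl, bfDr, bfNl, bfNr, bfZl, bfZr).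

Definition polar u : 'rV[F]_4 := \row_(i < 4) [:: - u 0 j3 / 2; u 0 j1; u 0 j2; - u 0 j0 / 2]`_i.

Lemma dot_polar u w : dot (polar u) w = bf u w.
Proof. by rewrite dotE /bf !mxE /=; ring. Qed.

Lemma polar_eq0 u : polar u = 0 -> u = 0.
Proof.
have n2 : (2 : F) != 0 by rewrite pnatr_eq0.
move=> /rowP h; apply: row4P; rewrite mxE.
- have := h j3; rewrite !mxE /= => /eqP; rewrite mulf_eq0 oppr_eq0 invr_eq0 (negPf n2) orbF => /eqP //.
- by have := h j1; rewrite !mxE.
- by have := h j2; rewrite !mxE.
- have := h j0; rewrite !mxE /= => /eqP; rewrite mulf_eq0 oppr_eq0 invr_eq0 (negPf n2) orbF => /eqP //.
Qed.

Definition par p : 'rV[F]_4 := \row_(i < 4) [:: 1; p.1; p.2; p.1 ^+ 2 + p.2 ^+ 2]`_i.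

Lemma parE p : [/\ par p 0 j0 = 1, par p 0 j1 = p.1, par p 0 j2 = p.2 &
  par p 0 j3 = p.1 ^+ 2 + p.2 ^+ 2].
Proof. by split; rewrite mxE. Qed.

Lemma bf_par p q : bf (par p) (par q) = - ((p.1 - q.1) ^+ 2 + (p.2 - q.2) ^+ 2) / 2.
Proof.
by rewrite /bf; have [-> -> -> ->] := parE p; have [-> -> -> ->] := parE q; field.
Qed.

Lemma bf_par_self p : bf (par p) (par p) = 0.
Proof. by rewrite bf_par !subrr; ring. Qed.

Definition projp w : F * F := (w 0 j1 / w 0 j0, w 0 j2 / w 0 j0).

Lemma proj_par x p : x != 0 -> projp (x *: par p) = p.
Proof.
move=> x0; rewrite /projp !mxE /= !mulr1; case: p => p1 p2 /=.
by congr (_, _); field.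
Qed.

Lemma par_proj w : bf w w = 0 -> w 0 j0 != 0 -> w = w 0 j0 *: par (projp w).
Proof.
move=> h w0; apply: row4P; rewrite !mxE /=; [by rewrite mulr1|by field|by field|].
have e : w 0 j1 ^+ 2 + w 0 j2 ^+ 2 = w 0 j0 * w 0 j3.
  have n2 : (2 : F) != 0 by rewrite pnatr_eq0.
  by apply/eqP; rewrite -subr_eq0 -h /bf; apply/eqP; field.
rewrite !expr_div_n -mulrDl e; field; exact: w0.
Qed.

Lemma par_inj x p q : par p = x *: par q -> p = q.
Proof.
move=> e; have := congr1 (fun w => w 0 j0) e; rewrite !mxE /= mulr1 => x1.
by rewrite -(proj_par p (oner_neq0 F)) scale1r e -x1 proj_par ?oner_neq0.
Qed.

Lemma par_neq0 p : par p != 0.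
Proof.
apply/eqP => /rowP /(_ j0); rewrite !mxE /= => /eqP; by rewrite oner_eq0.
Qed.

(** For [bf o o = 1] this is the orthogonal reflection in [o], acting on row vectors. On the points
    [par p] it is the inversion in the circle, or reflection in the line, given by
    [bf (par p) o = 0]. *)
Definition refl (o : 'rV[F]_4) : 'M[F]_4 := 1%:M - 2 *: ((polar o)^T *m o).

Lemma reflE o w : w *m refl o = w - (2 * bf w o) *: o.
Proof.
rewrite mulmxBr mulmx1 -scalemxAr mulmxA; congr (_ - _).
have -> : w *m (polar o)^T = (bf w o)%:M.
  apply/matrixP => i j; rewrite !ord1 !mxE eqxx mulr1n -[RHS]bfC -dot_polar.
  by apply: eq_bigr => k _; rewrite mxE mulrC.
by rewrite mul_scalar_mx scalerA.
Qed.

Lemma mulmx_row_inj (A B : 'M[F]_4) : (forall w : 'rV_4, w *m A = w *m B) -> A = B.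
Proof. by move=> h; apply/row_matrixP => i; rewrite !rowE h. Qed.

Lemma reflK o : bf o o = 1 -> refl o *m refl o = 1%:M.
Proof.
move=> o1; apply: mulmx_row_inj => w; rewrite mulmxA mulmx1 !reflE !bfE o1.
rewrite -addrA -opprD -scalerDl (_ : 2 * bf w o + _ = 0); first by rewrite scale0r subr0.
by ring.
Qed.

Lemma refl2_inv o o' : bf o o = 1 -> bf o' o' = 1 ->
  (refl o' *m refl o) *m (refl o *m refl o') = 1%:M.
Proof. by move=> o1 o1'; rewrite mulmxA -(mulmxA (refl o')) reflK // mulmx1 reflK. Qed.

Lemma bf_refl o u w : bf o o = 1 -> bf (u *m refl o) (w *m refl o) = bf u w.
Proof. by move=> o1; rewrite !reflE !bfE o1 [bf o w]bfC; ring. Qed.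

Definition on_line o p q := exists x y, o = x *: par p + y *: par q.

(** [bf o o = 1] says that [2 * (x * y * bf (par p) (par q)) = 1] for the coefficients of [o], and
    this cancels [par p] in its own image. *)
Lemma on_line_refl o p q : bf o o = 1 -> on_line o p q ->
  exists2 x, x != 0 & par p *m refl o = x *: par q.
Proof.
move=> o1 [x [y e]].
have h : 2 * (x * y * bf (par p) (par q)) = 1.
  by have := o1; rewrite e !bfE !bf_par_self [bf (par q) _]bfC => h; rewrite -[RHS]h; ring.
exists (- (2 * y * y * bf (par p) (par q))).
  rewrite oppr_eq0; apply/eqP => z; have : x * (2 * y * y * bf (par p) (par q)) = 0 by rewrite z mulr0.
  have -> : x * (2 * y * y * bf (par p) (par q)) = y by rewrite -[RHS]mulr1 -[X in _ = _ * X]h; ring.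
  by move=> y0; move: h; rewrite y0 mulr0 mul0r mulr0 => /esym /eqP; rewrite oner_eq0.
have eb : bf (par p) o = y * bf (par p) (par q) by rewrite e !bfE bf_par_self; ring.
rewrite reflE eb [in LHS]e scalerDr !scalerA opprD addrA.
have -> : 2 * (y * bf (par p) (par q)) * x = 1 by rewrite -[RHS]h; ring.
by rewrite scale1r subrr add0r -scaleNr; congr (_ *: _); ring.
Qed.

Lemma annihilator2 u w : exists2 c, c != 0 & dot c u = 0 /\ dot c w = 0.
Proof.
have /d4_form [c c0 [h1 h2 _ _]] : d4 u w 0 0 = 0.
  apply/d4_dep; exists 0, 0, 1, 0; rewrite !scale0r !scaler0 !addr0; split => //.
  by apply: Or43; rewrite oner_eq0.
by exists c.
Qed.

Lemma annihilator3 u v w : exists2 c, c != 0 & [/\ dot c u = 0, dot c v = 0 & dot c w = 0].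
Proof.
have /d4_form [c c0 [h1 h2 h3 _]] : d4 u v w 0 = 0.
  apply/d4_dep; exists 0, 0, 0, 1; rewrite !scale0r !scaler0 !addr0; split => //.
  by apply: Or44; rewrite oner_eq0.
by exists c.
Qed.

End Forms.

(** * Centres *)

Lemma atmost_inj (T U : eqType) (P : T -> Prop) (Q : U -> Prop) (f : T -> U) N :
  (forall x y, P x -> P y -> f x = f y -> x = y) -> (forall x, P x -> Q (f x)) ->
  atmost N Q -> atmost N P.
Proof.
move=> fi fQ hQ s us hs; rewrite -(size_map f); apply: hQ.
  by rewrite map_inj_in_uniq // => x y xs ys; apply: fi; exact: hs.
by move=> _ /mapP [x xs ->]; apply: fQ; exact: hs.
Qed.

Lemma escapes_all (T I : eqType) (P : T -> Prop) (Q : I -> T -> Prop) (r : seq I) N :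
  escapes P -> (forall i, i \in r -> atmost N (fun x => P x /\ Q i x)) ->
  escapes (fun x => P x /\ forall i, i \in r -> ~ Q i x).
Proof.
move=> hP hQ; apply: (escapes_or (N := size r * N) hP).
apply: atmost_sub (leqnn _) (atmost_bigor hQ) => x [px hn].
apply: contrapT => hx; apply: hn => i ir qi; apply: hx; exists i => //.
Qed.

Section Curves.
Variable R : realType.
Local Notation F := R[i].
Local Notation pt := (R[i] * R[i])%type.
Implicit Types (p q : pt) (o w c : 'rV[F]_4).

(* [C] is the union of the components [gs].  The bound [24 * D] covers pullbacks of a component
   along maps of degree at most 12; the bound 4 is where curves of degree at most four are excluded. *)
Record good_curve (C : set pt) (gs : seq {mpoly F[2]}) (D N : nat) : Prop := GoodCurve {
  good_mem : forall p, C p <-> exists2 g, g \in gs & eval2 g p = 0;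
  good_pos : (0 < D)%N;
  good_size : (size gs <= D)%N;
  good_msize : forall g, g \in gs -> (msize g <= D)%N;
  good_escapes : forall g, g \in gs -> escapes (fun p => eval2 g p = 0);
  good_vanish : forall g phi, g \in gs -> polyfun (24 * D) phi ->
    (forall p, eval2 g p = 0 -> phi p = 0) \/ atmost N (fun p => eval2 g p = 0 /\ phi p = 0);
  good_low : forall phi, polyfun 4 phi ->
    (forall p, phi p = 0) \/ atmost N (fun p => C p /\ phi p = 0) }.

Lemma good_curve_exists (d : nat) : exists D N, forall C, curve_of_degree C d ->
  no_small_curve C -> exists gs, good_curve C gs D N.
Proof.
pose D := d.+1; exists D, ((2 * (24 * D).+1 * (24 * D).+1) ^ 2)%N => C [d0 [f eC sf] _] nC.
have f1 : (1 < msize f)%N by rewrite sf.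
have f0 : f != 0 by apply: msize_gt0_neq0; apply: ltnW.
have [gs [ss ig zg]] := irreducible2_factors f1; exists gs; split => //.
- by move=> p; rewrite eC; exact: zg.
- by move: ss; rewrite sf => /ltnW.
- by move=> g /ig [_]; rewrite sf.
- by move=> g /ig [[g1 _] _]; exact: nonconstant_escapes.
- move=> g phi /ig [gi gm] hphi; apply: irreducible2_polyfun => //.
  by apply: leq_trans gm _; rewrite sf /D; lia.
- move=> phi hphi; apply: low_degree_section eC nC f0 _ _ hphi.
    by rewrite sf /D; lia.
  by rewrite /D; lia.
Qed.

Definition vpolyfun (e : nat) (W : pt -> 'rV[F]_4) := forall i, polyfun e (fun p => W p 0 i).

Lemma vpolyfun_par : vpolyfun 2 (@par F).
Proof.
apply: forall_ord4.
- by apply: (@polyfun_ext _ 2 (fun=> 1)) => [p|]; [rewrite mxE|exact: polyfunC].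
- by apply: (@polyfun_ext _ 2 (fun p => p.1)) => [p|]; [rewrite mxE|exact: polyfun1].
- by apply: (@polyfun_ext _ 2 (fun p => p.2)) => [p|]; [rewrite mxE|exact: polyfun2].
apply: (@polyfun_ext _ 2 (fun p => p.1 ^+ 2 + p.2 ^+ 2)) => [p|]; first by rewrite mxE.
by apply: polyfunD; [exact: (polyfunX 2 (polyfun1 R 0))|exact: (polyfunX 2 (polyfun2 R 0))].
Qed.

Lemma vpolyfun_mulmx e W (A : 'M[F]_4) : vpolyfun e W -> vpolyfun e (fun p => W p *m A).
Proof.
move=> h i; apply: (@polyfun_ext _ e (fun p => \sum_j A j i * W p 0 j)) => [p|].
  by rewrite mxE; apply: eq_bigr => j _; rewrite mulrC.
by apply: polyfun_sum => j; exact: polyfunZ.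
Qed.

Lemma polyfun_dot e W c : vpolyfun e W -> polyfun e (fun p => dot c (W p)).
Proof. by move=> h; apply: polyfun_sum => j; exact: polyfunZ. Qed.

(** Denominators are cleared by the power [2 * D] of the homogeneous coordinate [j0], as the
    exponents of both variables in [g] are below [D]. *)
Lemma polyfun_pullback (D e : nat) (g : {mpoly F[2]}) W : (msize g <= D)%N -> vpolyfun e W ->
  exists2 psi, polyfun (e * (2 * D)) psi & forall p, W p 0 j0 != 0 ->
    (psi p = 0 <-> eval2 g (projp (W p)) = 0).
Proof.
move=> gD hW; exists (fun p => \sum_(i < D) \sum_(j < D) coef2 g i j *
    (W p 0 j1 ^+ i * W p 0 j2 ^+ j * W p 0 j0 ^+ (2 * D - i - j))).
  apply: polyfun_sum => i; apply: polyfun_sum => j; apply: polyfunZ.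
  have -> : (e * (2 * D) = e * i + e * j + e * (2 * D - i - j))%N.
    by rewrite -!mulnDr; congr muln; have := ltn_ord i; have := ltn_ord j; lia.
  by apply: polyfunM; [apply: polyfunM|]; apply: polyfunX.
move=> p w0; set S := (X in X = 0 <-> _).
suff -> : S = W p 0 j0 ^+ (2 * D) * eval2 g (projp (W p)).
  split=> [/eqP|->]; last by rewrite mulr0.
  by rewrite mulf_eq0 expf_eq0 (negPf w0) andbF /= => /eqP.
rewrite (eval2_bipoly _ gD) /bipoly mulr_sumr; apply: eq_bigr => i _.
rewrite mulr_sumr; apply: eq_bigr => j _; rewrite /projp /= !expr_div_n.
have -> : W p 0 j0 ^+ (2 * D) = W p 0 j0 ^+ i * W p 0 j0 ^+ j * W p 0 j0 ^+ (2 * D - i - j).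
  by rewrite -!exprD; congr (_ ^+ _); have := ltn_ord i; have := ltn_ord j; lia.
by field; rewrite !expf_neq0.
Qed.

Lemma par_dot_neq0 c : (forall p, dot c (par p) = 0) -> c = 0.
Proof.
move=> h; have e x y : c 0 j0 + c 0 j1 * x + c 0 j2 * y + c 0 j3 * (x ^+ 2 + y ^+ 2) = 0.
  by rewrite -(h (x, y)) dotE !mxE /=; ring.
have n2 : (2 : F) != 0 by rewrite pnatr_eq0.
have h0 : c 0 j0 = 0 by rewrite -(e 0 0); ring.
have h3 : c 0 j3 = 0.
  have s : 2 * c 0 j3 = (c 0 j0 + c 0 j1 * 1 + c 0 j2 * 0 + c 0 j3 * (1 ^+ 2 + 0 ^+ 2)) +
      (c 0 j0 + c 0 j1 * (- 1) + c 0 j2 * 0 + c 0 j3 * ((- 1) ^+ 2 + 0 ^+ 2)) by rewrite h0; ring.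
  by apply: (mulfI n2); rewrite s !e mulr0 addr0.
have h1 : c 0 j1 = 0 by rewrite -(e 1 0) h0 h3; ring.
have h2 : c 0 j2 = 0 by rewrite -(e 0 1) h0 h3; ring.
by apply: row4P; rewrite mxE.
Qed.

Section Good.
Variables (C : set pt) (gs : seq {mpoly F[2]}) (D N : nat).
Hypothesis gC : good_curve C gs D N.

Lemma good_sub g p : g \in gs -> eval2 g p = 0 -> C p.
Proof. by move=> gg e; apply/(good_mem gC); exists g. Qed.

(** Read in the plane, the condition is a polynomial of degree at most two, not identically zero
    since [1], [x], [y], [x ^+ 2 + y ^+ 2] are independent; so [good_low] applies. *)
Lemma plane_section c : c != 0 -> atmost N (fun p => C p /\ dot c (par p) = 0).
Proof.
move=> c0; have hp : polyfun 4 (fun p => dot c (par p)).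
  by apply: polyfun_mono (polyfun_dot c vpolyfun_par).
case: (good_low gC hp) => // h; case/eqP: c0; exact: par_dot_neq0.
Qed.

Lemma pull e W g g' : (e <= 12)%N -> vpolyfun e W -> g \in gs -> g' \in gs ->
  (forall p, eval2 g p = 0 -> W p 0 j0 != 0 -> eval2 g' (projp (W p)) = 0) \/
  atmost N (fun p => [/\ eval2 g p = 0, W p 0 j0 != 0 & eval2 g' (projp (W p)) = 0]).
Proof.
move=> e12 hW gg gg'; have [psi hpsi hz] := polyfun_pullback (good_msize gC gg') hW.
have hp : polyfun (24 * D) psi by apply: polyfun_mono hpsi; nia.
have [h|h] := good_vanish gC gg hp.
  by left => p /h e0 w0; apply/(hz p w0).
by right; apply: atmost_sub (leqnn _) h => p [e0 w0 /(hz p w0)].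
Qed.

(** The points that an invertible [A] sends to infinity, where the coordinate [j0] vanishes, form a
    plane section. *)
Lemma unit_section g (A B : 'M[F]_4) : g \in gs -> A *m B = 1%:M ->
  atmost N (fun p => eval2 g p = 0 /\ (par p *m A) 0 j0 = 0).
Proof.
move=> gg AB; have n0 : delta_mx (0 : 'I_1) j0 *m A^T != 0.
  apply/eqP => z; have := congr1 (fun M => (M *m B^T) 0 j0) z.
  rewrite -mulmxA -trmx_mul (mulmx1C AB) trmx1 mulmx1 mul0mx !mxE !eqxx => /eqP.
  by rewrite oner_eq0.
apply: atmost_sub (leqnn _) (plane_section n0) => p [/(good_sub gg) Cp].
by rewrite coord_dot dot_mulmx.
Qed.

(* The reflection in [o] fixes the quadric and exchanges the two points on each line through [o]; it
   maps infinitely many points of [C] to points of [C] only if it maps a component to a component. *)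
Definition center_type o (g g' : {mpoly F[2]}) := forall p, eval2 g p = 0 ->
  (par p *m refl o) 0 j0 != 0 -> eval2 g' (projp (par p *m refl o)) = 0.

Definition center o := bf o o = 1 /\ exists g g', [/\ g \in gs, g' \in gs & center_type o g g'].

Lemma vpolyfun_refl o : vpolyfun 2 (fun p => par p *m refl o).
Proof. exact/vpolyfun_mulmx/vpolyfun_par. Qed.

(** The reflection determines [q] from [p], so it is enough to count [p]. Each pair of components
    contributes at most [N] points, as the other alternative of [pull] would make [o] a centre. *)
Lemma not_center_atmost o : bf o o = 1 -> ~ center o ->
  atmost (D * D * N) (fun pq : pt * pt => [/\ C pq.1, C pq.2 & on_line o pq.1 pq.2]).
Proof.
move=> o1 nc; apply: (@atmost_inj _ _ _ (fun p => C p /\ exists2 q, C q & on_line o p q) fst).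
- move=> [p q] [p' q'] /= [_ _ /(on_line_refl o1) [x x0 e]] [_ _ /(on_line_refl o1) [y y0 e']] ep.
  move: e'; rewrite -ep e => /esym e'; congr (_, _).
  by apply/esym; apply: (@par_inj _ (y^-1 * x)); rewrite -scalerA -e' scalerA mulVf ?scale1r.
- by move=> [p q] /= [Cp Cq h]; split => //; exists q.
pose G := [seq (g, g') | g <- gs, g' <- gs].
have sG : (size G * N <= D * D * N)%N.
  by rewrite leq_mul2r size_allpairs leq_mul ?orbT ?(good_size gC).
apply: (@atmost_sub _ _ (fun p => exists2 gg, gg \in G &
    [/\ eval2 gg.1 p = 0, (par p *m refl o) 0 j0 != 0 & eval2 gg.2 (projp (par p *m refl o)) = 0])
    (size G * N) _ _ sG).
  move=> p [/(good_mem gC) [g gg e] [q /(good_mem gC) [g' gg' e'] /(on_line_refl o1) [x x0 er]]].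
  exists (g, g'); first by apply/allpairsP; exists (g, g').
  by rewrite er proj_par // mxE mxE mulr1.
apply: atmost_bigor => -[g g'] /allpairsP [[h h'] [/= gg gg' [-> ->]]].
have [ht|//] := pull (isT : (2 <= 12)%N) (vpolyfun_refl o) gg gg'.
by exfalso; apply: nc; split => //; exists h, h'.
Qed.

Lemma isotropic_refl o w : bf o o = 1 -> bf w w = 0 -> bf (w *m refl o) (w *m refl o) = 0.
Proof. by move=> o1 h; rewrite bf_refl. Qed.

(** The images of the points of [g] are infinitely many points of [g'] that the reflection sends
    back to [g], so the finite alternative of [pull] fails. *)
Lemma center_type_sym o g g' : bf o o = 1 -> g \in gs -> g' \in gs ->
  center_type o g g' -> center_type o g' g.
Proof.
move=> o1 gg gg' ht; have [//|hN] := pull (isT : (2 <= 12)%N) (vpolyfun_refl o) gg' gg.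
exfalso; apply: escapes_not_atmost hN => s.
have [|p ps [ep np]] := escapes_or (good_escapes gC gg) (Q := fun p => (par p *m refl o) 0 j0 != 0)
    (N := N) _ (map (fun q => projp (par q *m refl o)) s).
  apply: atmost_sub (leqnn _) (unit_section gg (reflK o1)) => p [e /negP].
  by rewrite negbK => /eqP.
have ip : bf (par p *m refl o) (par p *m refl o) = 0 by apply: isotropic_refl; rewrite ?bf_par_self.
have := par_proj ip np; set x := (par p *m refl o) 0 j0; set q := projp _ => e1.
have eq : par q = x^-1 *: (par p *m refl o) by rewrite e1 scalerA mulVf ?scale1r.
have e2 : par q *m refl o = x^-1 *: par p by rewrite eq -scalemxAl -mulmxA (reflK o1) mulmx1.
exists q.
  apply: contraNN ps => qs; apply/mapP; exists q => //.
  by rewrite e2 proj_par ?invr_eq0.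
split; first exact: ht.
  by rewrite e2 mxE mxE mulr1 invr_eq0.
by rewrite e2 proj_par ?invr_eq0.
Qed.

End Good.
End Curves.

(** * Compositions of two reflections and the number of centres *)

Section Centers.
Variable R : realType.
Local Notation F := R[i].
Local Notation pt := (R[i] * R[i])%type.
Implicit Types (p q : pt) (o w c : 'rV[F]_4).

Lemma mulmx_expS (w : 'rV[F]_4) (A : 'M[F]_4) k : w *m A ^+ k.+1 = w *m A ^+ k *m A.
Proof. by rewrite exprSr -mulmxA. Qed.

Lemma pow_refl2_span o o' k w : exists x y,
  w *m (refl o' *m refl o) ^+ k = w + x *: o + y *: o'.
Proof.
elim: k => [|k [x [y e]]]; first by exists 0, 0; rewrite expr0 mulmx1 !scale0r !addr0.
rewrite mulmx_expS e mulmxA !reflE.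
set a := 2 * bf _ o'; set b := 2 * bf _ o.
by exists (x - b), (y - a); apply: row4P; rewrite !mxE; ring.
Qed.

Lemma pow_inv (A B : 'M[F]_4) k : A *m B = 1%:M -> A ^+ k *m B ^+ k = 1%:M.
Proof.
move=> AB; elim: k => [|k IH]; first by rewrite !expr0 mulmx1.
by rewrite exprSr exprS -[_ * A]/(_ *m A) -[B * _]/(B *m _) mulmxA -[_ *m A *m B]mulmxA AB mulmx1.
Qed.

Lemma eigen_pow (w : 'rV[F]_4) (A : 'M[F]_4) x k : w *m A = x *: w -> w *m A ^+ k = x ^+ k *: w.
Proof.
move=> e; elim: k => [|k IH]; first by rewrite !expr0 mulmx1 scale1r.
by rewrite mulmx_expS IH -scalemxAl e scalerA exprSr.
Qed.

Section Good.
Variables (C : set pt) (gs : seq {mpoly F[2]}) (D N : nat).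
Hypothesis gC : good_curve C gs D N.

Lemma refl_step o g g' w (r : pt) x : bf o o = 1 -> center_type o g g' ->
  eval2 g r = 0 -> x != 0 -> w = x *: par r -> (w *m refl o) 0 j0 != 0 ->
  exists s y, [/\ eval2 g' s = 0, y != 0 & w *m refl o = y *: par s].
Proof.
move=> o1 h er x0 ew; have e : w *m refl o = x *: (par r *m refl o) by rewrite ew -scalemxAl.
rewrite e mxE mulf_eq0 negb_or => /andP[_ n1].
have iu : bf (par r *m refl o) (par r *m refl o) = 0 by rewrite bf_refl // bf_par_self.
have eu := par_proj iu n1; have zs := h r er n1.
exists (projp (par r *m refl o)), (x * (par r *m refl o) 0 j0); split; first exact: zs.
  by rewrite mulf_neq0.
by rewrite -scalerA -eu.
Qed.

(** The plane spanned by a general point of [g], [o] and [o'] contains the first [N.+1] terms of the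
    orbit, all on [C], so two of them coincide and a power with exponent at most [N] fixes the point
    projectively. The factorial is a common multiple of these exponents. *)
Lemma refl2_order o o' g g' : g \in gs -> g' \in gs -> bf o o = 1 -> bf o' o' = 1 ->
  center_type o g g' -> center_type o' g g' -> (refl o' *m refl o) ^+ (N`!) = 1%:M.
Proof.
move=> gg gg' o1 o1' ho ho'; have hs := center_type_sym gC o1 gg gg' ho.
set M := refl o' *m refl o; set M' := refl o *m refl o'.
have MM : M *m M' = 1%:M by exact: refl2_inv.
have [n n0 [no no']] := annihilator2 o o'.
(* Excluded are the points whose orbit meets infinity, after either reflection, and those on the
   plane [n] through [o] and [o']. *)
pose Q (k : nat + nat + unit) p := match k with
  | inl (inl k) => (par p *m M ^+ k) 0 j0 = 0
  | inl (inr k) => (par p *m (M ^+ k *m refl o')) 0 j0 = 0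
  | inr _ => dot n (par p) = 0 end.
pose ks : seq (nat + nat + unit) := inr tt :: [seq inl (inl k) | k <- iota 0 N.+1] ++ [seq inl (inr k) | k <- iota 0 N.+1].
have hQ : escapes (fun p => eval2 g p = 0 /\ forall k, k \in ks -> ~ Q k p).
  apply: (@escapes_all _ _ _ _ _ N); first exact: good_escapes gC _ gg.
  move=> [[k|k]|[]] _.
  - by apply: atmost_sub (leqnn _) (unit_section gC gg (pow_inv k MM)) => p [].
  - have e : M ^+ k *m refl o' *m (refl o' *m M' ^+ k) = 1%:M.
      by rewrite mulmxA -(mulmxA (M ^+ k)) reflK // mulmx1 pow_inv.
    by apply: atmost_sub (leqnn _) (unit_section gC gg e) => p [].
  - by apply: atmost_sub (leqnn _) (plane_section gC n0) => p [/(good_sub gC gg)].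
have hfix : escapes (fun p => eval2 g p = 0 /\ par p *m M ^+ (N`!) = par p).
  move=> s; have [p ps [ep hp]] := hQ s; exists p => //; split => //.
  have n1 k : (k <= N)%N -> (par p *m M ^+ k) 0 j0 != 0.
    move=> kN; apply/eqP; apply: (hp (inl (inl k))); rewrite inE mem_cat.
    by rewrite map_f // mem_iota add0n ltnS.
  have n2 k : (k <= N)%N -> (par p *m M ^+ k *m refl o') 0 j0 != 0.
    move=> kN; apply/eqP; rewrite -mulmxA; apply: (hp (inl (inr k))); rewrite inE mem_cat.
    by apply/orP; right; apply/orP; right; rewrite map_f // mem_iota add0n ltnS.
  (* [refl o'] takes [g] to [g'] and [refl o] takes [g'] back to [g], so the orbit stays on [g]. *)
  have orb k : (k <= N)%N -> exists r y, [/\ eval2 g r = 0, y != 0 & par p *m M ^+ k = y *: par r].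
    elim: k => [|k IH] kN; first by exists p, 1; rewrite oner_eq0 expr0 mulmx1 scale1r.
    have [r [y [er y0 ey]]] := IH (ltnW kN); rewrite mulmx_expS /M mulmxA -/M.
    have [q [a [eq a0 ea]]] := refl_step o1' ho' er y0 ey (n2 k (ltnW kN)).
    apply: (refl_step o1 hs eq a0 ea).
    by have := n1 _ kN; rewrite mulmx_expS /M mulmxA.
  have [c c0 [cp co co']] := annihilator3 (par p) o o'.
  have cM k : dot c (par p *m M ^+ k) = 0.
    by have [x [y ->]] := pow_refl2_span o o' k (par p); rewrite !dotDr !dotZr cp co co' !mulr0 !addr0.
  pose rs := [seq projp (par p *m M ^+ k) | k <- iota 0 N.+1].
  have /uniqPn : ~~ uniq rs.
    apply/negP => ur; have : (size rs <= N)%N.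
      apply: (plane_section gC c0 ur) => t tr; have := tr.
      move=> /mapP [k]; rewrite mem_iota add0n ltnS => /andP[_ kN] ->.
      have [r [y [er y0 ey]]] := orb k kN; rewrite ey proj_par //; split.
        exact: good_sub gC _ _ gg er.
      by apply: (mulfI y0); rewrite mulr0 -dotZr -ey.
    by rewrite size_map size_iota ltnn.
  move=> /(_ (0, 0)) [a [b [ab bN]]]; rewrite size_map size_iota in bN.
  have aN := ltn_trans ab bN.
  rewrite !(nth_map 0%N) ?size_iota // !nth_iota // !add0n => eab.
  rewrite ltnS in bN; rewrite ltnS in aN.
  have [r [y [er y0 ey]]] := orb a aN; have [r' [y' [er' y0' ey']]] := orb b bN.
  move: eab; rewrite ey ey' !proj_par // => err; rewrite -err in ey'.
  pose x := y' / y.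
  have ex : par p *m M ^+ (b - a) = x *: par p.
    have : (par p *m M ^+ (b - a) - x *: par p) *m M ^+ a = 0.
      rewrite mulmxBl -mulmxA -[_ *m M ^+ a]/(_ * _) -exprD subnK ?(ltnW ab) // ey' -scalemxAl ey scalerA.
      by rewrite /x divfK // subrr.
    move=> /(congr1 (fun A => A *m M' ^+ a)); rewrite -mulmxA pow_inv // mulmx1 mul0mx => /eqP.
    by rewrite subr_eq0 => /eqP.
  have dvd : (b - a %| N`!)%N.
    by apply: dvdn_fact; rewrite subn_gt0 ab (leq_trans (leq_subr _ _)).
  have ez : par p *m M ^+ (N`!) = (x ^+ (N`! %/ (b - a))) *: par p.
    by rewrite -{1}(divnK dvd) mulnC exprM; exact: eigen_pow.
  move: ez; set z := x ^+ _ => ez; rewrite ez.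
  (* The factor [z] is 1: the image differs from [par p] by a combination of [o] and [o'], which [n]
     annihilates, while [n] does not annihilate [par p]. *)
  have [u [v euv]] := pow_refl2_span o o' (N`!) (par p).
  have : (z - 1) * dot n (par p) = 0.
    rewrite mulrBl mul1r -dotZr -ez euv !dotDr !dotZr no no' !mulr0 !addr0 subrr //.
  move=> /eqP; rewrite mulf_eq0 => /orP[|/eqP]; last by move/(hp (inr tt) (mem_head _ _)).
  by rewrite subr_eq0 => /eqP ->; rewrite scale1r.
(* A nonzero column of [A] would be a plane containing the infinitely many fixed points of [C]. *)
apply/eqP; rewrite -subr_eq0; apply/eqP; set A := (_ - _).
apply: contrapT => /eqP An0.
have [j hj] : exists j, col j A != 0.
  apply: contrapT => hn; move/eqP: An0; apply; apply/matrixP => i j.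
  have : col j A = 0 by apply: contrapT => /eqP hc; apply: hn; exists j.
  by move/matrixP => /(_ i 0); rewrite !mxE.
have c0 : (col j A)^T != 0 by rewrite trmx_eq0.
apply: (escapes_not_atmost hfix (N := N)).
apply: atmost_sub (leqnn _) (plane_section gC c0) => p [/(good_sub gC gg) Cp e]; split => //.
have : (par p *m A) 0 j = 0 by rewrite mulmxBr e mulmx1 subrr mxE.
by rewrite mxE => <-; apply: eq_bigr => k _; rewrite !mxE mulrC.
Qed.

End Good.

(* With [z + z^-1 = 2 B(o, o')] the vector [o - z o'] is an eigenvector of the composite
   of the two reflections, for the eigenvalue [z^-2]. *)
Lemma refl2_eigen o o' z : bf o o = 1 -> bf o' o' = 1 -> z != 0 -> z + z^-1 = 2 * bf o o' ->
  (o - z *: o') *m (refl o' *m refl o) = z^-1 ^+ 2 *: (o - z *: o').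
Proof.
move=> o1 o1' z0 ez.
have e1 : (o - z *: o') *m refl o' = o - z^-1 *: o'.
  rewrite reflE !bfE o1' mulr1 mulrBr -ez -addrA -opprD -scalerDl; congr (o - _ *: o'); ring.
rewrite mulmxA e1 reflE !bfE o1 [bf o' o]bfC mulrBr mulr1 mulrCA -ez.
rewrite scalerBr scalerA addrAC -{1}[o]scale1r -scalerBl; congr (_ *: o - _ *: o'); field; exact: z0.
Qed.

(** The degenerate case of [refl2_eigen], with a unipotent composite: [o'] moves by multiples of
    [o - o'], so in characteristic zero a finite order forces [o = o']. *)
Lemma refl2_unipotent o o' k : bf o o = 1 -> bf o' o' = 1 -> bf o o' = 1 ->
  o' *m (refl o' *m refl o) ^+ k = o' + (2 *+ k) *: (o - o').
Proof.
move=> o1 o1' b1.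
have en : (o - o') *m (refl o' *m refl o) = o - o'.
  have n1 : (o - o') *m refl o' = o - o' by rewrite reflE !bfE o1' b1 subrr mulr0 scale0r subr0.
  by rewrite mulmxA n1 reflE !bfE o1 [bf o' o]bfC b1 subrr mulr0 scale0r subr0.
have eo : o' *m (refl o' *m refl o) = o' + 2 *: (o - o').
  have n1 : o' *m refl o' = - o' by rewrite reflE o1' mulr1; apply: row4P; rewrite !mxE; ring.
  rewrite mulmxA n1 reflE !bfE [bf o' o]bfC b1.
  by apply: row4P; rewrite !mxE; ring.
elim: k => [|k IH]; first by rewrite expr0 mulmx1 mulr0n scale0r addr0.
rewrite mulmx_expS IH mulmxDl eo -scalemxAl en -addrA -scalerDl; congr (_ + _ *: _).
by rewrite [RHS]mulrS.
Qed.

(** The eigenvalue of [refl2_eigen] is an [m]-th root of unity, hence [z ^+ (2 * m) = 1]. If the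
    eigenvector is zero, then [o = z *: o'] and already [z ^+ 2 = 1]. *)
Lemma refl2_gram (m : nat) o o' : (0 < m)%N -> bf o o = 1 -> bf o' o' = 1 ->
  (refl o' *m refl o) ^+ m = 1%:M ->
  (bf o o' = 1 -> o = o') /\ exists2 z, z ^+ (2 * m) = 1 & bf o o' = (z + z^-1) / 2.
Proof.
move=> m0 o1 o1' eM; have n2 : (2 : F) != 0 by rewrite pnatr_eq0.
split=> [b1|].
  have := refl2_unipotent m o1 o1' b1; rewrite eM mulmx1 => /esym /eqP.
  rewrite -subr_eq0 addrAC subrr add0r scaler_eq0 subr_eq0 => /orP[|/eqP //].
  by rewrite mulrn_eq0 (negPf n2) eqn0Ngt m0.
have [z ez] : exists z, z ^+ 2 - 2 * bf o o' * z + 1 = 0.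
  have [z hz] := solve_monicpoly (fun i => if i == 0%N then -1 else 2 * bf o o' : F) (isT : (0 < 2)%N).
  exists z; rewrite hz big_ord_recl big_ord1 /= expr0 expr1; ring.
have z0 : z != 0.
  by apply/eqP => h; move: ez; rewrite h expr0n mulr0 subrr add0r => /eqP; rewrite oner_eq0.
have eb : z + z^-1 = 2 * bf o o'.
  apply: (mulfI z0); have : z * (z + z^-1) = z ^+ 2 + 1 by field.
  by move=> ->; apply/eqP; rewrite -subr_eq0 -[X in _ == X]ez; apply/eqP; ring.
exists z; last by rewrite eb mulrC mulKf.
have e := refl2_eigen o1 o1' z0 eb.
have := eigen_pow m e; rewrite eM mulmx1 -exprM.
set u := o - _ => /eqP; rewrite -subr_eq0 -[X in X - _]scale1r -scalerBl scaler_eq0 subr_eq0 => /orP[/eqP e1|/eqP u0].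
  by rewrite -[LHS]mul1r {1}e1 exprVn mulVf // expf_neq0.
have zz : z ^+ 2 = 1.
  have eo : o = z *: o' by apply/eqP; rewrite -subr_eq0 -/u u0.
  by rewrite -o1 eo !bfE o1'; ring.
by rewrite exprM zz expr1n.
Qed.

(** An element of [s] is determined by its products with a maximal independent subset, of at most
    four vectors: if [o] and [o'] have the same products, then [bf o o' = bf o' o' = 1], since [o']
    is in the span, and so [o = o']. *)
Lemma gram_count (s : seq 'rV[F]_4) (L : seq F) : uniq s ->
  (forall o o', o \in s -> o' \in s -> bf o o' \in L /\ (bf o o' = 1 -> o = o')) ->
  (forall o, o \in s -> bf o o = 1) -> (size s <= (size L).+1 ^ 4)%N.
Proof.
move=> us hL h1; pose A := \matrix_(i < size s) (nth 0 s i).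
pose f := maxrankfun A; pose r := \rank A.
have rowA i : row i A = nth 0 s i by rewrite rowK.
have memA (i : 'I_(size s)) : row i A \in s by rewrite rowA mem_nth.
pose G o : {ffun 'I_r -> 'I_(size L).+1} := [ffun i => inord (index (bf o (row (f i) A)) L)].
have Gi : {in s &, injective G}.
  move=> o o' os os' eG.
  have eb i : bf o (row (f i) A) = bf o' (row (f i) A).
    have [m _] := hL o _ os (memA (f i)); have [m' _] := hL o' _ os' (memA (f i)).
    have := congr1 (fun g : {ffun 'I_r -> 'I_(size L).+1} => val (g i)) eG.
    rewrite !ffunE /= !inordK; try by rewrite ltnS ltnW // index_mem.
    by move=> /(congr1 (nth 0 L)); rewrite !nth_index.
  have sub : (o' <= rowsub f A)%MS.
    rewrite eq_maxrowsub; have il : (index o' s < size s)%N by rewrite index_mem.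
    by have := row_sub (Ordinal il) A; rewrite rowA /= nth_index.
  have /submxP [u eu] := sub.
  have lin v : bf v o' = \sum_i u 0 i * bf v (row (f i) A).
    have v0 : bf v 0 = 0 by rewrite /bf !mxE; ring.
    rewrite eu mulmx_sum_row (big_morph (bf v) (bfDr v) v0); apply: eq_bigr => i _.
    by rewrite bfZr row_rowsub.
  apply: (hL o o' os os').2; rewrite -[RHS](h1 o' os') !lin.
  by apply: eq_bigr => i _; rewrite eb.
have := @uniq_leq_size _ (map G s) (enum {ffun 'I_r -> 'I_(size L).+1}).
rewrite map_inj_in_uniq // size_map => /(_ us) h.
have {}h : (size s <= size (enum {ffun 'I_r -> 'I_(size L).+1}))%N by apply: h => x _; rewrite mem_enum.
apply: leq_trans h _; rewrite -cardE card_ffun !card_ord leq_pexp2l //.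
exact: rank_leq_col.
Qed.

Lemma roots_of_unity_list (n : nat) : (0 < n)%N ->
  exists rs : seq F, size rs = n /\ forall z, z ^+ n = 1 -> z \in rs.
Proof.
move=> n0; have [rs e] := closed_field_poly_normal ('X^n - 1 : {poly F}).
have m : ('X^n - 1 : {poly F}) \is monic by rewrite monicXnsubC.
move: e; rewrite (monicP m) scale1r => e; exists rs; split.
  by have := size_XnsubC (1 : F) n0; rewrite e size_prod_XsubC => -[].
move=> z hz; rewrite -root_prod_XsubC -e; apply/rootP; rewrite !hornerE hz subrr //.
Qed.

Lemma centers_atmost (C : set pt) gs D N : good_curve C gs D N ->
  atmost (D * D * (2 * N`!).+1 ^ 4) (center gs).
Proof.
move=> gC; pose G := [seq (g, g') | g <- gs, g' <- gs].
set B := ((2 * N`!).+1 ^ 4)%N.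
have sG : (size G * B <= D * D * B)%N.
  by rewrite leq_mul2r size_allpairs leq_mul ?orbT ?(good_size gC).
apply: (@atmost_sub _ _ (fun o => exists2 gg, gg \in G & bf o o = 1 /\ center_type o gg.1 gg.2)
    (size G * B) _ _ sG).
  by move=> o [o1 [g [g' [gg gg' h]]]]; exists (g, g') => //; apply/allpairsP; exists (g, g').
apply: atmost_bigor => -[_ _] /allpairsP [[g g'] [/= gg gg' [-> ->]]] s us hs.
have m0 : (0 < 2 * N`!)%N by rewrite muln_gt0 fact_gt0.
have [rs [srs hrs]] := roots_of_unity_list m0.
have := @gram_count s [seq (z + z^-1) / 2 | z <- rs] us; rewrite size_map srs; apply.
  move=> o o' /hs [o1 h] /hs [o1' h'].
  have eM := refl2_order gC gg gg' o1 o1' h h'.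
  have [hu [z z1 ez]] := refl2_gram (fact_gt0 N) o1 o1' eM.
  by split => //; apply/mapP; exists z => //; exact: hrs.
by move=> o /hs [].
Qed.
End Centers.

(** * Common partners *)

Section Lines.
Variable F : numClosedFieldType.
Local Notation pt := (F * F)%type.
Implicit Types (p q r s t : pt) (a b c n u v w o : 'rV[F]_4).

(** By [bf_par], the squared distance of [p] and [q] is not zero; over a closed field it can vanish
    for distinct points. *)
Definition sep p q := bf (par p) (par q) != 0.

Lemma sepC p q : sep p q = sep q p.
Proof. by rewrite /sep bfC. Qed.

Lemma sep_neq p q : sep p q -> p != q.
Proof. by apply: contraNneq => ->; rewrite bf_par_self. Qed.

(** The separations make any three of the four lifts independent, so the lines of [(p, q)] and
    [(s, t)] meet in a point off the quadric. They hold for distinct points of a circle by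
    [circle_sep]. *)
Definition concyc p q s t : Prop := [/\ sep p q, sep s t, sep p s &
  [/\ sep p t, sep q s, sep q t & d4 (par p) (par q) (par s) (par t) = 0]].

(** The Gram matrix of three isotropic vectors has zero diagonal, and its determinant is twice the
    product of the three mutual products. *)
Lemma indep3 q s t x y z : sep q s -> sep q t -> sep s t ->
  x *: par q + y *: par s + z *: par t = 0 -> [/\ x = 0, y = 0 & z = 0].
Proof.
rewrite /sep => qs qt st e.
have n2 : (2 : F) != 0 by rewrite pnatr_eq0.
have b0 u : bf 0 u = 0 by rewrite /bf !mxE; ring.
have eq : y * bf (par q) (par s) + z * bf (par q) (par t) = 0.
  by rewrite -(b0 (par q)) -e !bfE bf_par_self [bf (par s) _]bfC [bf (par t) _]bfC; ring.
have es : x * bf (par q) (par s) + z * bf (par s) (par t) = 0.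
  by rewrite -(b0 (par s)) -e !bfE bf_par_self [bf (par t) _]bfC; ring.
have et : x * bf (par q) (par t) + y * bf (par s) (par t) = 0.
  by rewrite -(b0 (par t)) -e !bfE bf_par_self; ring.
move: eq es et qs qt st; set A := bf (par q) _; set B := bf (par q) _; set G := bf (par s) _.
move=> eq es et A0 B0 G0.
have : 2 * (y * z * G) = 0.
  transitivity (y * (x * A + z * G) + z * (x * B + y * G) - x * (y * A + z * B)); first by ring.
  by rewrite eq es et; ring.
move/eqP; rewrite !mulf_eq0 (negPf n2) (negPf G0) orbF /= => /orP[/eqP y0|/eqP z0].
  move: et eq; rewrite y0 !mul0r add0r addr0 => /eqP; rewrite mulf_eq0 (negPf B0) orbF => /eqP ->.
  by move=> /eqP; rewrite mulf_eq0 (negPf B0) orbF => /eqP ->.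
move: es eq; rewrite z0 !mul0r !addr0 => /eqP; rewrite mulf_eq0 (negPf A0) orbF => /eqP ->.
by move=> /eqP; rewrite mulf_eq0 (negPf A0) orbF => /eqP ->.
Qed.

Lemma concyc_meet p q s t : concyc p q s t -> exists x y z e,
  [/\ x != 0, y != 0, z != 0 & e != 0] /\ x *: par p + y *: par q = z *: par s + e *: par t.
Proof.
move=> [pq st ps [pt qs qt /d4_dep [x0 [x1 [x2 [x3 [h e]]]]]]].
have all0 : [\/ x0 = 0, x1 = 0, x2 = 0 | x3 = 0] -> False.
  have fin : x0 = 0 -> x1 = 0 -> x2 = 0 -> x3 = 0 -> False.
    by move=> e0 e1 e2 e3; case: h => /eqP.
  case=> z; move: (e); rewrite z scale0r ?add0r ?addr0 => ez.
  - by have [] := indep3 qs qt st ez; exact: fin.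
  - by have [? ?] := indep3 ps pt st ez; exact: fin.
  - by have [? ? ?] := indep3 pq pt qt ez; exact: fin.
  - by have [? ? ?] := indep3 pq ps qs ez; exact: fin.
have nz (x : F) : (x = 0 -> False) -> x != 0 by move=> hx; apply/eqP.
exists x0, x1, (- x2), (- x3); split.
  rewrite !oppr_eq0; split; apply: nz => z; apply: all0; [exact: Or41|exact: Or42|exact: Or43|exact: Or44].
by apply/eqP; rewrite -subr_eq0 !scaleNr -opprD opprK addrA e.
Qed.

Definition span2 a b u := exists x y, u = x *: a + y *: b.

Lemma span2_dot n a b u : span2 a b u -> dot n a = 0 -> dot n b = 0 -> dot n u = 0.
Proof. by move=> [x [y ->]] ha hb; rewrite dotDr !dotZr ha hb !mulr0 addr0. Qed.

Lemma span2_exchange a b u v : span2 a b u -> span2 a b v -> u != 0 ->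
  (exists k, v = k *: u) \/ (span2 u v a /\ span2 u v b).
Proof.
move=> [x [y eu]] [x' [y' ev]] u0.
have [d0|d0] := eqVneq (x * y' - x' * y) 0; last first.
  right; split.
    exists (y' / (x * y' - x' * y)), (- y / (x * y' - x' * y)); rewrite eu ev.
    by apply: row4P; rewrite !mxE; field.
  exists (- x' / (x * y' - x' * y)), (x / (x * y' - x' * y)); rewrite eu ev.
  by apply: row4P; rewrite !mxE; field.
left; have e : x * y' = x' * y by apply/eqP; rewrite -subr_eq0 d0.
have [x0|x0] := eqVneq x 0.
  have y0 : y != 0 by apply: contraNneq u0 => y0; rewrite eu x0 y0 !scale0r addr0.
  exists (y' / y); rewrite eu ev scalerDr !scalerA divfK //; congr (_ *: _ + _).
  by move: e; rewrite x0 mul0r mulr0 => /esym /eqP; rewrite mulf_eq0 (negPf y0) orbF => /eqP.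
exists (x' / x); rewrite eu ev scalerDr !scalerA divfK //; congr (_ + _ *: _).
by rewrite mulrAC -e mulrC mulKf.
Qed.

Lemma isotropic_on_line p q r : sep p q -> on_line (par r) p q -> r = p \/ r = q.
Proof.
move=> pq [x [y e]]; have n2 : (2 : F) != 0 by rewrite pnatr_eq0.
have : 2 * (x * y * bf (par p) (par q)) = 0.
  have := bf_par_self r; rewrite {1}e {1}e !bfE !bf_par_self [bf (par q) _]bfC => h.
  by rewrite -[RHS]h; ring.
move/eqP; rewrite !mulf_eq0 (negPf n2) (negPf pq) orbF /= => /orP[/eqP x0|/eqP y0].
  by right; apply: (@par_inj _ y); rewrite e x0 scale0r add0r.
by left; apply: (@par_inj _ x); rewrite e y0 scale0r addr0.
Qed.

Lemma span2_trans u v a b w : span2 u v w -> span2 a b u -> span2 a b v -> span2 a b w.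
Proof.
move=> [x [y ->]] [x1 [y1 ->]] [x2 [y2 ->]].
by exists (x * x1 + y * x2), (x * y1 + y * y2); apply: row4P; rewrite !mxE; ring.
Qed.

Lemma sep_indep p q x y : sep p q -> x *: par p + y *: par q = 0 -> x = 0 /\ y = 0.
Proof.
move=> pq e; have b0 u : bf 0 u = 0 by rewrite /bf !mxE; ring.
have ep : y * bf (par p) (par q) = 0.
  by rewrite -(b0 (par p)) -e !bfE bf_par_self [bf (par q) _]bfC; ring.
have eq : x * bf (par p) (par q) = 0 by rewrite -(b0 (par q)) -e !bfE bf_par_self; ring.
by split; apply/eqP; [move/eqP: eq|move/eqP: ep]; rewrite mulf_eq0 (negPf pq) orbF.
Qed.

Lemma on_line_scale k u p q : k != 0 -> on_line (k *: u) p q -> on_line u p q.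
Proof.
move=> k0 [c [d e]]; exists (k^-1 * c), (k^-1 * d).
by rewrite -!scalerA -scalerDr -e scalerA mulVf // scale1r.
Qed.

Lemma bf_neq0 u : bf u u != 0 -> u != 0.
Proof. by apply: contraNneq => ->; rewrite /bf !mxE; apply/eqP; ring. Qed.

(** The line of [(p, q)] meets those of [(s, t)] and [(s', t')], which lie in the plane [n]: either
    in two points, and then it lies in [n] as well, or in one common point. *)
Lemma coplanar_meet p q s t s' t' n : concyc p q s t -> sep s' t' ->
  d4 (par p) (par q) (par s') (par t') = 0 ->
  dot n (par s) = 0 -> dot n (par t) = 0 -> dot n (par s') = 0 -> dot n (par t') = 0 ->
  (dot n (par p) = 0 /\ dot n (par q) = 0) \/
  exists u, [/\ bf u u != 0, on_line u p q, on_line u s t & on_line u s' t'].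
Proof.
move=> hc he /d4_dep [x0 [x1 [x2 [x3 [hx ex]]]]] ns nt ns' nt'.
have [pq _ _ _] := hc; have [x [y [z [f [[a0 b0 c0 f0] ez]]]]] := concyc_meet hc.
set u := x *: par p + y *: par q in ez.
have bu : bf u u != 0.
  have -> : bf u u = 2 * (x * y * bf (par p) (par q)).
    by rewrite /u !bfE !bf_par_self [bf (par q) _]bfC; ring.
  by rewrite !mulf_neq0 // pnatr_eq0.
pose u' := x0 *: par p + x1 *: par q.
have eu' : u' = (- x2) *: par s' + (- x3) *: par t'.
  by apply/eqP; rewrite -subr_eq0 !scaleNr -opprD opprK addrA ex.
have up : on_line u p q by exists x, y.
have us : on_line u s t by exists z, f.
have up' : on_line u' p q by exists x0, x1.
have us' : on_line u' s' t' by exists (- x2), (- x3).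
have u'0 : u' != 0.
  apply/eqP => z0; have [h0 h1] := sep_indep pq z0.
  move: eu'; rewrite z0 => /esym /(sep_indep he) [/eqP h2 /eqP h3].
  rewrite !oppr_eq0 in h2 h3.
  by case: hx; rewrite ?h0 ?h1 ?(eqP h2) ?(eqP h3) eqxx.
have [[k ek]|[hp hq]] := span2_exchange up up' (bf_neq0 bu).
  right; exists u; split=> //; apply: (@on_line_scale k); last by rewrite -ek.
  by apply: contraNneq u'0 => z0; rewrite ek z0 scale0r.
left; have nu := span2_dot us ns nt; have nu' := span2_dot us' ns' nt'.
by split; [exact: span2_dot hp nu nu'|exact: span2_dot hq nu nu'].
Qed.

Lemma lines_meet_once p q s t u v : sep p q -> sep s t -> (s, t) <> (p, q) -> (s, t) <> (q, p) ->
  on_line u p q -> on_line u s t -> on_line v p q -> on_line v s t -> u != 0 ->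
  exists k, v = k *: u.
Proof.
move=> pq st n1 n2 up us vp vs u0; have [//|[hs ht]] := span2_exchange us vs u0.
exfalso; have ls : on_line (par s) p q by apply: span2_trans hs up vp.
have lt : on_line (par t) p q by apply: span2_trans ht up vp.
have := sep_neq st.
by case: (isotropic_on_line pq ls) (isotropic_on_line pq lt) => [es|es] [et|et];
  rewrite ?es ?et ?eqxx // => _; [apply: n1|apply: n2]; rewrite es et.
Qed.

Lemma plane_of p s t : sep p s -> sep p t -> sep s t -> exists2 n, n != 0 &
  [/\ dot n (par p) = 0, dot n (par s) = 0, dot n (par t) = 0 &
    forall w, d4 (par p) (par s) (par t) w = 0 -> dot n w = 0].
Proof.
move=> ps pt st; have [n n0 [np ns nt]] := annihilator3 (par p) (par s) (par t).
exists n => //; split => // w /d4_dep [x0 [x1 [x2 [x3 [h e]]]]].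
have x30 : x3 != 0.
  apply/eqP => z; move: e; rewrite z scale0r addr0 => /(indep3 ps pt st) [z0 z1 z2].
  by move: h; rewrite z z0 z1 z2 eqxx => -[].
apply: (mulfI x30); rewrite mulr0 -dotZr.
have -> : x3 *: w = - (x0 *: par p + x1 *: par s + x2 *: par t).
  by apply/eqP; rewrite -addr_eq0 addrC e.
by rewrite -scaleN1r dotZr !dotDr !dotZr np ns nt !mulr0 !addr0 mulr0.
Qed.

Lemma d4_comb4 x y a b c u v :
  d4 a b c (x *: u + y *: v) = x * d4 a b c u + y * d4 a b c v.
Proof. by rewrite !(d4_swap03 a) d4_comb1; ring. Qed.

Lemma d4_comb2 x y a b c u v :
  d4 a (x *: u + y *: v) b c = x * d4 a u b c + y * d4 a v b c.
Proof. by rewrite !(d4_swap01 a) d4_comb1; ring. Qed.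

(* The transversal through [w] of the lines [s t] and [s' t'] meets the latter in [trans_pt w];
   [trans_end w] is the second point of that transversal on the quadric [bf w w = 0]. *)
Definition trans_pt s t s' t' w :=
  d4 w (par s) (par t) (par s') *: par t' - d4 w (par s) (par t) (par t') *: par s'.

Definition trans_end s t s' t' w :=
  bf (trans_pt s t s' t' w) (trans_pt s t s' t' w) *: w
  - (2 * bf w (trans_pt s t s' t' w)) *: trans_pt s t s' t' w.

Lemma trans_pt_line s t s' t' w : on_line (trans_pt s t s' t' w) s' t'.
Proof.
by exists (- d4 w (par s) (par t) (par t')), (d4 w (par s) (par t) (par s')); rewrite addrC scaleNr.
Qed.

Lemma projp_eq u v : u 0 j0 != 0 -> v 0 j0 != 0 -> projp u = projp v <->
  (u 0 j0 * v 0 j1 - u 0 j1 * v 0 j0 = 0 /\ u 0 j0 * v 0 j2 - u 0 j2 * v 0 j0 = 0).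
Proof.
rewrite /projp => u0 v0; split=> [[h1 h2]|[/eqP h1 /eqP h2]].
  by split; [rewrite -[u 0 j1](divfK u0) h1; field|rewrite -[u 0 j2](divfK u0) h2; field].
rewrite !subr_eq0 in h1 h2; congr (_, _); apply/eqP; rewrite eqr_div //.
  by rewrite -(eqP h1) mulrC.
by rewrite -(eqP h2) mulrC.
Qed.

Lemma trans_pt_coplanar s t s' t' w : d4 w (par s) (par t) (trans_pt s t s' t' w) = 0.
Proof.
rewrite /trans_pt -scaleNr d4_comb4; move: (d4 _ _ _ (par s')) (d4 _ _ _ (par t')) => x y; ring.
Qed.

Lemma trans_end_isotropic s t s' t' p :
  bf (trans_end s t s' t' (par p)) (trans_end s t s' t' (par p)) = 0.
Proof.
rewrite /trans_end; move: (trans_pt _ _ _ _ _) => v.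
by rewrite !bfE bf_par_self [bf v (par p)]bfC; ring.
Qed.

Lemma trans_pt_concyc p q s t s' t' : concyc p q s t -> concyc p q s' t' ->
  d4 (par s) (par t) (par s') (par t') != 0 ->
  exists x y, [/\ x != 0, y != 0 & trans_pt s t s' t' (par p) = x *: par p + y *: par q].
Proof.
move=> [pq st ps [pt qs qt d0]] /concyc_meet [x [y [z [e [[x0 y0 z0 e0] ez]]]]] sk.
have [n n0 [np nq ns nt]] := (d4_form _ _ _ _).1 d0.
have dz : d4 (par p) (par s) (par t) (z *: par s' + e *: par t') = 0.
  by apply/d4_form; exists n => //; split => //; rewrite -ez dotDr !dotZr np nq !mulr0 addr0.
move: dz; rewrite d4_comb4 /trans_pt; set A := d4 _ _ _ (par s'); set B := d4 _ _ _ (par t') => dz.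
have A0 : A != 0.
  apply/eqP => zA; have zB : B = 0.
    by apply: (mulfI e0); move: dz; rewrite zA !mulr0 add0r.
  have [m m0 [mp ms mt hm]] := plane_of ps pt st.
  by move/eqP: sk; apply; apply/d4_form; exists m => //; split => //; exact: hm.
exists (A / e * x), (A / e * y); rewrite !mulf_neq0 ?invr_eq0 //; split => //.
have -> : (A / e * x) *: par p + (A / e * y) *: par q = (A / e) *: (z *: par s' + e *: par t').
  by rewrite -ez scalerDr !scalerA.
have eB : B = - (z * A) / e.
  by apply: (mulfI e0); rewrite [RHS]mulrC divfK //; apply/eqP; rewrite -addr_eq0 addrC dz.
by rewrite eB; apply: row4P; rewrite !mxE; field.
Qed.

(** For skew lines the transversal through [par p] is unique, so it is the line through [par p] and
    [par q], whose second point on the quadric is [par q]. *)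
Lemma trans_end_concyc p q s t s' t' : concyc p q s t -> concyc p q s' t' ->
  d4 (par s) (par t) (par s') (par t') != 0 ->
  exists2 k, k != 0 & trans_end s t s' t' (par p) = k *: par q.
Proof.
move=> h h' sk; have [x [y [x0 y0 e]]] := trans_pt_concyc h h' sk.
have n2 : (2 : F) != 0 by rewrite pnatr_eq0.
have pq : sep p q by case: h.
exists (- (2 * y * y * bf (par p) (par q))); first by rewrite oppr_eq0 !mulf_neq0.
rewrite /trans_end e !bfE !bf_par_self [bf (par q) _]bfC.
by apply: row4P; rewrite !mxE; ring.
Qed.

Lemma trans_end_coplanar p q s t s' t' k : k != 0 -> trans_end s t s' t' (par p) = k *: par q ->
  d4 (par p) (par q) (par s') (par t') = 0.
Proof.
move=> k0 e; apply/d4_dep; have [x [y ev]] := trans_pt_line s t s' t' (par p).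
move: e; rewrite /trans_end; set v := trans_pt _ _ _ _ _ in ev *; set b := 2 * _; set c := bf v v => e.
exists c, (- k), (- (b * x)), (- (b * y)); split; first by apply: Or42; rewrite oppr_eq0.
by rewrite scaleNr -e ev; apply: row4P; rewrite !mxE; ring.
Qed.

Lemma poly5_eq0 (c0 c1 c2 c3 c4 : F) :
  (forall x, c0 + c1 * x + c2 * x ^+ 2 + c3 * x ^+ 3 + c4 * x ^+ 4 = 0) ->
  [/\ c0 = 0, c1 = 0, c2 = 0, c3 = 0 & c4 = 0].
Proof.
move=> h; have e : Poly [:: c0; c1; c2; c3; c4] = 0.
  apply/eqP; apply: contraT => /(poly_nonroot [::]) [x _].
  rewrite horner_Poly /= => /eqP; case; rewrite -[RHS](h x); ring.
have co i := congr1 (fun p : {poly F} => p`_i) e.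
by have := (co 0%N, co 1%N, co 2%N, co 3%N, co 4%N); rewrite !coef_Poly !coef0 /= => -[[[[-> ->] ->] ->] ->].
Qed.

(** Comparing coefficients on the two axes and evaluating at [(1, 1)] leaves only multiples of the
    equation of the paraboloid. *)
Lemma quadric_par (Q : 'I_4 -> 'I_4 -> F) :
  (forall p, \sum_i \sum_j Q i j * (par p 0 i * par p 0 j) = 0) ->
  exists k, forall w, \sum_i \sum_j Q i j * (w 0 i * w 0 j) = k * bf w w.
Proof.
move=> h; have n2 : (2 : F) != 0 by rewrite pnatr_eq0.
pose S i j := Q i j + Q j i.
have E w : \sum_i \sum_j Q i j * (w 0 i * w 0 j) =
    Q j0 j0 * w 0 j0 ^+ 2 + Q j1 j1 * w 0 j1 ^+ 2 + Q j2 j2 * w 0 j2 ^+ 2 + Q j3 j3 * w 0 j3 ^+ 2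
    + S j0 j1 * (w 0 j0 * w 0 j1) + S j0 j2 * (w 0 j0 * w 0 j2) + S j0 j3 * (w 0 j0 * w 0 j3)
    + S j1 j2 * (w 0 j1 * w 0 j2) + S j1 j3 * (w 0 j1 * w 0 j3) + S j2 j3 * (w 0 j2 * w 0 j3).
  by rewrite !sum4 /S; ring.
have {}h x y : Q j0 j0 + Q j1 j1 * x ^+ 2 + Q j2 j2 * y ^+ 2 + Q j3 j3 * (x ^+ 2 + y ^+ 2) ^+ 2
    + S j0 j1 * x + S j0 j2 * y + S j0 j3 * (x ^+ 2 + y ^+ 2)
    + S j1 j2 * (x * y) + S j1 j3 * (x * (x ^+ 2 + y ^+ 2)) + S j2 j3 * (y * (x ^+ 2 + y ^+ 2)) = 0.
  have := h (x, y); rewrite E; have [-> -> -> ->] := parE (x, y) => /= hh.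
  by rewrite -[RHS]hh; ring.
have [|z0 z01 z1 z13 z3] := @poly5_eq0 (Q j0 j0) (S j0 j1) (Q j1 j1 + S j0 j3) (S j1 j3) (Q j3 j3).
  by move=> x; rewrite -[RHS](h x 0); ring.
have [|_ z02 z2 z23 _] := @poly5_eq0 (Q j0 j0) (S j0 j2) (Q j2 j2 + S j0 j3) (S j2 j3) (Q j3 j3).
  by move=> x; rewrite -[RHS](h 0 x); ring.
have e1 : Q j1 j1 = - S j0 j3 by apply/eqP; rewrite -addr_eq0 z1.
have e2 : Q j2 j2 = - S j0 j3 by apply/eqP; rewrite -addr_eq0 z2.
have z12 : S j1 j2 = 0.
  by rewrite -[RHS](h 1 1) z0 z01 z13 z3 z02 z23 e1 e2; ring.
by exists (Q j1 j1) => w; rewrite E z0 z01 z13 z3 z02 z23 z12 e2 e1 /bf; field.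
Qed.

Lemma quadric2_par a b c n :
  (forall p, dot a (par p) * dot b (par p) - dot c (par p) * dot n (par p) = 0) ->
  exists k, forall w, dot a w * dot b w - dot c w * dot n w = k * bf w w.
Proof.
have E w : dot a w * dot b w - dot c w * dot n w =
    \sum_i \sum_j (a 0 i * b 0 j - c 0 i * n 0 j) * (w 0 i * w 0 j).
  rewrite /dot !big_distrlr /= -sumrB; apply: eq_bigr => i _; rewrite -sumrB.
  by apply: eq_bigr => j _; ring.
move=> h; have [|k hk] := @quadric_par (fun i j => a 0 i * b 0 j - c 0 i * n 0 j).
  by move=> p; rewrite -E.
by exists k => w; rewrite E.
Qed.

(** The right-hand side is a quadratic form in [w]: the transversals of three skew lines sweep out a
    quadric. *)
Lemma trans_quadric s t s1 t1 s2 t2 w : d4 w (trans_pt s t s1 t1 w) (par s2) (par t2) =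
  d4 w (par s) (par t) (par s1) * d4 w (par t1) (par s2) (par t2)
  - d4 w (par s) (par t) (par t1) * d4 w (par s1) (par s2) (par t2).
Proof. by rewrite /trans_pt -scaleNr d4_comb2; ring. Qed.

(** Otherwise the quadric of transversals would be [k * bf]. It contains the line of [s] and [t], on
    which [bf] does not vanish, so [k = 0]. The form then vanishes identically, which puts [s] and
    [t] in the plane of [s1], [s2], [t2], although [(s, t)] and [(s2, t2)] are skew. *)
Lemma no_common_quadric s t s1 t1 s2 t2 : sep s t -> sep s2 t2 ->
  d4 (par s) (par t) (par s1) (par t1) != 0 -> d4 (par s) (par t) (par s2) (par t2) != 0 ->
  d4 (par s1) (par t1) (par s2) (par t2) != 0 ->
  ~ forall p, d4 (par p) (trans_pt s t s1 t1 (par p)) (par s2) (par t2) = 0.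
Proof.
move=> st st2 k1 k2 k12 h.
have [|k hk] := @quadric2_par (cof (par s) (par t) (par s1)) (cof (par t1) (par s2) (par t2))
    (cof (par s) (par t) (par t1)) (cof (par s1) (par s2) (par t2)).
  by move=> p; rewrite -!d4E -trans_quadric.
have {}hk w : d4 w (trans_pt s t s1 t1 w) (par s2) (par t2) = k * bf w w.
  by rewrite trans_quadric !d4E hk.
have n2 : (2 : F) != 0 by rewrite pnatr_eq0.
have dl w : d4 w (par s) (par t) w = 0 by case: (d4_same w (par s) (par t)).
have z1 b : d4 (par s) (par s) (par t) b = 0 by case: (d4_same (par s) (par t) b).
have z2 b : d4 (par t) (par s) (par t) b = 0 by case: (d4_same (par t) (par s) b).
have sumE a b u v w : d4 (a + b) u v w = d4 a u v w + d4 b u v w.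
  by rewrite -[a]scale1r -[b]scale1r d4_comb1 !mul1r !scale1r.
have k0 : k = 0.
  have := hk (par s + par t); rewrite /trans_pt !sumE !z1 !z2 !addr0 !scale0r subr0.
  have z a : d4 a 0 (par s2) (par t2) = 0.
    apply/d4_dep; exists 0, 1, 0, 0; rewrite scaler0 !scale0r !addr0; split => //.
    by apply: Or42; rewrite oner_eq0.
  rewrite !z addr0.
  rewrite !bfE !bf_par_self [bf (par t) _]bfC => /esym e; apply/eqP.
  have : 2 * (k * bf (par s) (par t)) = 0 by rewrite -[RHS]e; ring.
  by move/eqP; rewrite !mulf_eq0 (negPf n2) (negPf st) orbF.
pose dd := d4 (par s1) (par s) (par t) (par t1).
have d0 : dd != 0.
  apply: contraNN k1 => /eqP /d4_form [m m0 [m1 m2 m3 m4]].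
  by apply/eqP/d4_form; exists m.
have hs a : (forall b, d4 a (par s) (par t) b = 0) -> d4 a (par s1) (par s2) (par t2) = 0.
  move=> za; have := hk (a + par s1); rewrite k0 mul0r trans_quadric !sumE !za dl !add0r mul0r sub0r.
  have -> : d4 (par s1) (par s1) (par s2) (par t2) = 0 by case: (d4_same (par s1) (par s2) (par t2)).
  by rewrite addr0 => /eqP; rewrite oppr_eq0 mulf_eq0 (negPf d0) => /eqP.
have [n n0 [ns1 ns2 nt2]] := annihilator3 (par s1) (par s2) (par t2).
have key a : d4 a (par s1) (par s2) (par t2) = 0 -> dot n a = 0.
  move=> /d4_dep [x0 [x1 [x2 [x3 [hx e]]]]].
  have [z|x00] := eqVneq x0 0.
    exfalso; move/eqP: k12; apply; apply/d4_dep; exists x1, 0, x2, x3; split.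
      case: hx => hx; [by rewrite z eqxx in hx|exact: Or41|exact: Or43|exact: Or44].
    by move: e; rewrite z !scale0r add0r addr0.
  apply: (mulfI x00); rewrite mulr0 -dotZr.
  have -> : x0 *: a = - (x1 *: par s1 + x2 *: par s2 + x3 *: par t2).
    by apply/eqP; rewrite -addr_eq0 !addrA e.
  by rewrite -scaleN1r dotZr !dotDr !dotZr ns1 ns2 nt2 !mulr0 !addr0 mulr0.
move/eqP: k2; apply; apply/d4_form; exists n => //.
by split => //; apply: key; apply: hs.
Qed.
End Lines.

Lemma atmost_pair (T U : eqType) (P : T -> Prop) (Q : U -> Prop) N M :
  atmost N P -> atmost M Q -> atmost (N * M) (fun x : T * U => P x.1 /\ Q x.2).
Proof.
move=> hP hQ s us hs; apply: (@leq_trans (size (undup (map fst s)) * M)%N).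
  apply: (@size_fibers_le _ _ _ _ fst); first by move=> x xs; rewrite mem_undup map_f.
  move=> u _; rewrite -size_filter -(size_map snd); apply: hQ.
    rewrite map_inj_in_uniq ?filter_uniq // => -[a b] [a' b'].
    by rewrite !mem_filter /= => /andP[/eqP -> _] /andP[/eqP -> _] ->.
  move=> y ys; have /mapP [x xs ->] := ys; move: xs.
  by rewrite mem_filter => /andP[_ /hs []].
rewrite leq_mul2r; apply/orP; right; apply: hP; first exact: undup_uniq.
by move=> x; rewrite mem_undup => xs; have /mapP [y /hs [h _] ->] := xs.
Qed.

(** Meant for [swap2]: a pair and its swap span the same line, so at most one of the two is kept, at
    the cost of a factor 2. *)
Lemma thin_involution (T : eqType) (f : T -> T) (s : seq T) : involutive f -> uniq s ->
  exists s', [/\ {subset s' <= s}, uniq s', (size s <= 2 * size s')%N &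
    forall x y, x \in s' -> y \in s' -> y = f x -> y = x].
Proof.
move=> fK; move: {2}(size s) (leqnn (size s)) => n; elim: n s => [|n IH] [|x s] //= hn us.
- by exists [::].
- by exists [::].
move: us => /andP[xs us]; pose s1 := [seq y <- s | y != f x].
have s1s : (size s <= (size s1).+1)%N.
  rewrite -(count_predC (pred1 (f x)) s) addnC -[X in (_ <= X)%N]addn1; apply: leq_add.
    by rewrite size_filter.
  by rewrite count_uniq_mem //; case: (_ \in _).
have [||s' [sub us' ss hs]] := IH s1.
- by apply: (leq_trans _ (hn : (size s <= n)%N)); rewrite size_filter count_size.
- exact: filter_uniq.
have xs' : x \notin s' by apply: contra xs => /sub; rewrite mem_filter => /andP[].
exists (x :: s'); split.
- by move=> y; rewrite !inE => /orP[->//|/sub]; rewrite mem_filter => /andP[_ ->]; rewrite orbT.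
- by rewrite /= xs'.
- by rewrite /= mulnS ltnS (leq_trans s1s).
- move=> y z; rewrite !inE => /orP[/eqP ->|ys] /orP[/eqP ->|zs] //.
  + by move=> e; move: (sub z zs); rewrite mem_filter e eqxx.
  + by move=> e; move: (sub y ys); rewrite mem_filter e fK eqxx.
  + exact: hs.
Qed.

(** * Pairs with many common partners *)

Section Partners.
Variable R : realType.
Local Notation F := R[i].
Local Notation pt := (R[i] * R[i])%type.
Implicit Types (p q r s t : pt) (pq st e : pt * pt) (o w c : 'rV[F]_4).

Definition swap2 e : pt * pt := (e.2, e.1).

Lemma swap2K : involutive swap2.
Proof. by case. Qed.

Definition coplanar4 e e' := d4 (par e.1) (par e.2) (par e'.1) (par e'.2) = 0.

(* Pairs collinear with a common centre are removed: through a centre pass too many lines joining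
   two points of the curve. *)
Definition inc (gs : seq {mpoly F[2]}) pq st := concyc pq.1 pq.2 st.1 st.2 /\
  ~ exists o, [/\ center gs o, on_line o pq.1 pq.2 & on_line o st.1 st.2].

Lemma polyfun_bf a b (U V : pt -> 'rV[F]_4) : vpolyfun a U -> vpolyfun b V ->
  polyfun (a + b) (fun p => bf (U p) (V p)).
Proof.
move=> hU hV; apply: polyfunB; first by apply: polyfunD; apply: polyfunM.
apply: (@polyfun_ext _ (a + b) (fun p => 2^-1 * (U p 0 j0 * V p 0 j3 + U p 0 j3 * V p 0 j0))).
  by move=> p; rewrite mulrC.
by apply: polyfunZ; apply: polyfunD; apply: polyfunM.
Qed.

Lemma polyfun_d4 b c w : polyfun 2 (fun p => d4 (par p) b c w).
Proof.
apply: (@polyfun_ext _ 2 (fun p => dot (cof b c w) (par p))) => [p|]; first by rewrite d4E.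
exact/polyfun_dot/vpolyfun_par.
Qed.

Lemma vpolyfun_trans_pt s t s' t' : vpolyfun 2 (fun p => trans_pt s t s' t' (par p)).
Proof.
move=> i; apply: (@polyfun_ext _ 2 (fun p => par t' 0 i * d4 (par p) (par s) (par t) (par s')
   - par s' 0 i * d4 (par p) (par s) (par t) (par t'))) => [p|].
  by rewrite /trans_pt; move: (par s') (par t') (par s) (par t) (par p) => *; rewrite !mxE; ring.
by apply: polyfunB; apply: polyfunZ; exact: polyfun_d4.
Qed.

Lemma vpolyfun_trans_end s t s' t' : vpolyfun 6 (fun p => trans_end s t s' t' (par p)).
Proof.
have hv := vpolyfun_trans_pt s t s' t'.
move=> i; apply: (@polyfun_ext _ 6 (fun p => bf (trans_pt s t s' t' (par p)) (trans_pt s t s' t' (par p))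
   * par p 0 i - (2 * bf (par p) (trans_pt s t s' t' (par p))) * trans_pt s t s' t' (par p) 0 i)) => [p|].
  by rewrite /trans_end; move: (trans_pt _ _ _ _ _) => v; move: (par p) => u; rewrite !mxE; ring.
apply: polyfunB.
  exact: (polyfunM (polyfun_bf hv hv) (vpolyfun_par R i)).
apply: (polyfunM (e1 := 4) (e2 := 2)); last exact: hv.
apply: polyfunZ; exact: (polyfun_bf (vpolyfun_par R) hv).
Qed.

Lemma trans_end_inj p q q' st e : ~ coplanar4 st e -> concyc p q st.1 st.2 -> concyc p q e.1 e.2 ->
  concyc p q' st.1 st.2 -> concyc p q' e.1 e.2 -> q = q'.
Proof.
move=> /eqP sk h h' h2 h2'.
have [k k0 e1] := trans_end_concyc h h' sk; have [l l0 e2] := trans_end_concyc h2 h2' sk.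
apply: (@par_inj _ (k^-1 * l)); rewrite -scalerA -e2 e1 scalerA mulVf ?scale1r //.
Qed.

Section Good.
Variables (C : set pt) (gs : seq {mpoly F[2]}) (D N : nat).
Hypothesis gC : good_curve C gs D N.

(** Either [pq] lies in the common plane of the two lines, with at most [N * N] choices, or all
    three lines pass through one point. Normalised, this point is not a centre because of [inc], so
    [not_center_atmost] applies. *)
Lemma meeting_lines st e : sep st.1 st.2 -> sep e.1 e.2 -> e <> st -> e <> swap2 st ->
  coplanar4 st e ->
  atmost (N * N + D * D * N) (fun pq => [/\ C pq.1, C pq.2, inc gs pq st & coplanar4 pq e]).
Proof.
case: st e => [s t] [s' t'] /= hst he n1 n2 /d4_form /= [n n0 [ns nt ns' nt']].
have sec := plane_section gC n0.
pose P2 pq := [/\ C pq.1, C pq.2, inc gs pq (s, t) & exists u, [/\ bf u u != 0,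
  on_line u pq.1 pq.2, on_line u s t & on_line u s' t']].
have hP2 : atmost (D * D * N) P2.
  (* One such pair [pq0] fixes the meeting point; for all others it is the same up to a scalar, by
     [lines_meet_once]. *)
  have [[pq0 [_ _ [_ nc] [u0 [b0 up us us']]]]|hn] := pselect (exists pq, P2 pq); last first.
    by move=> [|x l] // _ hx; exfalso; apply: hn; exists x; apply: hx; rewrite mem_head.
  pose y := sqrtC (bf u0 u0); have y0 : y != 0 by rewrite sqrtC_eq0.
  pose o := y^-1 *: u0; have e0 : u0 = y *: o by rewrite /o scalerA mulfV ?scale1r.
  have line a b : on_line u0 a b -> on_line o a b by rewrite e0; exact: on_line_scale.
  have o1 : bf o o = 1 by rewrite /o bfZl bfZr -[bf u0 u0]sqrtCK -/y; field; exact: y0.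
  have nco : ~ center gs o.
    by move=> co; apply: nc; exists o; split; [exact: co|exact: line up|exact: line us].
  apply: atmost_sub (leqnn _) (not_center_atmost gC o1 nco) => pq [Cp Cq _ [u [bu uq us1 us1']]].
  split; [exact: Cp|exact: Cq|].
  have [k ek] : exists k, u = k *: u0.
    by apply: (lines_meet_once hst he _ _ us us' us1 us1' (bf_neq0 b0)) => // ee; apply: n2.
  have k0 : k != 0 by apply: contraNneq (bf_neq0 bu) => z; rewrite ek z scale0r.
  by rewrite ek in uq; exact: (line _ _ (on_line_scale k0 uq)).
apply: (@atmost_sub _ _ (fun pq : pt * pt => ((C pq.1 /\ dot n (par pq.1) = 0) /\ (C pq.2 /\ dot n (par pq.2) = 0)) \/ P2 pq)
    _ _ _ (leqnn _)); last exact: atmost_or (atmost_pair sec sec) hP2.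
move=> [p q] [/= Cp Cq hi hd].
have [[np nq]|hu] := coplanar_meet hi.1 he hd ns nt ns' nt'.
  by left; split; split; [exact: Cp|exact: np|exact: Cq|exact: nq].
by right; split; [exact: Cp|exact: Cq|exact: hi|exact: hu].
Qed.

(** If [e] and [e'] are coplanar, this is [meeting_lines]. Otherwise [p] is on the quadric of
    transversals, whose equation has degree at most 4 in the plane and is not trivial by
    [no_common_quadric]; and [p] determines [q]. *)
Lemma three_lines st e e' : sep st.1 st.2 -> sep e.1 e.2 -> sep e'.1 e'.2 ->
  e' <> e -> e' <> swap2 e -> ~ coplanar4 st e -> ~ coplanar4 st e' ->
  atmost (N * N + D * D * N + N)
    (fun pq => [/\ C pq.1, C pq.2, inc gs pq st & inc gs pq e /\ coplanar4 pq e']).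
Proof.
move=> hst he he' n1 n2 k1 k2.
have [k12|k12] := pselect (coplanar4 e e').
  apply: atmost_sub (leq_addr _ _) (meeting_lines he he' n1 n2 k12) => pq [Cp Cq _ [h h']].
  by split.
pose phi p := d4 (par p) (trans_pt st.1 st.2 e.1 e.2 (par p)) (par e'.1) (par e'.2).
have hphi : polyfun 4 phi.
  apply: (@polyfun_ext _ 4 (fun p => d4 (par p) (par st.1) (par st.2) (par e.1) * d4 (par p) (par e.2) (par e'.1) (par e'.2)
  - d4 (par p) (par st.1) (par st.2) (par e.2) * d4 (par p) (par e.1) (par e'.1) (par e'.2))) => [p|].
    by rewrite /phi trans_quadric.
  by apply: polyfunB; apply: (polyfunM (e1 := 2) (e2 := 2)); exact: polyfun_d4.
have [h|h] := good_low gC hphi.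
  exfalso; move/eqP: k1 => k1; move/eqP: k2 => k2; move/eqP: k12 => k12.
  exact: (no_common_quadric hst he' k1 k2 k12).
apply: (@atmost_sub _ _ _ N _ _ (leq_addl _ _)) => [pq|]; first by move=> hh; exact: hh.
apply: (@atmost_inj _ _ _ _ fst _ _ _ h).
  move=> [p q] [p' q'] /= [_ _ [h1 _] [[h2 _] _]] [_ _ [h3 _] [[h4 _] _]] ep.
  move: h3 h4; rewrite /= -ep => h3 h4; congr (_, _); exact: (trans_end_inj k1 h1 h2 h3 h4).
move=> [p q] [/= Cp _ [h1 _] [[h2 _] h3]]; split; first exact: Cp.
have [x [y [_ _ ev]]] := trans_pt_concyc h1 h2 (introN eqP k1).
have [n n0 [np nq ns nt]] := (d4_form _ _ _ _).1 h3.
have nv : dot n (trans_pt st.1 st.2 e.1 e.2 (par p)) = 0.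
  by rewrite ev dotDr !dotZr np nq !mulr0 addr0.
rewrite /phi; apply/d4_form; exists n; first exact: n0.
by split; [exact: np|exact: nv|exact: ns|exact: nt].
Qed.

Let M3 := (N * N + D * D * N + N)%N.

Definition common g g' st e pq :=
  [/\ eval2 g pq.1 = 0, eval2 g' pq.2 = 0, inc gs pq st & inc gs pq e].

Lemma common_fst g g' st e P K : ~ coplanar4 st e -> (forall pq, common g g' st e pq -> P pq.1) ->
  atmost K P -> atmost K (common g g' st e).
Proof.
move=> k hP; apply: (@atmost_inj _ _ _ P fst); last exact: hP.
move=> [p q] [p' q'] /= [_ _ [h1 _] [h2 _]] [_ _ [h3 _] [h4 _]] ep.
by move: h3 h4; rewrite /= -ep => h3 h4; congr (_, _); exact: (trans_end_inj k h1 h2 h3 h4).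
Qed.

Local Notation W st e := (fun p => trans_end st.1 st.2 e.1 e.2 (par p)).

Lemma common_trans_end g g' st e pq : ~ coplanar4 st e -> common g g' st e pq ->
  W st e pq.1 0 j0 != 0 /\ projp (W st e pq.1) = pq.2.
Proof.
move=> /eqP k [_ _ [h1 _] [h2 _]]; have [x x0 ->] := trans_end_concyc h1 h2 k.
by rewrite proj_par // mxE mxE mulr1.
Qed.

(** From more than [2 * N] such [e] keep more than [N], no two of them swaps of each other. Each map
    [W st e] takes [g] into [g'], and for general [p] the images lie on [C] in the plane of [p] and
    [st], so two of them coincide. Some [e] and [e'] then give the same image for infinitely many
    points of [g], hence for all; so every common partner of [st] and [e], apart from images at
    infinity, is coplanar with [e'], against [three_lines]. *)
Lemma bad_type g g' st : g \in gs -> g' \in gs -> sep st.1 st.2 ->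
  atmost (2 * N) (fun e => [/\ sep e.1 e.2, ~ coplanar4 st e & ~ atmost (N + M3) (common g g' st e)]).
Proof.
move=> gg gg' hst es0 us0 hes0; rewrite leqNgt; apply/negP => big.
have [es [sub us ss hes]] := thin_involution swap2K us0.
have esN : (N < size es)%N by move: big ss; lia.
have {}hes0 e : e \in es -> [/\ sep e.1 e.2, ~ coplanar4 st e & ~ atmost (N + M3) (common g g' st e)].
  by move=> /sub /hes0.
have vW e : vpolyfun 6 (W st e) by exact: vpolyfun_trans_end.
have onto e : e \in es -> forall p, eval2 g p = 0 -> W st e p 0 j0 != 0 -> eval2 g' (projp (W st e p)) = 0.
  move=> /hes0 [se sk nb]; have [//|h] := pull gC (isT : (6 <= 12)%N) (vW e) gg gg'.
  exfalso; apply: nb; apply: atmost_sub (leq_addr _ _) (common_fst sk _ h); first by move=> x hx; exact: hx.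
  move=> pq hpq; have [w0 ep] := common_trans_end sk hpq; case: hpq => e1 e2 _ _.
  by split => //; rewrite ep.
have Wz e : e \in es -> atmost N (fun p => eval2 g p = 0 /\ W st e p 0 j0 = 0).
  move=> /hes0 [se sk nb].
  have hp : polyfun (24 * D) (fun p => W st e p 0 j0).
    by apply: polyfun_mono (vW e j0); have := good_pos gC; lia.
  have [h|//] := good_vanish gC gg hp.
  exfalso; apply: nb; apply: (@atmost_sub _ _ (fun=> False) 0%N) => //; last by move=> [|x l] // _ /(_ x (mem_head _ _)).
  by move=> pq hpq; have [/eqP w0 _] := common_trans_end sk hpq; case: hpq => /h.
pose Q (k : (pt * pt) + pt) p := match k with
  | inl e => W st e p 0 j0 = 0
  | inr s => bf (par s) (par p) = 0 end.
pose ks : seq ((pt * pt) + pt) := inr st.1 :: inr st.2 :: map inl es.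
have hQ : escapes (fun p => eval2 g p = 0 /\ forall k, k \in ks -> ~ Q k p).
  apply: (@escapes_all _ _ _ _ _ N); first exact: good_escapes gC _ gg.
  have sec s : atmost N (fun p => eval2 g p = 0 /\ bf (par s) (par p) = 0).
    have s0 : polar (par s) != 0 by apply: contra (par_neq0 s) => /eqP /polar_eq0 ->.
    by apply: atmost_sub (leqnn _) (plane_section gC s0) => p [/(good_sub gC gg) Cp h]; rewrite dot_polar.
  move=> k; rewrite !inE => /or3P[/eqP ->|/eqP ->|/mapP [e ees ->]]; [exact: sec|exact: sec|].
  exact: Wz.
pose prs := [seq (e, e') | e <- es, e' <- [seq x <- es | x != e]].
pose coin (ee : (pt * pt) * (pt * pt)) p := [/\ eval2 g p = 0, W st ee.1 p 0 j0 != 0,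
  W st ee.2 p 0 j0 != 0 & projp (W st ee.1 p) = projp (W st ee.2 p)].
have hcoin : escapes (fun p => exists2 ee, ee \in prs & coin ee p).
  move=> l; have [p pl [ep hp]] := hQ l; exists p => //.
  have w0 e : e \in es -> W st e p 0 j0 != 0.
    by move=> ee; apply/eqP; apply: (hp (inl e)); rewrite !inE map_f ?orbT //.
  have ps : sep p st.1 by rewrite sepC; apply/eqP; apply: (hp (inr st.1)); rewrite inE eqxx.
  have pt' : sep p st.2 by rewrite sepC; apply/eqP; apply: (hp (inr st.2)); rewrite !inE eqxx orbT.
  have [n n0 [np ns nt hn]] := plane_of ps pt' hst.
  have Wn e : dot n (W st e p) = 0.
    suff hv : dot n (trans_pt st.1 st.2 e.1 e.2 (par p)) = 0.
      rewrite /trans_end; move: (trans_pt _ _ _ _ _) hv => v hv.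
      by rewrite -scaleNr dotDr !dotZr np hv !mulr0 addr0.
    apply: hn; exact: trans_pt_coplanar.
  pose rs := [seq projp (W st e p) | e <- es].
  have /uniqPn : ~~ uniq rs.
    apply/negP => ur; have : (size rs <= N)%N.
      apply: (plane_section gC n0 ur) => r rr; have /mapP [e ee ->] := rr.
      split; first exact: (good_sub gC gg' (onto e ee p ep (w0 e ee))).
      have iW := trans_end_isotropic st.1 st.2 e.1 e.2 p.
      apply: (mulfI (w0 e ee)); rewrite mulr0 -dotZr -(par_proj iW (w0 e ee)); exact: Wn.
    by rewrite size_map leqNgt esN.
  pose z0 : pt := (0, 0); pose d0 : pt * pt := (z0, z0).
  move=> /(_ z0) [a [b [ab bN eab]]]; rewrite size_map in bN.
  have aN := ltn_trans ab bN.
  rewrite (nth_map d0 z0 _ aN) (nth_map d0 z0 _ bN) in eab.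
  have ma := mem_nth d0 aN; have mb := mem_nth d0 bN.
  exists (nth d0 es a, nth d0 es b).
    apply/allpairsPdep; exists (nth d0 es a), (nth d0 es b); split; [exact: ma| |exact: erefl].
    by rewrite mem_filter mb andbT (nth_uniq d0 bN aN us) (gtn_eqF ab).
  split; [exact: ep|exact: (w0 _ ma)|exact: (w0 _ mb)|exact: eab].
have [[e e'] /allpairsPdep [x [y [xs]]]] : exists2 ee, ee \in prs & ~ atmost N (coin ee).
  apply: contrapT => hn; apply: (escapes_not_atmost hcoin (N := (size prs * N)%N)).
  apply: atmost_bigor => ee eep; apply: contrapT => na; apply: hn; exists ee => //.
rewrite mem_filter => /andP[exy ys] [ex ey]; rewrite -{}ex -{}ey in xs ys exy * => nco.
have [se sk nb] := hes0 e xs; have [se' sk' _] := hes0 e' ys.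
have cross (i : 'I_4) p : eval2 g p = 0 -> i = j1 \/ i = j2 ->
    W st e p 0 j0 * W st e' p 0 i - W st e p 0 i * W st e' p 0 j0 = 0.
  move=> ep hi; pose phi p := W st e p 0 j0 * W st e' p 0 i - W st e p 0 i * W st e' p 0 j0.
  have hp : polyfun (24 * D) phi.
    apply: (@polyfun_mono _ 12); first exact: leq_mul (isT : (12 <= 24)%N) (good_pos gC).
    by apply: polyfunB; apply: (polyfunM (e1 := 6) (e2 := 6)); exact: vW.
  have [h|h] := good_vanish gC gg hp; first exact: h.
  exfalso; apply: nco; apply: atmost_sub (leqnn _) h => r [er w0 w0' h12]; split; first exact: er.
  by rewrite /phi; have [h1 h2] := (projp_eq w0 w0').1 h12; case: hi => ->; [exact: h1|exact: h2].
(* The summand [N] covers the partners at which [W st e'] is at infinity, [M3] the others. *)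
apply: nb; apply: (@atmost_sub _ _ (fun pq => (common g g' st e pq /\ W st e' pq.1 0 j0 = 0) \/
    [/\ C pq.1, C pq.2, inc gs pq st & inc gs pq e /\ coplanar4 pq e']) _ _ _ (leqnn _)).
  move=> pq hpq; have [w0|w0] := eqVneq (W st e' pq.1 0 j0) 0; first by left.
  right; have [v0 ev] := common_trans_end sk hpq; have [e1 e2 i1 i2] := hpq.
  split; [exact: (good_sub gC gg e1)|exact: (good_sub gC gg' e2)|exact: i1|split; first exact: i2].
  have iW := trans_end_isotropic st.1 st.2 e'.1 e'.2 pq.1.
  have eW := par_proj iW w0; apply: (@trans_end_coplanar _ pq.1 pq.2 st.1 st.2 e'.1 e'.2 _ w0); rewrite [LHS]eW; congr (_ *: par _).
  rewrite -ev; apply/esym; apply: (projp_eq v0 w0).2.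
  by split; [exact: (cross j1 _ e1 (or_introl erefl))|exact: (cross j2 _ e1 (or_intror erefl))].
apply: atmost_or; last first.
  apply: three_lines => //.
    by move=> ee; move: exy; rewrite ee eqxx.
  move=> ee; have := hes e e' xs ys ee => ee'; move: exy; rewrite ee' eqxx //.
apply: (@atmost_inj _ _ _ _ fst _ _ _ (Wz e' ys)).
  move=> [p q] [p' q'] /= [[_ _ [h1 _] [h2 _]] _] [[_ _ [h3 _] [h4 _]] _] ep.
  by move: h3 h4; rewrite /= -ep => h3 h4; congr (_, _); exact: (trans_end_inj sk h1 h2 h3 h4).
by move=> pq [[e1 _ _ _] h]; split; [exact: e1|exact: h].
Qed.

(** The summand 2 stands for [st] and its swap. Other pairs coplanar with [st] are never bad, by
    [meeting_lines]; a skew bad pair is bad for one of the at most [D * D] pairs of components. *)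
Lemma bad_partners st : sep st.1 st.2 ->
  atmost (2 + D * D * (2 * N)) (fun e => ~ atmost (N * N + D * D * N + D * D * (N + M3))
    (fun pq => [/\ C pq.1, C pq.2, inc gs pq st & inc gs pq e])).
Proof.
move=> hst; pose G := [seq (g, g') | g <- gs, g' <- gs].
have sG : (size G <= D * D)%N by rewrite size_allpairs leq_mul ?(good_size gC).
apply: (@atmost_sub _ _ (fun e => e \in [:: st; swap2 st] \/ exists2 gg, gg \in G &
   [/\ sep e.1 e.2, ~ coplanar4 st e & ~ atmost (N + M3) (common gg.1 gg.2 st e)]) (2 + size G * (2 * N))).
- move=> e nb; have [e1|n1] := eqVneq e st; first by left; rewrite e1 mem_head.
  have [e2|n2] := eqVneq e (swap2 st); first by left; rewrite e2 !inE eqxx orbT.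
  right; have [se|nse] := boolP (sep e.1 e.2); last first.
    exfalso; apply: nb; apply: (@atmost_sub _ _ (fun=> False) 0%N) => //.
      by move=> pq [_ _ _ [[_ h _ _] _]]; move: nse; rewrite h.
    by move=> [|x l] // _ /(_ x (mem_head _ _)).
  have [k|k] := pselect (coplanar4 st e).
    exfalso; apply: nb; move/eqP: n1 => n1; move/eqP: n2 => n2.
    apply: atmost_sub (leq_addr _ _) (meeting_lines hst se n1 n2 k) => pq [Cp Cq i1 i2].
    by split; [exact: Cp|exact: Cq|exact: i1|case: i2 => -[_ _ _ [_ _ _ h]] _; exact: h].
  apply: contrapT => hn; apply: nb.
  have hG gg : gg \in G -> atmost (N + M3) (common gg.1 gg.2 st e).
    by move=> ggG; apply: contrapT => na; apply: hn; exists gg.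
  apply: atmost_sub (atmost_bigor hG).
    move=> pq [/(good_mem gC) [g gg e1] /(good_mem gC) [g' gg' e2] i1 i2].
    by exists (g, g') => //; apply/allpairsP; exists (g, g').
  by apply: leq_trans (leq_addl _ _); rewrite leq_mul2r sG orbT.
- by rewrite leq_add2l leq_mul2r sG orbT.
apply: (@atmost_or _ (fun e => e \in [:: st; swap2 st]) _ 2); first exact: (@atmost_seq _ _ [:: st; swap2 st]).
by apply: atmost_bigor => -[_ _] /allpairsP [[g g'] [/= gg gg' [-> ->]]]; exact: bad_type.
Qed.

End Good.
End Partners.

(** * Elimination of the ordinates *)

Section Elimination.
Variable F : numClosedFieldType.
Implicit Types (t : GRing.term F) (f : GRing.formula F) (e : seq F) (u v : {poly {poly F}}).

Definition bidegree_le (D : nat) u := (size u <= D)%N && (sizeY u <= D)%N.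

Lemma bidegreeM D E u v : bidegree_le D u -> bidegree_le E v -> bidegree_le (D + E) (u * v).
Proof.
move=> /andP[h1 h2] /andP[h3 h4]; apply/andP; split.
  by apply: leq_trans (size_polyMleq _ _) _; apply: leq_trans (leq_pred _) (leq_add h1 h3).
rewrite sizeYE in h2; rewrite sizeYE in h4; rewrite sizeYE rmorphM.
by apply: leq_trans (size_polyMleq _ _) _; apply: leq_trans (leq_pred _) (leq_add h2 h4).
Qed.

Lemma bidegreeD D E u v : bidegree_le D u -> bidegree_le E v -> bidegree_le (D + E) (u + v).
Proof.
move=> /andP[h1 h2] /andP[h3 h4]; apply/andP; split.
  apply: leq_trans (size_polyD _ _) _.
  by rewrite geq_max (leq_trans h1 (leq_addr _ _)) (leq_trans h3 (leq_addl _ _)).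
rewrite sizeYE in h2; rewrite sizeYE in h4; rewrite sizeYE rmorphD.
apply: leq_trans (size_polyD _ _) _.
by rewrite geq_max (leq_trans h2 (leq_addr _ _)) (leq_trans h4 (leq_addl _ _)).
Qed.

Lemma bidegreeC (c : F) : bidegree_le 1 c%:P%:P.
Proof. by rewrite /bidegree_le sizeYE swapXY_polyC map_polyC /= !size_polyC_leq1. Qed.

Lemma bidegree_mono D E u : (D <= E)%N -> bidegree_le D u -> bidegree_le E u.
Proof. by move=> h /andP[h1 h2]; rewrite /bidegree_le (leq_trans h1 h) (leq_trans h2 h). Qed.

Lemma term_bipoly t : GRing.rterm t -> exists D, forall e, exists2 u,
  bidegree_le D u & forall x y, GRing.eval (x :: y :: e) t = u.[x, y].
Proof.
elim: t => //=.
- move=> n _; exists 2%N => e; case: n => [|[|n]].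
  + exists 'X; first by rewrite /bidegree_le sizeYE swapXY_X size_polyX size_polyC polyX_eq0.
    by move=> x y; rewrite /= hornerX hornerC.
  + exists 'Y; first by rewrite /bidegree_le sizeYE swapXY_Y size_polyX size_polyC polyX_eq0.
    by move=> x y; rewrite /= hornerC hornerX.
  + exists (e`_n)%:P%:P; first exact: bidegree_mono (bidegreeC _).
    by move=> x y; rewrite /= !hornerC.
- by move=> c _; exists 1%N => e; exists c%:P%:P; [exact: bidegreeC|move=> x y; rewrite !hornerC].
- by move=> n _; exists 1%N => e; exists n%:R%:P%:P; [exact: bidegreeC|move=> x y; rewrite !hornerC].
- move=> t1 IH1 t2 IH2 /andP[/IH1 [D1 h1] /IH2 [D2 h2]]; exists (D1 + D2)%N => e.
  have [u1 b1 e1] := h1 e; have [u2 b2 e2] := h2 e.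
  by exists (u1 + u2) => [|x y]; [exact: bidegreeD|rewrite e1 e2 !hornerD].
- move=> t IH /IH [D h]; exists (1 + D)%N => e; have [u b eu] := h e.
  exists ((-1)%:P%:P * u) => [|x y]; first by apply: bidegreeM b; exact: bidegreeC.
  by rewrite eu !hornerM !hornerC mulN1r.
- move=> t IH n /IH [D h]; exists (1 + D)%N => e; have [u b eu] := h e.
  exists (n%:R%:P%:P * u) => [|x y]; first by apply: bidegreeM b; exact: bidegreeC.
  by rewrite eu !hornerM !hornerC mulr_natl.
- move=> t1 IH1 t2 IH2 /andP[/IH1 [D1 h1] /IH2 [D2 h2]]; exists (D1 + D2)%N => e.
  have [u1 b1 e1] := h1 e; have [u2 b2 e2] := h2 e.
  by exists (u1 * u2) => [|x y]; [exact: bidegreeM|rewrite e1 e2 !hornerM].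
- move=> t IH n /IH [D h]; exists (1 + n * D)%N => e; have [u b eu] := h e.
  exists (u ^+ n) => [|x y]; last by rewrite eu !horner_exp.
  elim: n => [|n IHn]; first by rewrite expr0 -[1]/(1%:P%:P); exact: bidegreeC.
  by rewrite exprS mulSn addnCA; exact: bidegreeM.
Qed.

(** An equation contributes the difference of its two terms, or [1] when this is the zero
    polynomial; the connectives multiply. The parameters [e] enter the coefficients of [u] but not
    its degree bound. *)
Lemma qf_generic f : GRing.qf_form f -> GRing.rformula f -> exists D, forall e, exists u,
  [/\ u != 0, bidegree_le D u &
   (forall x y, u.[x, y] != 0 -> GRing.qf_eval (x :: y :: e) f) \/
   (forall x y, u.[x, y] != 0 -> ~~ GRing.qf_eval (x :: y :: e) f)].
Proof.
have b1 : bidegree_le 1 (1 : {poly {poly F}}) by rewrite -[1]/(1%:P%:P); exact: bidegreeC.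
have prod D1 D2 u1 u2 : u1 != 0 -> u2 != 0 -> bidegree_le D1 u1 -> bidegree_le D2 u2 ->
    [/\ u1 * u2 != 0, bidegree_le (D1 + D2) (u1 * u2) &
    forall x y, (u1 * u2).[x, y] != 0 -> u1.[x, y] != 0 /\ u2.[x, y] != 0].
  move=> n1 n2 h1 h2; split; [exact: mulf_neq0|exact: bidegreeM|].
  by move=> x y; rewrite !hornerM mulf_eq0 negb_or => /andP.
elim: f => //=.
- move=> b _ _; exists 1%N => e; exists 1; split; [exact: oner_neq0|exact: b1|].
  by case: b; [left|right].
- move=> t1 t2 _ /andP[/term_bipoly [D1 h1] /term_bipoly [D2 h2]].
  exists (1 + (D1 + (1 + D2)))%N => e; have [u1 d1 e1] := h1 e; have [u2 d2 e2] := h2 e.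
  pose v := u1 + (-1)%:P%:P * u2.
  have ev x y : (GRing.eval (x :: y :: e) t1 == GRing.eval (x :: y :: e) t2) = (v.[x, y] == 0).
    by rewrite e1 e2 /v !hornerD !hornerM !hornerC mulN1r subr_eq0.
  have [v0|v0] := eqVneq v 0.
    exists 1; split; [exact: oner_neq0|exact: bidegree_mono b1|].
    by left => x y _; rewrite ev v0 !horner0.
  exists v; split => //; last by right => x y; rewrite ev.
  apply: bidegree_mono (leq_addl 1 _) _; apply: bidegreeD d1 _; apply: bidegreeM d2; exact: bidegreeC.
- move=> f1 IH1 f2 IH2 /andP[q1 q2] /andP[r1 r2]; have [D1 h1] := IH1 q1 r1; have [D2 h2] := IH2 q2 r2.
  exists (D1 + D2)%N => e; have [u1 [n1 d1 c1]] := h1 e; have [u2 [n2 d2 c2]] := h2 e.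
  have [n12 d12 z] := prod _ _ _ _ n1 n2 d1 d2; exists (u1 * u2); split => //.
  case: c1 => c1; last by right => x y /z [/c1 /negPf -> _].
  case: c2 => c2; last by right => x y /z [_ /c2 /negPf ->]; rewrite andbF.
  by left => x y /z [/c1 -> /c2 ->].
- move=> f1 IH1 f2 IH2 /andP[q1 q2] /andP[r1 r2]; have [D1 h1] := IH1 q1 r1; have [D2 h2] := IH2 q2 r2.
  exists (D1 + D2)%N => e; have [u1 [n1 d1 c1]] := h1 e; have [u2 [n2 d2 c2]] := h2 e.
  have [n12 d12 z] := prod _ _ _ _ n1 n2 d1 d2; exists (u1 * u2); split => //.
  case: c1 => c1; first by left => x y /z [/c1 -> _].
  case: c2 => c2; first by left => x y /z [_ /c2 ->]; rewrite orbT.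
  by right => x y /z [/c1 /negPf -> /c2 /negPf ->].
- move=> f1 IH1 f2 IH2 /andP[q1 q2] /andP[r1 r2]; have [D1 h1] := IH1 q1 r1; have [D2 h2] := IH2 q2 r2.
  exists (D1 + D2)%N => e; have [u1 [n1 d1 c1]] := h1 e; have [u2 [n2 d2 c2]] := h2 e.
  have [n12 d12 z] := prod _ _ _ _ n1 n2 d1 d2; exists (u1 * u2); split => //.
  case: c1 => c1; last by left => x y /z [/c1 /negPf -> _].
  case: c2 => c2; first by left => x y /z [_ /c2 ->]; rewrite implybT.
  by right => x y /z [/c1 -> /c2 /negPf ->].
- move=> f IH q r; have [D h] := IH q r; exists D => e; have [u [n d c]] := h e.
  exists u; split => //; case: c => c; [right|left] => x y /c //.
  by move=> ->.
Qed.

(** Quantifier elimination yields one quantifier-free formula for all environments, so the degree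
    bound is uniform in the parameters, which will be the equation of the curve and the form given
    by [(p, q)]. *)
Lemma definable_generic f : GRing.rformula f -> exists D, forall e, exists u,
  [/\ u != 0, bidegree_le D u &
   (forall x y, u.[x, y] != 0 -> GRing.holds (x :: y :: e) f) \/
   (forall x y, u.[x, y] != 0 -> ~ GRing.holds (x :: y :: e) f)].
Proof.
move=> rf.
have wf := @ClosedFieldQE.wf_ex_elim F; have ok := @ClosedFieldQE.holds_ex_elim F (@solve_monicpoly F).
pose qf := GRing.quantifier_elim (@ClosedFieldQE.ex_elim F) f.
have /andP[q1 q2] : GRing.qf_form qf && GRing.rformula qf by exact: GRing.quantifier_elim_wf.
have P e : reflect (GRing.holds e f) (GRing.qf_eval e qf) by exact: GRing.quantifier_elim_rformP.
have [D h] := qf_generic q1 q2; exists D => e; have [u [u0 d c]] := h e; exists u; split => //.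
by case: c => c; [left|right] => x y /c /P.
Qed.

Fixpoint sum_term (ts : seq (GRing.term F)) : GRing.term F :=
  if ts is t :: ts' then GRing.Add t (sum_term ts') else GRing.NatConst F 0.

Lemma eval_sum_term e ts : GRing.eval e (sum_term ts) = \sum_(t <- ts) GRing.eval e t.
Proof. by elim: ts => [|t ts IH] /=; rewrite ?big_nil // big_cons IH. Qed.

Lemma rterm_sum_term ts : GRing.rterm (sum_term ts) = all (@GRing.rterm F) ts.
Proof. by elim: ts => //= t ts ->. Qed.

Definition sum2_term (n : nat) (h : nat -> nat -> GRing.term F) : GRing.term F :=
  sum_term [seq sum_term [seq h i j | j <- iota 0 n] | i <- iota 0 n].

Lemma sum_iota (n : nat) (h : nat -> F) : \sum_(i <- iota 0 n) h i = \sum_(i < n) h i.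
Proof. by rewrite -val_enum_ord big_map big_enum. Qed.

Lemma eval_sum2_term e n h : GRing.eval e (sum2_term n h) =
  \sum_(i < n) \sum_(j < n) GRing.eval e (h i j).
Proof.
rewrite eval_sum_term big_map sum_iota; apply: eq_bigr => i _.
by rewrite eval_sum_term big_map sum_iota.
Qed.

Lemma rterm_sum2_term n h : (forall i j, GRing.rterm (h i j)) -> GRing.rterm (sum2_term n h).
Proof.
move=> hr; rewrite rterm_sum_term all_map; apply/allP => i _ /=.
by rewrite rterm_sum_term all_map; apply/allP => j _ /=.
Qed.
End Elimination.

(** * The relation between the abscissas of two points of a curve *)

Section CurveElimination.
Variable R : realType.
Local Notation F := R[i].

(* The variables 0 and 1 are the abscissas, 2 and 3 the ordinates of two points of the curve;
   they are followed by the 16 coefficients of the bilinear form and the coefficients of the curve. *)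
Definition par_term (n k : nat) : GRing.term F :=
  nth (GRing.NatConst F 1) [:: GRing.NatConst F 1; GRing.Var F n; GRing.Var F (n + 2);
    GRing.Add (GRing.Exp (GRing.Var F n) 2) (GRing.Exp (GRing.Var F (n + 2)) 2)] k.

Definition curve_term (D n : nat) : GRing.term F :=
  sum2_term D (fun i j => GRing.Mul (GRing.Mul (GRing.Var F (20 + (i * D + j)))
    (GRing.Exp (GRing.Var F n) i)) (GRing.Exp (GRing.Var F (n + 2)) j)).

Definition form_term : GRing.term F :=
  sum2_term 4 (fun i j => GRing.Mul (GRing.Var F (4 + (i * 4 + j)))
    (GRing.Mul (par_term 0 i) (par_term 1 j))).

Definition pair_formula (D : nat) : GRing.formula F :=
  GRing.Exists 2 (GRing.Exists 3 (GRing.And (GRing.Equal (curve_term D 0) (GRing.NatConst F 0))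
    (GRing.And (GRing.Equal (curve_term D 1) (GRing.NatConst F 0))
       (GRing.Equal form_term (GRing.NatConst F 0))))).

Definition form_env (m : 'I_4 -> 'I_4 -> F) : seq F :=
  mkseq (fun k => m (inord (k %/ 4)) (inord (k %% 4))) 16.

Definition curve_env (D : nat) (a : nat -> nat -> F) : seq F :=
  mkseq (fun k => a (k %/ D)%N (k %% D)%N) (D * D).

Arguments curve_term : simpl never.
Arguments form_term : simpl never.
Arguments par_term : simpl never.

Lemma rterm_par_term n k : GRing.rterm (par_term n k).
Proof. by rewrite /par_term; case: k => [|[|[|[|[|k]]]]]. Qed.

Lemma rterm_curve_term D n : GRing.rterm (curve_term D n).
Proof. exact: rterm_sum2_term. Qed.

Lemma rterm_form_term : GRing.rterm form_term.
Proof. by apply: rterm_sum2_term => i j /=; rewrite !rterm_par_term. Qed.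

Lemma rformula_pair D : GRing.rformula (pair_formula D).
Proof.
change ((GRing.rterm (curve_term D 0) && true) &&
  ((GRing.rterm (curve_term D 1) && true) && (GRing.rterm form_term && true))).
by rewrite !rterm_curve_term rterm_form_term.
Qed.

Lemma eval_curve_term D (a : nat -> nat -> F) e n x y : e`_n = x -> e`_(n + 2) = y ->
  (forall k, (k < D * D)%N -> e`_(20 + k) = (curve_env D a)`_k) ->
  GRing.eval e (curve_term D n) = bipoly D a x y.
Proof.
move=> ex ey he; rewrite eval_sum2_term /bipoly.
apply: eq_bigr => i _; apply: eq_bigr => j _.
have [iD jD] := (ltn_ord i, ltn_ord j).
have k : (i * D + j < D * D)%N.
  by apply: (@leq_trans (i.+1 * D)); rewrite ?leq_mul2r ?iD ?orbT // mulSn addnC ltn_add2r.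
have D0 : (0 < D)%N by apply: leq_ltn_trans iD.
rewrite [GRing.eval _ _]/= ex ey he // nth_mkseq //.
by rewrite divnMDl // modnMDl (divn_small jD) (modn_small jD) addn0.
Qed.

Lemma eval_par_term e n (k : 'I_4) x y : e`_n = x -> e`_(n + 2) = y ->
  GRing.eval e (par_term n k) = par (x, y) 0 k.
Proof.
move=> <- <-; rewrite mxE; case: k => [[|[|[|[|//]]]]] hk //=.
Qed.

Lemma eval_form_term (m : 'I_4 -> 'I_4 -> F) e x x' y y' :
  e`_0 = x -> e`_1 = x' -> e`_2 = y -> e`_3 = y' ->
  (forall k, (k < 16)%N -> e`_(4 + k) = (form_env m)`_k) ->
  GRing.eval e form_term = \sum_i \sum_j m i j * (par (x, y) 0 i * par (x', y') 0 j).
Proof.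
move=> e0 e1 e2 e3 he; rewrite eval_sum2_term.
apply: eq_bigr => i _; apply: eq_bigr => j _.
have [i4 j4] := (ltn_ord i, ltn_ord j).
have k : (i * 4 + j < 16)%N by lia.
rewrite [LHS]/= (eval_par_term i e0 e2) (eval_par_term j e1 e3) he // nth_mkseq //.
by rewrite divnMDl // modnMDl (divn_small j4) (modn_small j4) addn0 !inord_val.
Qed.

(** Being definable, the relation holds for general abscissas or fails for general ones. The first
    alternative remains possible for arbitrary [a] and [m]; [pair_curve] excludes it for concyclic
    points. *)
Lemma pair_elimination (D : nat) : exists E, forall (a : nat -> nat -> F) (m : 'I_4 -> 'I_4 -> F),
  exists c : nat -> nat -> F, (exists x x', bipoly E c x x' != 0) /\
  let P x x' := exists y y', [/\ bipoly D a x y = 0, bipoly D a x' y' = 0 &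
    \sum_i \sum_j m i j * (par (x, y) 0 i * par (x', y') 0 j) = 0] in
  (forall x x', bipoly E c x x' != 0 -> P x x') \/ (forall x x', bipoly E c x x' != 0 -> ~ P x x').
Proof.
have [E hE] := definable_generic (rformula_pair D); exists E => a m.
(* The two zeros hold the places of the ordinates, variables 2 and 3, which the quantifiers
   overwrite. *)
have [u [u0 /andP[s1 s2] hu]] := hE ([:: 0; 0] ++ form_env m ++ curve_env D a).
have eu x x' : bipoly E (fun i j => u`_j`_i) x' x = u.[x, x'].
  rewrite /bipoly exchange_big /= [u.[_]](horner_coef_wide _ s1) horner_sum; apply: eq_bigr => i _.
  rewrite hornerM -rmorphXn hornerC (horner_coef_wide _ (leq_trans (max_size_coefXY u i) s2)) mulr_suml.
  by apply: eq_bigr => j _.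
exists (fun i j => u`_i`_j); have eu' x x' : bipoly E (fun i j => u`_i`_j) x x' = u.[x, x'].
  by rewrite bipoly_swap.
split.
  by have [x [x' h]] := poly2_nonroot u0; exists x, x'; rewrite eu'.
move=> P; have hP x x' : GRing.holds [:: x, x' & [:: 0; 0] ++ form_env m ++ curve_env D a] (pair_formula D) <-> P x x'.
  have H y y' (e := [:: x, x', y, y' & form_env m ++ curve_env D a]) :
     [/\ GRing.eval e (curve_term D 0) = bipoly D a x y, GRing.eval e (curve_term D 1) = bipoly D a x' y' &
      GRing.eval e form_term = \sum_i \sum_j m i j * (par (x, y) 0 i * par (x', y') 0 j)].
    have h16 k : (k < D * D)%N -> e`_(20 + k) = (curve_env D a)`_k by [].
    have h4 k : (k < 16)%N -> e`_(4 + k) = (form_env m)`_k.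
      move=> k16; change ((form_env m ++ curve_env D a)`_k = (form_env m)`_k).
      by rewrite nth_cat size_mkseq k16.
    by split; [exact: eval_curve_term|exact: eval_curve_term|exact: eval_form_term].
  split=> [[y [y' [h1 [h2 h3]]]]|[y [y' [h1 h2 h3]]]]; exists y, y'; have [e1 e2 e3] := H y y'.
    by split; [rewrite -e1; exact: h1|rewrite -e2; exact: h2|rewrite -e3; exact: h3].
  split; [exact: etrans e1 h1|split; [exact: etrans e2 h2|exact: etrans e3 h3]].
by case: hu => h; [left|right] => x x'; rewrite eu' => /h /hP.
Qed.
End CurveElimination.

(** * Four-point circles *)

Lemma atmost_list (T : eqType) (P : T -> Prop) N : atmost N P ->
  exists l : seq T, (size l <= N)%N /\ forall x, P x -> x \in l.
Proof.
move=> hP; apply: contrapT => hn.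
suff : exists l : seq T, [/\ uniq l, forall x, x \in l -> P x & size l = N.+1].
  by move=> [l [ul hl sl]]; have := hP l ul hl; rewrite sl ltnn.
elim: N.+1 => [|n [l [ul hl sl]]]; first by exists [::].
have [x px xl] : exists2 x, P x & x \notin l.
  apply: contrapT => h; apply: hn; exists l; split; first exact: hP ul hl.
  by move=> x px; apply: contrapT => /negP xl; apply: h; exists x.
exists (x :: l); rewrite /= xl ul sl; split => // y.
by rewrite inE => /orP[/eqP ->|/hl].
Qed.

Section Bilinear.
Variable F : numClosedFieldType.
Local Notation pt := (F * F)%type.
Implicit Types (p q r s t : pt) (n w u v : 'rV[F]_4).

Lemma linear_form_sum (phi : 'rV[F]_4 -> F) w :
  (forall x y u v, phi (x *: u + y *: v) = x * phi u + y * phi v) ->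
  phi w = \sum_i w 0 i * phi (delta_mx 0 i).
Proof.
move=> h; have hD u v : phi (u + v) = phi u + phi v by rewrite -[u]scale1r -[v]scale1r h !mul1r !scale1r.
have hZ x u : phi (x *: u) = x * phi u.
  by have := h x 0 u u; rewrite mul0r addr0 scale0r addr0.
by rewrite {1}(row_sum_delta w) !sum4 !hD !hZ.
Qed.

Lemma d4_bilinear u v : exists m : 'I_4 -> 'I_4 -> F, forall w w',
  d4 u v w w' = \sum_i \sum_j m i j * (w 0 i * w' 0 j).
Proof.
exists (fun i j => d4 u v (delta_mx 0 i) (delta_mx 0 j)) => w w'.
have h3 w1 x y a b : d4 u v (x *: a + y *: b) w1 = x * d4 u v a w1 + y * d4 u v b w1.
  by rewrite !(d4_swap02 u) d4_comb1; ring.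
rewrite (@linear_form_sum (fun a => d4 u v a w')); last by move=> *; exact: h3.
apply: eq_bigr => i _; rewrite (@linear_form_sum (fun a => d4 u v (delta_mx 0 i) a)); last first.
  by move=> *; exact: d4_comb4.
by rewrite mulr_sumr; apply: eq_bigr => j _; rewrite mulrA mulrC.
Qed.

(** The line of [(p, q)] meets the quadric only in its two ends, so the lift of [s] is off it and
    the three lifts are independent. *)
Lemma plane_of_sep p q s : sep p q -> s <> p -> s <> q -> exists2 n, n != 0 &
  forall w, d4 (par p) (par q) (par s) w = 0 -> dot n w = 0.
Proof.
move=> pq sp sq; have [n n0 [np nq ns]] := annihilator3 (par p) (par q) (par s).
exists n => // w /d4_dep [x0 [x1 [x2 [x3 [h e]]]]].
have x30 : x3 != 0.
  apply/eqP => z; move: e; rewrite z scale0r addr0 => e.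
  have [x20|x20] := eqVneq x2 0.
    move: e; rewrite x20 scale0r addr0 => /(sep_indep pq) [z0 z1].
    by move: h; rewrite z z0 z1 x20 eqxx => -[].
  have ls : on_line (par s) p q.
    exists (- (x2^-1 * x0)), (- (x2^-1 * x1)); apply: (@scalerI _ _ x2); first exact: x20.
    rewrite scalerDr !scalerA !mulrN !mulrA mulfV // !mul1r !scaleNr -opprD.
    by apply/eqP; rewrite -addr_eq0 addrC e.
  by case: (isotropic_on_line pq ls).
apply: (mulfI x30); rewrite mulr0 -dotZr.
have -> : x3 *: w = - (x0 *: par p + x1 *: par q + x2 *: par s).
  by apply/eqP; rewrite -addr_eq0 addrC e.
by rewrite -scaleN1r dotZr !dotDr !dotZr np nq ns !mulr0 !addr0 mulr0.
Qed.

Lemma plane_span p s t n w : sep p s -> sep p t -> sep s t ->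
  dot n (par p) = 0 -> dot n (par s) = 0 -> dot n (par t) = 0 ->
  d4 (par p) (par s) (par t) w = 0 -> dot n w = 0.
Proof.
move=> ps pt st np ns nt /d4_dep [x0 [x1 [x2 [x3 [h e]]]]].
have x30 : x3 != 0.
  apply/eqP => z; move: e; rewrite z scale0r addr0 => /(indep3 ps pt st) [z0 z1 z2].
  by move: h; rewrite z z0 z1 z2 eqxx => -[].
apply: (mulfI x30); rewrite mulr0 -dotZr.
have -> : x3 *: w = - (x0 *: par p + x1 *: par s + x2 *: par t).
  by apply/eqP; rewrite -addr_eq0 addrC e.
by rewrite -scaleN1r dotZr !dotDr !dotZr np ns nt !mulr0 !addr0 mulr0.
Qed.

Definition circle_form (a b r : F) : 'rV[F]_4 :=
  \row_(i < 4) [:: a ^+ 2 + b ^+ 2 - r; - 2 * a; - 2 * b; 1]`_i.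

Lemma circle_formE (a b r : F) p : dot (circle_form a b r) (par p) = (p.1 - a) ^+ 2 + (p.2 - b) ^+ 2 - r.
Proof. by rewrite dotE !mxE /=; ring. Qed.

Lemma circle_form_neq0 (a b r : F) : circle_form a b r != 0.
Proof. by apply/eqP => /rowP /(_ j3); rewrite !mxE /= => /eqP; rewrite oner_eq0. Qed.

(* Two distinct points with [bf = 0] differ by an isotropic vector, whose direction meets a circle
   of nonzero squared radius only once. *)
Lemma circle_sep (a b r : F) p q : r != 0 -> (p.1 - a) ^+ 2 + (p.2 - b) ^+ 2 = r ->
  (q.1 - a) ^+ 2 + (q.2 - b) ^+ 2 = r -> p != q -> sep p q.
Proof.
move=> r0 hp hq; apply: contraNT; rewrite negbK bf_par => /eqP e.
have n2 : (2 : F) != 0 by rewrite pnatr_eq0.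
pose u := p.1 - q.1; pose v := p.2 - q.2.
have euv : u ^+ 2 + v ^+ 2 = 0.
  by apply: (mulfI (invr_neq0 n2)); apply/eqP; rewrite mulr0 -oppr_eq0 -[X in _ == X]e /u /v; apply/eqP; ring.
have eAB : (p.1 - a) * u + (p.2 - b) * v = 0.
  apply: (mulfI n2); rewrite mulr0; transitivity
    (((p.1 - a) ^+ 2 + (p.2 - b) ^+ 2) - ((q.1 - a) ^+ 2 + (q.2 - b) ^+ 2) + (u ^+ 2 + v ^+ 2)).
    by rewrite /u /v; ring.
  by rewrite hp hq euv subrr addr0.
have u0 : u = 0.
  have : u ^+ 2 * r = 0.
    rewrite -hp; transitivity (((p.1 - a) * u + (p.2 - b) * v) * ((p.1 - a) * u - (p.2 - b) * v)
      + (p.2 - b) ^+ 2 * (u ^+ 2 + v ^+ 2)); first by ring.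
    by rewrite eAB euv mul0r mulr0 addr0.
  by move/eqP; rewrite mulf_eq0 (negPf r0) orbF sqrf_eq0 => /eqP.
have v0 : v = 0.
  by move: euv; rewrite u0 expr0n add0r => /eqP; rewrite sqrf_eq0 => /eqP.
move: u0 v0; rewrite /u /v => /eqP; rewrite subr_eq0 => /eqP h1 /eqP; rewrite subr_eq0 => /eqP h2.
by case: p q h1 h2 {hp hq e u v euv eAB} => ? ? [? ?] /= -> ->.
Qed.
End Bilinear.

Section Assembly.
Variable R : realType.
Local Notation F := R[i].
Local Notation pt := (R[i] * R[i])%type.
Implicit Types (p q r s t : pt) (pq st e : pt * pt).

Lemma circle_concyc (a b r : F) p q s t : r != 0 -> uniq [:: p; q; s; t] ->
  circle a b r p -> circle a b r q -> circle a b r s -> circle a b r t -> concyc p q s t.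
Proof.
move=> r0 /and4P[]; rewrite !inE !negb_or => /and3P[pq ps pt'] /andP[qs qt] st _ hp hq hs ht.
have sp x y : x != y -> circle a b r x -> circle a b r y -> sep x y.
  by move=> xy hx hy; exact: circle_sep r0 hx hy xy.
split; [exact: sp|exact: sp|exact: sp|split; [exact: sp|exact: sp|exact: sp|]].
have on x : circle a b r x -> dot (circle_form a b r) (par x) = 0.
  by move=> hx; rewrite circle_formE hx subrr.
by apply/d4_form; exists (circle_form a b r); [exact: circle_form_neq0|split; exact: on].
Qed.

Lemma circle_determined (X Y : set pt) p q s t : is_circle X -> is_circle Y -> concyc p q s t ->
  X p -> X q -> X s -> Y p -> Y q -> Y s -> X = Y.
Proof.
move=> [a [b [r [r0 ->]]]] [a' [b' [r' [r0' ->]]]] [pq _ ps [_ qs _ _]] xp xq xs yp yq ys.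
have sub (a1 b1 r1 a2 b2 r2 : F) : circle a1 b1 r1 p -> circle a1 b1 r1 q -> circle a1 b1 r1 s ->
    circle a2 b2 r2 p -> circle a2 b2 r2 q -> circle a2 b2 r2 s ->
    forall x, circle a1 b1 r1 x -> circle a2 b2 r2 x.
  move=> h1 h2 h3 k1 k2 k3 x hx.
  have on (a0 b0 c0 : F) y : circle a0 b0 c0 y -> dot (circle_form a0 b0 c0) (par y) = 0.
    by move=> hy; rewrite circle_formE hy subrr.
  have d : d4 (par p) (par q) (par s) (par x) = 0.
    apply/d4_form; exists (circle_form a1 b1 r1); [exact: circle_form_neq0|by split; exact: on].
  have := plane_span pq ps qs (on _ _ _ _ k1) (on _ _ _ _ k2) (on _ _ _ _ k3) d.
  by rewrite circle_formE => /eqP; rewrite subr_eq0 => /eqP.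
by apply/seteqP; split => x; exact: sub.
Qed.

Lemma vertical_section C gs D N x : good_curve C gs D N -> atmost N (fun p => C p /\ p.1 = x).
Proof.
move=> gC; pose n : 'rV[F]_4 := \row_(i < 4) [:: - x; 1; 0; 0]`_i.
have n0 : n != 0.
  by apply/eqP => /rowP /(_ j1); rewrite !mxE /= => /eqP; rewrite oner_eq0.
apply: atmost_sub (leqnn _) (plane_section gC n0) => p [Cp ep]; split; first exact: Cp.
by rewrite dotE !mxE /= ep; ring.
Qed.

(** The relation cannot hold for general abscissas: over an [x2] different from the abscissas of [p]
    and [q] there are finitely many points [s] of [C], the plane of [p], [q] and each such [s] has
    finitely many points [t] of [C], and an [x3] can avoid all their abscissas. Hence it fails for
    general ones, and [c] vanishes wherever it holds. *)
Lemma pair_curve (C : set pt) gs D N f (E D0 : nat) :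
  good_curve C gs D N -> C = zero_set f -> (msize f <= D0)%N ->
  (forall (a : nat -> nat -> F) (m : 'I_4 -> 'I_4 -> F),
    exists c : nat -> nat -> F, (exists x x', bipoly E c x x' != 0) /\
    let P x x' := exists y y', [/\ bipoly D0 a x y = 0, bipoly D0 a x' y' = 0 &
      \sum_i \sum_j m i j * (par (x, y) 0 i * par (x', y') 0 j) = 0] in
    (forall x x', bipoly E c x x' != 0 -> P x x') \/ (forall x x', bipoly E c x x' != 0 -> ~ P x x')) ->
  forall p q, exists c : nat -> nat -> F, (exists x y, bipoly E c x y != 0) /\
    forall s t, C s -> C t -> concyc p q s t -> bipoly E c s.1 t.1 = 0.
Proof.
move=> gC eC fD hE p q; have [m hm] := d4_bilinear (par p) (par q).
have [c [[x1 [x1' c0]] hc]] := hE (coef2 f) m; exists c; split; first by exists x1, x1'.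
have onC x y : bipoly D0 (coef2 f) x y = 0 <-> C (x, y).
  by rewrite eC /zero_set /= (eval2_bipoly (x, y) fD).
case: hc => hc; last first.
  move=> [x y] [x' y'] Cs Ct [_ _ _ [_ _ _ d]] /=.
  apply: contrapT => /eqP h; apply: (hc x x' h); exists y, y'; split; [exact/onC|exact/onC|].
  by rewrite -hm.
move=> s0 t0 Cs0 Ct0 [pq _ _ _]; exfalso.
have pol1 : \poly_(i < E) (\poly_(j < E) c i j).[x1'] != 0.
  apply: contraNneq c0 => z; rewrite bipoly_swap bipoly_row; move: z => /(congr1 (fun P => P.[x1])).
  by rewrite horner0 => ->.
have [x2 x2n hx2] := poly_nonroot [:: p.1; q.1] pol1.
have c2 : bipoly E c x2 x1' != 0 by rewrite bipoly_swap bipoly_row.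
have pol2 : \poly_(j < E) (\poly_(i < E) c i j).[x2] != 0.
  by apply: contraNneq c2 => z; rewrite bipoly_row z horner0.
have [ls [_ hls]] := atmost_list (vertical_section (x := x2) gC).
have T s : exists lt : seq pt, s \in ls -> C s /\ s.1 = x2 -> forall t, C t -> d4 (par p) (par q) (par s) (par t) = 0 -> t \in lt.
  case: (pselect (C s /\ s.1 = x2)) => hs; last by exists [::].
  have sp : s <> p by move=> e; move: x2n; rewrite !inE -hs.2 e eqxx.
  have sq : s <> q by move=> e; move: x2n; rewrite !inE -hs.2 e eqxx orbT.
  have [n n0 hn] := plane_of_sep pq sp sq.
  have [lt [_ hlt]] := atmost_list (plane_section gC n0); exists lt => _ _ t Ct d.
  by apply: hlt; split; [exact: Ct|exact: hn].
have [lt hlt] := @choice _ _ _ T.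
have [x3 x3n hx3] := poly_nonroot [seq t.1 | t <- flatten [seq lt s | s <- ls]] pol2.
have [|y [y' [/onC Cs /onC Ct d]]] := hc x2 x3; first by rewrite bipoly_row.
have sl : (x2, y) \in ls by apply: hls.
rewrite -hm in d.
case/negP: x3n; apply/mapP; exists (x3, y') => //; apply/flatten_mapP; exists (x2, y) => //.
exact: hlt.
Qed.

Lemma partner_unique o p q q' : bf o o = 1 -> on_line o p q -> on_line o p q' -> q = q'.
Proof.
move=> o1 /(on_line_refl o1) [x x0 e] /(on_line_refl o1) [x' x0' e'].
by apply: (@par_inj _ (x^-1 * x')); rewrite -scalerA -e' e scalerA mulVf // scale1r.
Qed.

(** On lines through a given centre [p] determines [q] and [s] determines [t], so each of the
    boundedly many centres contributes at most [size P * size P] quadruples. *)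
Lemma improper_atmost C gs D N (P : seq pt) : good_curve C gs D N ->
  atmost (D * D * (2 * N`!).+1 ^ 4 * (size P * size P)) (fun x : (pt * pt) * (pt * pt) =>
    [/\ x.1.1 \in P, x.2.1 \in P & exists o, [/\ center gs o, on_line o x.1.1 x.1.2 & on_line o x.2.1 x.2.2]]).
Proof.
move=> /centers_atmost /atmost_list [lo [slo hlo]].
have memP : atmost (size P) (fun p => p \in P) by exact: atmost_seq.
apply: (@atmost_sub _ _ (fun x : (pt * pt) * (pt * pt) => exists2 o, o \in lo & [/\ bf o o = 1,
  x.1.1 \in P, x.2.1 \in P, on_line o x.1.1 x.1.2 & on_line o x.2.1 x.2.2]) (size lo * (size P * size P))).
- by move=> x [h1 h2 [o [co l1 l2]]]; exists o; [exact: hlo|split=> //; case: co].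
- by rewrite leq_mul.
apply: atmost_bigor => o _; apply: (@atmost_inj _ _ _ _ (fun x => (x.1.1, x.2.1)) _ _ _ (atmost_pair memP memP)).
  move=> [[p q] [s t]] [[p' q'] [s' t']] /= [o1 _ _ h1 h2] [_ _ _ h1' h2'] [ep es].
  rewrite -ep in h1'; rewrite -es in h2'.
  by rewrite -ep -es (partner_unique o1 h1 h1') (partner_unique o1 h2 h2').
by move=> x [_ h1 h2 _ _]; split.
Qed.

Lemma circle_points (S : {fset pt}) (X : set pt) : four_point_circles S X ->
  exists x : (pt * pt) * (pt * pt), [/\ x.1.1 \in S, x.1.2 \in S, x.2.1 \in S & x.2.2 \in S] /\
    [/\ X x.1.1, X x.1.2, X x.2.1 & concyc x.1.1 x.1.2 x.2.1 x.2.2].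
Proof.
move=> [[a [b [r [r0 ->]]]]]; set T := [fset p in S | _] => hT.
have mT p : p \in T -> p \in S /\ circle a b r p.
  by rewrite !inE /= => /andP[? /asboolP].
have {}hT : (4 <= size (enum_fset T))%N by exact: hT.
have uT := fset_uniq T.
case eT: (enum_fset T) hT uT => [|p [|q [|s [|t l]]]] // _ uT.
have sub x : x \in [:: p; q; s; t] -> x \in T.
  by move=> h; change (x \in enum_fset T); rewrite eT -[p :: _]/([:: p; q; s; t] ++ l) mem_cat h.
have u4 : uniq [:: p; q; s; t].
  by move: uT; rewrite -[p :: _]/([:: p; q; s; t] ++ l) cat_uniq => /andP[].
have [[pS pX] [qS qX]] := (mT p (sub p (mem_head _ _)), mT q (sub q ltac:(by rewrite !inE eqxx orbT))).
have [[sS sX] [tS tX]] := (mT s (sub s ltac:(by rewrite !inE eqxx !orbT)), mT t (sub t ltac:(by rewrite !inE eqxx !orbT))).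
exists ((p, q), (s, t)); split => /=; first by split.
by split=> //; exact: circle_concyc r0 u4 pX qX sX tX.
Qed.

Lemma size_incident (T : eqType) (P : T -> T -> bool) (U : seq T) :
  size [seq (v, u) | v <- U, u <- [seq u <- U | P v u]] = (\sum_(v <- U) count (P v) U)%N.
Proof.
rewrite size_allpairs_dep sumnE big_map; apply: eq_bigr => v _.
by rewrite size_filter.
Qed.

(** Each circle is assigned a quadruple of its points, injectively because three of them determine
    the circle. Quadruples through a centre are counted by [improper_atmost], the others by
    [incidence_bound]. *)
Lemma four_point_circles_atmost (d : nat) : exists K : nat, forall C (S : {fset pt}) (m r : nat),
  curve_of_degree C d -> no_small_curve C -> [set` S] `<=` C ->
  (0 < m)%N -> (#|` S| <= m * r)%N ->
  atmost (K * (#|` S| ^ 2 * (r + m ^ 2))) (four_point_circles S).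
Proof.
have [D [N hD]] := @good_curve_exists R d.
have [E hE] := @pair_elimination R d.+1.
pose M3 := (N * N + D * D * N + N)%N.
pose MB := (2 + D * D * (2 * N))%N; pose M2 := (N * N + D * D * N + D * D * (N + M3))%N.
have [K' hK'] := incidence_bound R E N MB M2.
pose Nc := (D * D * (2 * N`!).+1 ^ 4)%N.
exists (K' + Nc)%N => C S m r dC nC SC m0 hn.
have [gs gC] := hD C dC nC.
have [_ [f eC sf] _] := dC.
have fD : (msize f <= d.+1)%N by rewrite sf.
pose P := enum_fset S; have sP : size P = #|` S| by [].
have PC p : p \in P -> C p by move=> h; exact: SC.
pose inc' v u := `[< inc gs v u >].
set U := [seq (s, t) | s <- P, t <- P].
have memU p q : p \in P -> q \in P -> (p, q) \in U by move=> hp hq; apply/allpairsP; exists (p, q).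
have Umem e : e \in U -> e.1 \in P /\ e.2 \in P by move=> /allpairsP [[x y] /= [hx hy ->]].
have uU : uniq U by apply: allpairs_uniq; [exact: fset_uniq|exact: fset_uniq|by move=> [? ?] [? ?]].
have hI : (\sum_(v <- U) count (inc' v) U <= K' * (#|` S| ^ 2 * (r + m ^ 2)))%N.
  rewrite -sP; apply: hK' => //.
  - exact: fset_uniq.
  - move=> x; rewrite -size_filter; apply: (vertical_section (x := x) gC).
      by rewrite filter_uniq ?fset_uniq.
    by move=> p; rewrite mem_filter => /andP[/eqP e pP]; split; first exact: PC.
  - move=> p q _ _; have [c [c0 hc]] := pair_curve gC eC fD hE p q; exists c; split; first exact: c0.
    by move=> s t sS tS /asboolP [h _]; exact: hc (PC _ sS) (PC _ tS) h.
  move=> u uin; have [hu|hu] := boolP (sep u.1 u.2); last first.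
    exists [::]; split => // u' _ _; rewrite (@eq_in_count _ _ pred0) ?count_pred0 // => v _ /=.
    by apply/negP => /andP[/asboolP [[_ h _ _] _] _]; case/negP: hu.
  have hb := bad_partners gC hu.
  exists [seq e <- U | `[< ~ atmost M2 (fun pq => [/\ C pq.1, C pq.2, inc gs pq u & inc gs pq e]) >]].
  split; first by apply: hb; rewrite ?filter_uniq // => e; rewrite mem_filter => /andP[/asboolP].
  move=> u' u'U; rewrite mem_filter u'U andbT => /asboolP /contrapT h.
  rewrite -size_filter; apply: h; first by rewrite filter_uniq.
  move=> v; rewrite mem_filter => /andP[/andP[/asboolP h1 /asboolP h2] /Umem [v1 v2]].
  by split=> //; exact: PC.
have prop : atmost (\sum_(v <- U) count (inc' v) U)%N (fun x : (pt * pt) * (pt * pt) =>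
    [/\ x.1 \in U, x.2 \in U & inc gs x.1 x.2]).
  rewrite -size_incident; apply: atmost_seq => -[v u] /= [hv hu h].
  by apply/allpairsPdep; exists v, u; split=> //; rewrite mem_filter hu andbT; exact/asboolP.
have both := atmost_or prop (@improper_atmost _ _ _ _ P gC).
have T (X : set pt) : exists x : (pt * pt) * (pt * pt), four_point_circles S X ->
    [/\ x.1.1 \in S, x.1.2 \in S, x.2.1 \in S & x.2.2 \in S] /\
    [/\ X x.1.1, X x.1.2, X x.2.1 & concyc x.1.1 x.1.2 x.2.1 x.2.2].
  case: (pselect (four_point_circles S X)) => [/circle_points [x hx]|nX]; first by exists x.
  by exists ((0, 0), (0, 0)).
have [g hg] := @choice _ _ _ T.
apply: (@atmost_sub _ _ _ _ _ (fun X hX => hX)); last first.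
  apply: (@atmost_inj _ _ _ _ g _ _ _ both).
  - move=> X Y hX hY e; have [_ [x1 x2 x3 c]] := hg X hX; have [_ [y1 y2 y3 _]] := hg Y hY.
    rewrite -e in y1 y2 y3.
    exact: circle_determined hX.1 hY.1 c x1 x2 x3 y1 y2 y3.
  move=> X hX; have [[s1 s2 s3 s4] [_ _ _ c]] := hg X hX.
  case: (pselect (exists o, [/\ center gs o, on_line o (g X).1.1 (g X).1.2 & on_line o (g X).2.1 (g X).2.2])) => ho.
    by right.
  by left; split; [rewrite [(g X).1]surjective_pairing; exact: memU|
    rewrite [(g X).2]surjective_pairing; exact: memU|split].
(* As [m] is positive, the quadratic contribution of the centres is absorbed by the main term. *)
rewrite mulnDl leq_add // -/Nc sP leq_mul2l; apply/orP; right.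
by rewrite mulnn leq_pmulr // ltn_addl // expn_gt0 m0.
Qed.
End Assembly.

Lemma atmost_finite_set (T : choiceType) (A : set T) N : atmost N A ->
  finite_set A /\ (#|` fset_set A| <= N)%N.
Proof.
move=> hA; have [l [sl hl]] := atmost_list hA.
have fA : finite_set A by apply: (@sub_finite_set _ A [set` l]) => //; exact: finite_seq.
split=> //; apply: hA; first exact: fset_uniq.
move=> x xA; have : x \in fset_set A by [].
by rewrite in_fset_set // inE.
Qed.

(* [m] and [r] are rounded from [n `^ (1/3)] and [n `^ (2/3)]. *)
Lemma eight_thirds (R : realType) (n : nat) : exists m r : nat, [/\ (0 < m)%N, (n <= m * r)%N &
  (n ^ 2 * (r + m ^ 2))%:R <= 6 * (n%:R `^ (8%:R / 3%:R)) :> R].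
Proof.
have [->|n0] := eqVneq n 0%N.
  by exists 1%N, 0%N; split=> //; rewrite exp0n // mul0n mulr_ge0 // powR_ge0.
have n1 : 1 <= n%:R :> R by rewrite ler1n lt0n.
pose x : R := n%:R `^ (3%:R^-1).
have x0 : 0 <= x by exact: powR_ge0.
have x3 : x ^+ 3 = n%:R.
  by rewrite -powR_mulrn // -powRrM mulVf ?pnatr_eq0 // powRr1 // ler0n.
have x8 : n%:R `^ (8%:R / 3%:R) = x ^+ 8.
  by rewrite mulrC powRrM powR_mulrn.
have x1 : 1 <= x.
  by rewrite -(@ler_pXn2r _ 3) ?nnegrE ?ler01 // x3 expr1n.
have xx0 : 0 <= x ^+ 2 by rewrite exprn_ge0.
have /andP[m1 m2] := truncn_itv x0; have /andP[r1 r2] := truncn_itv xx0.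
(* Rounding up keeps [n <= m * r]. Since [x >= 1], it at most doubles [x] and [x ^+ 2], whence
   [6 = 2 + 4], from [r] and from [m ^+ 2]. *)
exists (Num.Def.trunc x).+1, (Num.Def.trunc (x ^+ 2)).+1; split=> //.
  rewrite -(ler_nat R) natrM -x3 exprS.
  by apply: ler_pM; [exact: x0|exact: xx0|exact: ltW m2|exact: ltW r2].
rewrite x8 natrM natrX natrD natrX -x3.
set m : R := (Num.Def.trunc x).+1%:R; set r : R := (Num.Def.trunc (x ^+ 2)).+1%:R.
have mx : m <= 2 * x by rewrite /m -natr1; lra.
have xx1 : 1 <= x ^+ 2 by rewrite exprn_ege1.
have rx : r <= 2 * x ^+ 2 by rewrite /r -natr1; lra.
have m2x : m ^+ 2 <= 4 * x ^+ 2.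
  have -> : 4 * x ^+ 2 = (2 * x) ^+ 2 by ring.
  by rewrite ler_pXn2r ?nnegrE ?mulr_ge0 ?ler0n.
have -> : 6 * x ^+ 8 = (x ^+ 3) ^+ 2 * (6 * x ^+ 2) by ring.
by rewrite ler_wpM2l ?exprn_ge0 //; lra.
Qed.

Theorem corollary4p2 (R : realType) (d : nat) :
  exists K : R, forall (C : set (R[i] * R[i])) (S : {fset R[i] * R[i]}),
    curve_of_degree C d ->
    ~ (exists (D : set (R[i] * R[i])) (e : nat),
         [/\ curve_of_degree D e, (e <= 4)%N & D `<=` C]) ->
    [set` S] `<=` C ->
    finite_set (four_point_circles S) /\
    #|` fset_set (four_point_circles S)|%:R <= K * (#|` S|%:R `^ (8%:R / 3%:R)).
Proof.
have [K hK] := @four_point_circles_atmost R d; exists (K%:R * 6) => C S dC nC SC.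
have [m [r [m0 hn le]]] := eight_thirds R #|` S|.
have [fin card] := atmost_finite_set (hK C S m r dC nC SC m0 hn); split; first exact: fin.
apply: le_trans (_ : (K * (#|` S| ^ 2 * (r + m ^ 2)))%:R <= _); first by rewrite ler_nat.
by rewrite natrM -mulrA ler_wpM2l // ler0n.
Qed.
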